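(* Let $\nu>0$ and $\alpha\in\mathbb{R}$. The Bargmann transform $\mathcal{A}_\nu$ maps the orthonormal basis $(\varphi_n^{\alpha})_{n\in\mathbb{Z}}$ of the Hilbert space $\mathcal{L}^2_{\sqrt2\mathbb{Z},\alpha}(\mathbb{R})$ onto the orthonormal basis $(\psi_n^{\alpha,\nu})_{n\in\mathbb{Z}}$ of the Hilbert space $\mathcal{F}^{2,\nu}_{\alpha}(\mathbb{C})$; consequently $\mathcal{A}_\nu$ is an isometric embedding from $\mathcal{L}^2_{\sqrt2\mathbb{Z},\alpha}(\mathbb{R})$ into $\mathcal{F}^{2,\nu}_{\alpha}(\mathbb{C})$.
   Context: $\mathcal{L}^2_{\sqrt2\mathbb{Z},\alpha}(\mathbb{R})$ is the Hilbert space of (classes of) measurable functions $\varphi:\mathbb{R}\to\mathbb{C}$ with $\varphi(q+\sqrt2 m)=e^{2i\pi\alpha m}\varphi(q)$ for almost every $q\in\mathbb{R}$ and all $m\in\mathbb{Z}$, and $\int_0^{\sqrt2}|\varphi(q)|^2dq<+\infty$, with the norm given by the square root of this integral. Its orthonormal basis is $\varphi_n^{\alpha}(q)=2^{-1/4}e^{\sqrt2 i\pi(n+\alpha)q}$, $n\in\mathbb{Z}$. $\mathcal{F}^{2,\nu}_{\alpha}(\mathbb{C})$ is the Hilbert space of entire functions $f$ with $f(z+m)=e^{2i\pi\alpha m}e^{\nu(z+\frac m2)m}f(z)$ for all $z\in\mathbb{C}$, $m\in\mathbb{Z}$, and $\|f\|_\nu^2=\int_{[0,1]\times\mathbb{R}}|f(x+iy)|^2e^{-\nu(x^2+y^2)}dx\,dy<+\infty$.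 Its orthonormal basis is $$\psi_n^{\alpha,\nu}(z)=\left(\frac{2\nu}{\pi}\right)^{1/4}e^{\frac{\nu}{2}z^2}e^{-\frac{\pi^2}{\nu}(n+\alpha)^2+2i\pi(\alpha+n)z},\qquad n\in\mathbb{Z}.$$ The Bargmann transform is $$[\mathcal{A}_\nu\varphi](z)=\left(\frac{\nu}{\pi}\right)^{3/4}\int_{-\infty}^{+\infty}\varphi(q)\,e^{-\frac{\nu}{2}(z^2+q^2)+\nu\sqrt2 zq}\,dq,\qquad z\in\mathbb{C},$$ whenever the integral exists. *)

(* Defs.v *)
From HB Require Import structures.
From mathcomp Require Import all_boot all_order all_algebra.
From mathcomp Require Import all_classical all_reals all_analysis.
From mathcomp Require Import complex.

Set Implicit Arguments.
Unset Strict Implicit.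
Unset Printing Implicit Defensive.
Import Order.TTheory GRing.Theory Num.Theory.
Import numFieldNormedType.Exports.

Local Open Scope classical_set_scope.
Local Open Scope ring_scope.
Local Open Scope complex_scope.

Section Complex.
Variable R : realType.

(* The complex exponential, by Euler's formula. *)
Definition cexp (z : R[i]) : R[i] :=
  (expR (complex.Re z))%:C * (cos (complex.Im z) +i* sin (complex.Im z)).

Definition cabs2 (z : R[i]) : R := complex.Re z ^+ 2 + complex.Im z ^+ 2.

(* Differentiability is over the field R[i], so this is holomorphy on R[i]. *)
Definition entire (f : R[i] -> R[i]) : Prop :=
  forall z : R[i], derivable (f : R[i]^o -> R[i]^o) z 1.

End Complex.

Section ComplexIntegral.
Context d (T : measurableType d) (R : realType).
Variables (mu : {measure set T -> \bar R}) (D : set T).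

Definition cintegrable (f : T -> R[i]) : Prop :=
  mu.-integrable D (EFin \o (@complex.Re R \o f)) /\
  mu.-integrable D (EFin \o (@complex.Im R \o f)).

Definition cintegral (f : T -> R[i]) : R[i] :=
  Rintegral mu D (@complex.Re R \o f) +i* Rintegral mu D (@complex.Im R \o f).

End ComplexIntegral.

Section FunctionSpaces.
Variable R : realType.

(* A basis is an orthonormal family whose finite linear combinations are dense;
   the members of a function space H are honest functions, possibly standing
   for their almost-everywhere classes, so [nrm] may be only a seminorm. *)
Definition orthonormal_basis (T : Type) (H : set (T -> R[i]))
    (ip : (T -> R[i]) -> (T -> R[i]) -> R[i]) (nrm : (T -> R[i]) -> R)
    (b : int -> T -> R[i]) : Prop :=
  [/\ forall n, H (b n),
      forall m n, ip (b m) (b n) = (m == n)%:R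
    & forall f, H f -> forall e : R, 0 < e ->
        exists (s : seq int) (c : int -> R[i]),
          nrm (fun x => f x - \sum_(n <- s) c n * b n x) < e].

(* [eqS] is the equality of the classes in S, so that the second clause says
   that A is well defined and injective on classes. *)
Definition isometric_embedding (X Y : Type)
    (S : set (X -> R[i])) (eqS : (X -> R[i]) -> (X -> R[i]) -> Prop)
    (nrmS : (X -> R[i]) -> R)
    (H : set (Y -> R[i])) (nrmH : (Y -> R[i]) -> R)
    (A : (X -> R[i]) -> Y -> R[i]) : Prop :=
  [/\ forall f, S f -> H (A f),
      forall f g, S f -> S g -> (eqS f g <-> A f = A g),
      forall (c : R[i]) f g, S f -> S g ->
        A (fun x => c * f x + g x) = (fun y => c * A f y + A g y)
    & forall f, S f -> nrmH (A f) = nrmS f].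

End FunctionSpaces.

Section Bargmann.
Variable R : realType.
Local Notation mu := (@lebesgue_measure R).
Local Notation sqrt2 := (Num.sqrt (2 : R)).
Implicit Types (nu alpha : R).

(* Representatives are Borel measurable: every Lebesgue measurable function
   agrees with one almost everywhere. *)
Definition quasi_periodic_L2 alpha : set (R -> R[i]) :=
  [set phi : R -> R[i] | [/\ measurable_fun setT (@complex.Re R \o phi),
      measurable_fun setT (@complex.Im R \o phi),
      (forall m : int, \forall q \ae mu,
         phi (q + sqrt2 * m%:~R) =
         cexp ('i%C * (2 * pi * alpha * m%:~R)%:C) * phi q)
    & (\int[mu]_(q in `[0%R, sqrt2]) (cabs2 (phi q))%:E < +oo)%E]].

Definition L2_ip (f g : R -> R[i]) : R[i] :=
  cintegral mu `[0, sqrt2] (fun q => f q * (g q)^*%C).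

Definition L2_norm (f : R -> R[i]) : R :=
  Num.sqrt (Rintegral mu `[0, sqrt2] (fun q => cabs2 (f q))).

Definition ae_equal (f g : R -> R[i]) : Prop := \forall q \ae mu, f q = g q.

Definition L2_basis alpha (n : int) (q : R) : R[i] :=
  (2 `^ (- 4^-1))%:C * cexp ('i%C * (sqrt2 * pi * (n%:~R + alpha) * q)%:C).

(* [0,1] x R, the point (x, y) standing for x + iy. *)
Definition strip : set (R * R) := `[0, 1] `*` setT.
Local Notation mu2 := (mu \x mu)%E.

Definition fock_weight nu (p : R * R) : R :=
  expR (- (nu * (p.1 ^+ 2 + p.2 ^+ 2))).

Definition quasi_periodic_fock nu alpha : set (R[i] -> R[i]) :=
  [set f : R[i] -> R[i] | [/\ entire f,
      (forall (z : R[i]) (m : int),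
         f (z + m%:~R) =
         cexp ('i%C * (2 * pi * alpha * m%:~R)%:C) *
         cexp (nu%:C * (z + m%:~R / 2) * m%:~R) * f z)
    & (\int[mu2]_(p in strip)
         (cabs2 (f (p.1 +i* p.2)) * fock_weight nu p)%:E < +oo)%E]].

Definition fock_ip nu (f g : R[i] -> R[i]) : R[i] :=
  cintegral mu2 strip (fun p =>
    f (p.1 +i* p.2) * (g (p.1 +i* p.2))^*%C * (fock_weight nu p)%:C).

Definition fock_norm nu (f : R[i] -> R[i]) : R :=
  Num.sqrt (Rintegral mu2 strip (fun p =>
    cabs2 (f (p.1 +i* p.2)) * fock_weight nu p)).

Definition fock_basis nu alpha (n : int) (z : R[i]) : R[i] :=
  ((2 * nu / pi) `^ 4^-1)%:C * cexp (nu%:C / 2 * z ^+ 2) *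
  cexp ((- (pi ^+ 2 / nu * (n%:~R + alpha) ^+ 2))%:C +
        'i%C * (2 * pi * (alpha + n%:~R))%:C * z).

Definition bargmann_integrand nu (phi : R -> R[i]) (z : R[i]) (q : R) : R[i] :=
  phi q * cexp (- (nu%:C / 2 * (z ^+ 2 + q%:C ^+ 2)) +
                (nu * sqrt2)%:C * z * q%:C).

Definition bargmann nu (phi : R -> R[i]) (z : R[i]) : R[i] :=
  ((nu / pi) `^ (3 / 4))%:C * cintegral mu setT (bargmann_integrand nu phi z).

(* [bargmann] is meaningful only where this holds: [cintegral] is total. *)
Definition bargmann_exists nu (phi : R -> R[i]) : Prop :=
  forall z : R[i], cintegrable mu setT (bargmann_integrand nu phi z).

End Bargmann.

(* Main.v *)
Require Import Defs.
From HB Require Import structures.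
From mathcomp Require Import all_boot all_order all_algebra.
From mathcomp Require Import all_classical all_reals all_analysis.
From mathcomp Require Import measurable_realfun complex.
From mathcomp Require Import ring lra zify.

Set Implicit Arguments.
Unset Strict Implicit.
Unset Printing Implicit Defensive.
Import Order.TTheory GRing.Theory Num.Theory.
Import numFieldNormedType.Exports.
Local Open Scope classical_set_scope.
Local Open Scope ring_scope.
Local Open Scope complex_scope.

(** The mechanism is that the Bargmann transform A turns translations of the line
    by sqrt 2 t into translations of the plane by t, up to an explicit exponential
    factor ([bargmann_translation]). The basis function phi_n is an eigenvector of
    all real translations, so A phi_n, which is entire, satisfies the same law
    along the real axis as psi_n does. The quotient of the two is therefore entire
    and constant on horizontal lines, hence constant
    ([entire_horizontally_constant]); at the point of the imaginary axis where the
    exponent of the integrand becomes real, it is a Gaussian integral, and equals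
    1 ([bargmann_L2_basis]).

    The transform makes sense because quasi-periodicity makes the modulus of phi
    periodic: cutting the line into periods, the integral of |phi| against
    exp (- |q|) is at most a constant times its integral over one period
    ([periodization_le]), and the Gaussian kernel beats every exponential. What is
    left is a Laplace transform, entire by differentiation under the integral sign
    ([entire_laplace]).

    Since A carries phi_n to psi_n and both families are orthonormal, A preserves
    the norm of finite combinations. For a general phi, the values at a point of
    the transforms of the partial Fourier sums converge ([bargmann_small]), so that
    Fatou's lemma and Bessel's inequality show that A is a contraction. Applied to
    the error of a partial Fourier sum, this contraction property yields equality
    of the norms ([bargmann_isometry]), and with it that A phi lies in the Fock
    space and that A is injective on classes.

    Two completeness statements remain. For the exponentials in L2 of an interval
    ([twisted_density]), the polynomials (1 - w ^ n) ^ (2 ^ n) in a trigonometric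
    polynomial w approximate indicators of intervals; a lambda-system argument
    extends this to Borel sets, and simple functions to all of L2. For the psi_n
    ([fock_basis_dense]), a function f of the Fock space is multiplied by
    exp (- nu z ^ 2 / 2), which makes it periodic up to a phase on each
    horizontal line. By Cauchy's theorem on rectangles ([goursat]) its Fourier
    coefficients at height y depend on y through the explicit exponential that psi_n
    prescribes, so the Fourier sums of all the slices at once are the slices of one
    combination of the psi_n. The slice errors tend to 0 and are dominated by the
    slice norms of f; dominated convergence over the heights concludes. The same
    slices show that the psi_n are orthonormal: along a slice they are multiples of
    distinct exponentials, and the mass at height y is a normal density in y. *)

(** * Complex numbers and holomorphy *)

Section ComplexModulus.
Variable R : realType.
Implicit Types (x y z w : R[i]) (r t : R).
Local Notation Re := (@complex.Re R).
Local Notation Im := (@complex.Im R).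

Lemma complex_ext z w : Re z = Re w -> Im z = Im w -> z = w.
Proof. by case: z w => a b [c d] /= -> ->. Qed.

Lemma cReD z w : Re (z + w) = Re z + Re w. Proof. by case: z w => a b []. Qed.
Lemma cImD z w : Im (z + w) = Im z + Im w. Proof. by case: z w => a b []. Qed.
Lemma cReN z : Re (- z) = - Re z. Proof. by case: z. Qed.
Lemma cImN z : Im (- z) = - Im z. Proof. by case: z. Qed.
Lemma cReM z w : Re (z * w) = Re z * Re w - Im z * Im w.
Proof. by case: z w => a b []. Qed.
Lemma cImM z w : Im (z * w) = Re z * Im w + Im z * Re w.
Proof. by case: z w => a b []. Qed.
Lemma cReJ z : Re z^*%C = Re z. Proof. by case: z. Qed.
Lemma cImJ z : Im z^*%C = - Im z. Proof. by case: z. Qed.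
Lemma cRe0 : Re 0 = 0. Proof. by []. Qed.
Lemma cIm0 : Im 0 = 0. Proof. by []. Qed.
Lemma cRe1 : Re 1 = 1. Proof. by []. Qed.
Lemma cIm1 : Im 1 = 0. Proof. by []. Qed.

Lemma intC (m : int) : (m%:~R : R[i]) = (m%:~R : R)%:C.
Proof. by rewrite rmorph_int. Qed.
Lemma natC (m : nat) : (m%:R : R[i]) = (m%:R : R)%:C.
Proof. by rewrite rmorph_nat. Qed.
Lemma cReInt (m : int) : Re m%:~R = m%:~R. Proof. by rewrite intC. Qed.
Lemma cImInt (m : int) : Im m%:~R = 0. Proof. by rewrite intC. Qed.

Lemma cRe_half z : Re (z / 2) = Re z / 2.
Proof.
have -> : (2 : R[i])^-1 = (2^-1 : R)%:C by rewrite natC -fmorphV.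
by rewrite cReM /= mulr0 subr0.
Qed.
Lemma cIm_half z : Im (z / 2) = Im z / 2.
Proof.
have -> : (2 : R[i])^-1 = (2^-1 : R)%:C by rewrite natC -fmorphV.
by rewrite cImM /= mulr0 add0r.
Qed.

Definition reimE := (cRe_half, cIm_half, cReD, cImD, cReN, cImN, cReM, cImM, cReJ, cImJ,
  cReInt, cImInt, cRe0, cIm0, cRe1, cIm1).

Lemma conjc_mul z w : (z * w)^*%C = z^*%C * w^*%C.
Proof. by apply: complex_ext; rewrite !reimE; ring. Qed.

Lemma real_complexM r t : (r * t)%:C = r%:C * t%:C :> R[i].
Proof. by rewrite rmorphM. Qed.

Lemma cabs2_ge0 z : 0 <= cabs2 z.
Proof. by rewrite addr_ge0 ?sqr_ge0. Qed.

Lemma cabs2_eq0 z : cabs2 z = 0 -> z = 0.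
Proof.
move=> /eqP; rewrite paddr_eq0 ?sqr_ge0// !sqrf_eq0 => /andP[/eqP a /eqP b].
exact: complex_ext.
Qed.

Lemma cabs2_0 : cabs2 (0 : R[i]) = 0.
Proof. by rewrite /cabs2 /= expr0n /= addr0. Qed.

Lemma cabs2M z w : cabs2 (z * w) = cabs2 z * cabs2 w.
Proof. by rewrite /cabs2 !reimE; ring. Qed.

Lemma cabs2N z : cabs2 (- z) = cabs2 z.
Proof. by rewrite /cabs2 !reimE !sqrrN. Qed.

Lemma cabs2J z : cabs2 z^*%C = cabs2 z.
Proof. by rewrite /cabs2 !reimE sqrrN. Qed.

Lemma cabs2_real r : cabs2 r%:C = r ^+ 2.
Proof. by rewrite /cabs2 /= expr0n /= addr0. Qed.

Lemma mulcJ z : z * z^*%C = (cabs2 z)%:C.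
Proof. by apply: complex_ext; rewrite !reimE /cabs2 /=; ring. Qed.

(** The coefficients 1 + t and 1 + 1 / t make this sharp enough for limits t -> 0,
    without square roots. *)
Lemma cabs2D_le t z w : 0 < t ->
  cabs2 (z + w) <= (1 + t) * cabs2 z + (1 + t^-1) * cabs2 w.
Proof.
move=> t0; rewrite /cabs2 !reimE.
have key (a b : R) : (a + b) ^+ 2 <= (1 + t) * a ^+ 2 + (1 + t^-1) * b ^+ 2.
  rewrite -subr_ge0.
  have -> : (1 + t) * a ^+ 2 + (1 + t^-1) * b ^+ 2 - (a + b) ^+ 2 =
            t^-1 * (t * a - b) ^+ 2 by field; rewrite gt_eqF.
  by rewrite mulr_ge0 ?sqr_ge0// invr_ge0 ltW.
have := key (Re z) (Re w); have := key (Im z) (Im w); lra.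
Qed.

Definition cabs z : R := Num.sqrt (cabs2 z).

Lemma cabs_normc z : `|z| = (cabs z)%:C.
Proof. by rewrite normc_def. Qed.

Lemma cabs_ge0 z : 0 <= cabs z. Proof. exact: sqrtr_ge0. Qed.

Lemma sqr_cabs z : cabs z ^+ 2 = cabs2 z.
Proof. by rewrite sqr_sqrtr ?cabs2_ge0. Qed.

Lemma cabsM z w : cabs (z * w) = cabs z * cabs w.
Proof. by rewrite /cabs cabs2M sqrtrM ?cabs2_ge0. Qed.

Lemma cabsN z : cabs (- z) = cabs z. Proof. by rewrite /cabs cabs2N. Qed.

Lemma cabs_real r : cabs r%:C = `|r|.
Proof. by rewrite /cabs cabs2_real sqrtr_sqr. Qed.

Lemma cabs0 : cabs 0 = 0. Proof. by rewrite /cabs cabs2_0 sqrtr0. Qed.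

Lemma cabsD z w : cabs (z + w) <= cabs z + cabs w.
Proof. by rewrite -lecR rmorphD /= -!cabs_normc ler_normD. Qed.

Lemma Re_le_cabs z : `|Re z| <= cabs z.
Proof. by rewrite -sqrtr_sqr ler_wsqrtr// lerDl sqr_ge0. Qed.

Lemma Im_le_cabs z : `|Im z| <= cabs z.
Proof. by rewrite -sqrtr_sqr ler_wsqrtr// lerDr sqr_ge0. Qed.

Lemma cabs_le_ReIm z : cabs z <= `|Re z| + `|Im z|.
Proof.
rewrite /cabs -[leRHS]ger0_norm ?addr_ge0// -sqrtr_sqr ler_wsqrtr// /cabs2.
rewrite sqrrD -!normrX (ger0_norm (sqr_ge0 (Re z))) (ger0_norm (sqr_ge0 (Im z))).
by rewrite addrAC lerDl mulrn_wge0// mulr_ge0.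
Qed.

Lemma cabs_le_cabs2 t z : 0 < t -> cabs z <= (t + cabs2 z / t) / 2.
Proof.
move=> t0; rewrite -sqr_cabs ler_pdivlMr// -subr_ge0.
have -> : t + cabs z ^+ 2 / t - cabs z * 2 = (t - cabs z) ^+ 2 / t.
  by field; rewrite gt_eqF.
by rewrite divr_ge0 ?sqr_ge0// ltW.
Qed.

End ComplexModulus.
Arguments reimE {R}.

Section ComplexExponential.
Variable R : realType.
Implicit Types (z w : R[i]) (r t : R).
Local Notation Re := (@complex.Re R).
Local Notation Im := (@complex.Im R).

Lemma Re_cexp z : Re (cexp z) = expR (Re z) * cos (Im z).
Proof. by rewrite /cexp cReM /= mul0r subr0. Qed.

Lemma Im_cexp z : Im (cexp z) = expR (Re z) * sin (Im z).
Proof. by rewrite /cexp cImM /= mul0r addr0. Qed.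

(* The rules for cexp come first: the rule for products also matches it, up to
   unfolding. *)
Definition creimE := (Re_cexp, Im_cexp, @reimE R).

Lemma cexpD z w : cexp (z + w) = cexp z * cexp w.
Proof.
apply: complex_ext; rewrite !creimE expRD ?cosD ?sinD; ring.
Qed.

Lemma cexp_real r : cexp r%:C = (expR r)%:C.
Proof.
by apply: complex_ext; rewrite ?Re_cexp ?Im_cexp /= ?cos0 ?sin0 ?mulr1 ?mulr0.
Qed.

Lemma cexp0 : cexp (0 : R[i]) = 1.
Proof. by rewrite (_ : 0 = (0 : R)%:C)// cexp_real expR0. Qed.

Lemma cabs2_cexp z : cabs2 (cexp z) = expR (2 * Re z).
Proof.
rewrite /cabs2 Re_cexp Im_cexp !exprMn -mulrDr cos2Dsin2 mulr1.
by rewrite expRM_natl.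
Qed.

Lemma cabs_cexp z : cabs (cexp z) = expR (Re z).
Proof.
by rewrite /cabs cabs2_cexp expRM_natl sqrtr_sqr ger0_norm ?expR_ge0.
Qed.

Lemma cexpN z : cexp (- z) * cexp z = 1.
Proof. by rewrite -cexpD addNr cexp0. Qed.

Lemma cexpJ z : (cexp z)^*%C = cexp z^*%C.
Proof.
by apply: complex_ext; rewrite !creimE ?cosN ?sinN ?mulrN.
Qed.

Lemma cexp_2pi (m : int) : cexp ('i%C * (2 * pi * m%:~R : R)%:C) = 1.
Proof.
have natcase (n : nat) : cexp ('i%C * (2 * pi * n%:R : R)%:C) = 1.
  elim: n => [|n IH]; first by rewrite mulr0 (_ : 'i%C * _ = 0) ?cexp0// mulr0.
  have -> : 'i%C * (2 * pi * n.+1%:R : R)%:C =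
    'i%C * (2 * pi * n%:R)%:C + 'i%C * (pi *+ 2)%:C.
    by rewrite -mulrDr -rmorphD /= -natr1; congr (_ * (_)%:C); ring.
  rewrite cexpD IH mul1r.
  apply: complex_ext; rewrite !creimE /= !mul0r ?mulr0 subr0
   add0r mul1r expR0 mul1r ?cos2pi ?sin2pi//.
case: m => n; first exact: natcase.
have := cexpN ('i%C * (2 * pi * (n.+1)%:R : R)%:C); rewrite natcase mulr1 => <-.
by congr cexp; rewrite NegzE mulrNz mulrN rmorphN /= mulrN.
Qed.

End ComplexExponential.

Section ComplexDerivative.
Variable R : realType.
Implicit Types (z w h d : R[i]) (f g : R[i] -> R[i]).
Local Notation Re := (@complex.Re R).
Local Notation Im := (@complex.Im R).

(** Complex differentiability as a linear approximation: with no quotient and a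
    real modulus, it is directly comparable with estimates on integrals. *)
Definition cderiv f z d := forall e : R, 0 < e -> exists2 r : R, 0 < r &
  forall h, cabs h < r -> cabs (f (z + h) - f z - d * h) <= e * cabs h.

Lemma entireP f : entire f <-> forall z, exists d, cderiv f z d.
Proof.
split=> [ef z|df z].
- have /cvg_ex[/= d dP] := ef z; exists d => e e0.
  have eC : 0 < (e%:C : R[i]) by rewrite ltcR.
  have [r /= r0 rP] := (@cvgrPdist_le _ _ _ _ _ _ _).1 dP _ eC.
  have [r' r'0 rE] : exists2 r', 0 < r' & r = r'%:C.
    case: r r0 {rP} => a b; rewrite ltcE /= => /andP[/eqP-> a0].
    by exists a.
  exists r' => // h hr; have [->|h0] := eqVneq h 0.
    by rewrite addr0 subrr mulr0 subr0 !cabs0 mulr0.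
  have := rP h; rewrite /ball_ /= sub0r normrN cabs_normc rE ltcR => /(_ hr h0).
  rewrite cabs_normc lecR /GRing.scale /= mulr1 => hle.
  have -> : f (z + h) - f z - d * h = - (d - h^-1 * (f (h + z) - f z)) * h.
    by rewrite mulNr mulrBl mulrAC mulVf// mul1r opprB addrC (addrC h) addrC.
  by rewrite cabsM cabsN ler_wpM2r// cabs_ge0.
- apply/cvg_ex; have [d dP] := df z; exists d.
  apply/(@cvgrPdist_le _ (R[i]^o)) => e e0.
  have [e' e'0 ->] : exists2 e', 0 < e' & e = e'%:C.
    case: e e0 => a b; rewrite ltcE /= => /andP[/eqP-> a0].
    by exists a.
  have [r r0 rP] := dP _ e'0.
  exists (r%:C : R[i]) => /=; first by rewrite ltcR.
  move=> h; rewrite /ball_ /= sub0r normrN cabs_normc ltcR => hr h0.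
  rewrite cabs_normc lecR /GRing.scale /= mulr1.
  have := rP h hr.
  have -> : f (z + h) - f z - d * h = - (d - h^-1 * (f (h + z) - f z)) * h.
    by rewrite mulNr mulrBl mulrAC mulVf// mul1r opprB addrC (addrC h) addrC.
  rewrite cabsM cabsN ler_pM2r// lt_neqAle cabs_ge0 andbT eq_sym.
  by apply: contra h0 => /eqP/(congr1 (fun r : R => r%:C)); rewrite -cabs_normc
    => /eqP; rewrite normr_eq0.
Qed.

Lemma entireM f g : entire f -> entire g -> entire (fun z => f z * g z).
Proof. by move=> ef eg z; apply: (@derivableM _ _ (f : R[i]^o -> R[i])). Qed.

Lemma entireD f g : entire f -> entire g -> entire (fun z => f z + g z).
Proof. by move=> ef eg z; apply: (@derivableD _ (R[i]^o) (R[i]^o)). Qed.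

Lemma entire_cst (c : R[i]) : entire (fun=> c).
Proof. by move=> z; apply: (@derivable_cst _ (R[i]^o) (R[i]^o)). Qed.

Lemma entire_id : entire (@id R[i]).
Proof. by move=> z; apply: (@derivable_id _ (R[i]^o)). Qed.

Lemma entire_comp f g : entire f -> entire g -> entire (g \o f).
Proof.
move=> ef eg z; apply/(@derivable1_diffP _ (R[i]^o)).
apply: (@differentiable_comp _ (R[i]^o) (R[i]^o) (R[i]^o)).
  exact/(@derivable1_diffP _ (R[i]^o)).
exact/(@derivable1_diffP _ (R[i]^o)).
Qed.

Lemma mean_value_bound (f g : R -> R) (b M : R) :
  (forall x : R, is_derive x (1 : R) f (g x)) -> (forall x, `|x| <= `|b| -> `|g x| <= M) ->
  `|f b - f 0| <= `|b| * M.
Proof.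
move=> fg gM.
have df : {within `[Num.min 0 b, Num.max 0 b], continuous f}.
  apply: continuous_subspaceT => x.
  by apply: differentiable_continuous; apply/derivable1_diffP; case: (fg x).
have ab : Num.min 0 b <= Num.max 0 b by rewrite le_max !ge_min !lexx.
have [c] := @MVT_segment R f g _ _ ab (fun x _ => fg x) df.
rewrite in_itv /= => /andP[c1 c2].
have cb : `|c| <= `|b|.
  have [b0|b0] := leP 0 b.
    move: c1 c2; rewrite (min_idPl b0) (max_idPr b0) => c1 c2.
    by rewrite !ger0_norm// (le_trans c1).
  move: c1 c2; rewrite (min_idPr (ltW b0)) (max_idPl (ltW b0)) => c1 c2.
  by rewrite (ler0_norm c2) (ler0_norm (ltW b0)) lerN2.
have [b0|b0] := leP 0 b.
  rewrite subr0 => ->.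
  by rewrite normrM mulrC ler_wpM2l// gM.
move=> E.
by rewrite distrC E normrM sub0r normrN mulrC ler_wpM2l// gM.
Qed.

Lemma sin_bound (b : R) : `|sin b| <= `|b|.
Proof.
have := @mean_value_bound sin cos b 1; rewrite sin0 subr0 mulr1; apply.
by move=> x _; rewrite ler_norml cos_geN1 cos_le1.
Qed.

Lemma cos_sub1_bound (b : R) : `|cos b - 1| <= b ^+ 2.
Proof.
rewrite -(real_normK (num_real b)) expr2.
have := @mean_value_bound cos (fun x => - sin x) b `|b|; rewrite cos0; apply.
by move=> x xb; rewrite normrN (le_trans (sin_bound x)).
Qed.

Lemma sin_sub_bound (b : R) : `|sin b - b| <= `|b| * b ^+ 2.
Proof.
have := @mean_value_bound (fun x => sin x - x) (fun x => cos x - 1) b (b ^+ 2).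
rewrite sin0 !subr0; apply.
move=> x xb; rewrite (le_trans (cos_sub1_bound x))//.
by rewrite -(real_normK (num_real b)) -(real_normK (num_real x)) lerXn2r ?nnegrE.
Qed.

Lemma expR_sub1_bound (a : R) : `|expR a - 1| <= `|a| * expR `|a|.
Proof.
have := @mean_value_bound expR expR a (expR `|a|); rewrite expR0; apply.
move=> x xa; rewrite ger0_norm ?expR_ge0// ler_expR.
exact: le_trans (ler_norm _) xa.
Qed.

Lemma expR_sub_bound (a : R) : `|expR a - 1 - a| <= a ^+ 2 * expR `|a|.
Proof.
rewrite -(real_normK (num_real a)) expr2 -mulrA.
have := @mean_value_bound (fun x => expR x - 1 - x) (fun x => expR x - 1) a
  (`|a| * expR `|a|).
rewrite expR0 subrr subr0 subr0; apply.
  move=> x; apply: is_deriveB; rewrite -[X in is_derive _ _ _ X]subr0.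
  exact: is_deriveB.
move=> x xa; rewrite (le_trans (expR_sub1_bound x))//.
by rewrite ler_pM ?expR_ge0// ler_expR.
Qed.

(** The error of the first order expansion of exp; comparing the real and the
    imaginary parts with the mean value theorem loses a constant only. *)
Lemma cexp_taylor w :
  cabs (cexp w - 1 - w) <= 6 * (cabs w ^+ 2 * expR (cabs w)).
Proof.
case: w => a b; set c := cabs (a +i* b); have ac : `|a| <= c := Re_le_cabs (a +i* b).
have bc : `|b| <= c := Im_le_cabs (a +i* b).
have c0 : 0 <= c := cabs_ge0 _.
set E := expR c; have E1 : 1 <= E by rewrite /E -expR0 ler_expR.
have cE : c <= E by rewrite (le_trans _ (expR_ge1Dx _))// lerDr.
have aE : expR `|a| <= E by rewrite ler_expR.
have aE' : expR a <= E by rewrite ler_expR (le_trans (ler_norm _)).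
have a2 : a ^+ 2 <= c ^+ 2.
  by rewrite -(real_normK (num_real a)) lerXn2r ?nnegrE.
have b2 : b ^+ 2 <= c ^+ 2.
  by rewrite -(real_normK (num_real b)) lerXn2r ?nnegrE.
have c20 : 0 <= c ^+ 2 by rewrite sqr_ge0.
apply: le_trans (cabs_le_ReIm _) _; rewrite !creimE /= !oppr0 addr0.
have H1 : `|expR a * cos b - 1 - a| <= 2 * (c ^+ 2 * E).
  have -> : expR a * cos b - 1 - a = (expR a - 1 - a) + expR a * (cos b - 1).
    by ring.
  rewrite (le_trans (ler_normD _ _))// mulr_natl mulr2n lerD//.
    by rewrite (le_trans (expR_sub_bound _))// ler_pM ?sqr_ge0 ?expR_ge0.
  rewrite normrM mulrC (ger0_norm (expR_ge0 a)) ler_pM ?expR_ge0//.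
  exact: le_trans (cos_sub1_bound _) b2.
have H2 : `|expR a * sin b - b| <= 2 * (c ^+ 2 * E).
  have -> : expR a * sin b - b = (expR a - 1) * sin b + (sin b - b) by ring.
  rewrite (le_trans (ler_normD _ _))// mulr_natl mulr2n lerD//.
    rewrite normrM [leRHS](_ : _ = (c * E) * c); last by ring.
    rewrite ler_pM//; last exact: le_trans (sin_bound _) bc.
    by rewrite (le_trans (expR_sub1_bound _))// ler_pM ?expR_ge0.
  rewrite (le_trans (sin_sub_bound _))// mulrC ler_pM ?sqr_ge0//.
  exact: le_trans bc cE.
rewrite (le_trans (lerD H1 H2))// -mulrDl ler_wpM2r//; last by lra.
by rewrite mulr_ge0// (le_trans _ E1).
Qed.

Lemma entire_cexp : entire (@cexp R).
Proof.
apply/entireP => z; exists (cexp z) => e e0.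
set K := expR (complex.Re z) * 6 * expR 1.
have K0 : 0 < K by rewrite !mulr_gt0 ?expR_gt0.
exists (Num.min 1 (e / K)) => [|h]; first by rewrite lt_min ltr01 divr_gt0.
rewrite lt_min => /andP[h1 hK].
rewrite cexpD -{2}[cexp z]mulr1 -!mulrBr cabsM cabs_cexp.
have hc := cabs_ge0 h.
apply: le_trans (_ : K * cabs h * cabs h <= _); last first.
  by rewrite ler_wpM2r// mulrC -ler_pdivlMr// ltW.
rewrite /K -!mulrA ler_wpM2l ?expR_ge0//.
rewrite (le_trans (cexp_taylor h))// ler_wpM2l//.
by rewrite expr2 mulrC ler_wpM2r ?mulr_ge0// ler_expR ltW.
Qed.

(** Derivatives along the real axis vanish, hence so do the complex ones. *)
Lemma entire_horizontally_constant f : entire f ->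
  (forall z (t : R), f (z + t%:C) = f z) -> forall z w, f z = f w.
Proof.
move=> /entireP df fper.
have d0 z : cderiv f z 0.
  have [d dP] := df z; suff -> : 0 = d by [].
  apply/esym/cabs2_eq0; apply/eqP; rewrite -sqr_cabs sqrf_eq0; apply/eqP/le_anti.
  rewrite cabs_ge0 andbT; apply/ler_addgt0Pl => e e0; rewrite addr0.
  have [r r0 rP] := dP e e0.
  have r2 : `|r / 2| = r / 2 by rewrite ger0_norm// divr_ge0// ltW.
  have := rP (r / 2)%:C; rewrite cabs_real r2 fper subrr sub0r cabsN cabsM.
  rewrite cabs_real r2 ler_pM2r ?divr_gt0//; apply.
  by rewrite ltr_pdivrMr// mulr_natr mulr2n ltrDl.
have vert (x y y' : R) : f (x +i* y) = f (x +i* y').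
  have dRe (p : R[i] -> R) (pB : forall a b, p (a - b) = p a - p b)
    (pc : forall a, `|p a| <= cabs a) : p (f (x +i* y)) = p (f (x +i* y')).
    apply: (@is_derive_0_is_cst R (fun y => p (f (x +i* y)))) => {y y'} y.
    suff H : h^-1 *: (p (f (x +i* (h *: 1 + y))) - p (f (x +i* y))) @[h --> 0^']
       --> (0 : R).
      by apply: DeriveDef; [apply/cvg_ex; exists 0 | apply/cvg_lim].
    apply/cvgrPdist_le => e e0; have [r r0 rP] := d0 (x +i* y) e e0.
    exists r => //= h; rewrite /ball_ /= sub0r normrN => hr h0.
    have := rP (0 +i* h); rewrite mul0r subr0.
    have -> : cabs (0 +i* h) = `|h| by rewrite /cabs /cabs2 /= expr0n add0r sqrtr_sqr.
    have -> : (x +i* y) + (0 +i* h) = x +i* (h *: 1 + y).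
      by apply: complex_ext; rewrite !reimE /= ?addr0// /GRing.scale /= mulr1 addrC.
    move=> /(_ hr) hle; rewrite sub0r normrN /GRing.scale /= normrM normfV mulrC.
    by rewrite ler_pdivrMr ?normr_gt0// (le_trans _ hle)// -pB.
  apply: complex_ext.
    by apply: dRe => [[? ?] [? ?]//|]; exact: Re_le_cabs.
  by apply: dRe => [[? ?] [? ?]//|]; exact: Im_le_cabs.
move=> z w.
have -> : z = w + (Re z - Re w)%:C + (0 +i* (Im z - Im w)).
  by apply: complex_ext; rewrite !reimE /=; ring.
have E := fper w (Re z - Re w).
rewrite -E; case: w {E} => a b; case: z => c d /=.
rewrite (_ : _ + _ + _ = (a + (c - a)) +i* (b + (d - b))); last first.
  by apply: complex_ext; rewrite !reimE /=; ring.
rewrite (vert _ _ b); congr f.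
by apply: complex_ext; rewrite !reimE /=; ring.
Qed.

End ComplexDerivative.

(** * Complex-valued integrals and square integrable functions *)

Section ComplexIntegration.
Context d (T : measurableType d) (R : realType).
Variables (mu : {measure set T -> \bar R}) (D : set T).
Hypothesis mD : measurable D.
Implicit Types (f g h : T -> R[i]) (c : R[i]).
Local Notation Re := (@complex.Re R).
Local Notation Im := (@complex.Im R).

Definition cmeasurable f :=
  measurable_fun D (Re \o f) /\ measurable_fun D (Im \o f).

Lemma eq_cmeasurable f g : {in D, f =1 g} -> cmeasurable f -> cmeasurable g.
Proof.
move=> fg [fr fi]; split; [move: fr|move: fi]; apply: eq_measurable_fun => x xD;
by rewrite /= fg.
Qed.

Lemma cmeasurable_cst c : cmeasurable (fun=> c).
Proof. by split; exact: measurable_cst. Qed.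

Lemma cmeasurableD f g : cmeasurable f -> cmeasurable g ->
  cmeasurable (fun x => f x + g x).
Proof.
move=> [fr fi] [gr gi]; split.
  by rewrite (_ : _ \o _ = (Re \o f) \+ (Re \o g)); [exact: measurable_funD|
    apply/funext => x /=; rewrite cReD].
by rewrite (_ : _ \o _ = (Im \o f) \+ (Im \o g)); [exact: measurable_funD|
    apply/funext => x /=; rewrite cImD].
Qed.

Lemma cmeasurableM f g : cmeasurable f -> cmeasurable g ->
  cmeasurable (fun x => f x * g x).
Proof.
move=> [fr fi] [gr gi]; split.
  rewrite (_ : _ \o _ = ((Re \o f) \* (Re \o g)) \- ((Im \o f) \* (Im \o g))).
    by apply: measurable_funB; exact: measurable_funM.
  by apply/funext => x /=; rewrite cReM.
rewrite (_ : _ \o _ = ((Re \o f) \* (Im \o g)) \+ ((Im \o f) \* (Re \o g))).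
  by apply: measurable_funD; exact: measurable_funM.
by apply/funext => x /=; rewrite cImM.
Qed.

Lemma cmeasurableN f : cmeasurable f -> cmeasurable (fun x => - f x).
Proof.
move=> mf; have := cmeasurableM (cmeasurable_cst (-1)) mf.
by apply: eq_cmeasurable => x _; rewrite mulN1r.
Qed.

Lemma cmeasurableJ f : cmeasurable f -> cmeasurable (fun x => (f x)^*%C).
Proof.
move=> [fr fi]; split.
  by rewrite (_ : _ \o _ = Re \o f)//; apply/funext => x /=; rewrite cReJ.
rewrite (_ : _ \o _ = -%R \o (Im \o f)); first exact: measurableT_comp.
by apply/funext => x /=; rewrite cImJ.
Qed.

Lemma cmeasurable_sum (I : Type) (s : seq I) (f : I -> T -> R[i]) :
  (forall i, cmeasurable (f i)) -> cmeasurable (fun x => \sum_(i <- s) f i x).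
Proof.
move=> mf; elim: s => [|i s IH].
  apply: eq_cmeasurable (cmeasurable_cst 0) => x _.
  by rewrite big_nil.
apply: eq_cmeasurable (cmeasurableD (mf i) IH) => x _.
by rewrite big_cons.
Qed.

Lemma cmeasurable_real (u : T -> R) : measurable_fun D u ->
  cmeasurable (fun x => (u x)%:C).
Proof. by move=> mu_; split => //; exact: measurable_cst. Qed.

Lemma measurable_cabs2 f : cmeasurable f -> measurable_fun D (fun x => cabs2 (f x)).
Proof. by move=> [fr fi]; apply: measurable_funD; exact: measurable_funX. Qed.

Lemma measurable_cabs f : cmeasurable f -> measurable_fun D (fun x => cabs (f x)).
Proof.
move=> mf; apply: (measurableT_comp _ (measurable_cabs2 mf)).
by have := continuous_measurable_fun (@sqrt_continuous R).
Qed.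

Lemma cmeasurable_cexp f : cmeasurable f -> cmeasurable (fun x => cexp (f x)).
Proof.
move=> [fr fi]; split.
  rewrite (_ : _ \o _ = (expR \o (Re \o f)) \* (cos \o (Im \o f))).
    apply: measurable_funM; first exact: measurableT_comp.
    apply: (measurableT_comp _ fi).
    exact: continuous_measurable_fun (@continuous_cos R).
  by apply/funext => x; exact: Re_cexp.
rewrite (_ : _ \o _ = (expR \o (Re \o f)) \* (sin \o (Im \o f))).
  apply: measurable_funM; first exact: measurableT_comp.
  apply: (measurableT_comp _ fi).
  exact: continuous_measurable_fun (@continuous_sin R).
by apply/funext => x; exact: Im_cexp.
Qed.

Lemma integrable_dominated (u v : T -> R) : measurable_fun D u ->
  (forall x, D x -> `|u x| <= v x) -> mu.-integrable D (EFin \o v) ->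
  mu.-integrable D (EFin \o u).
Proof.
move=> mu_ uv; apply: le_integrable => //; first exact/measurable_EFinP.
by move=> x Dx /=; rewrite lee_fin (le_trans (uv x Dx))// ler_norm.
Qed.

Lemma ge0_integrable_lty (u : T -> R) : measurable_fun D u ->
  (forall x, D x -> 0 <= u x) -> (\int[mu]_(x in D) (u x)%:E < +oo)%E ->
  mu.-integrable D (EFin \o u).
Proof.
move=> mu_ u0 ioo; apply/integrableP; split; first exact/measurable_EFinP.
rewrite (eq_integral (EFin \o u))// => x /set_mem xD /=.
by rewrite ger0_norm ?u0.
Qed.

Lemma cintegrable_dominated f (v : T -> R) : cmeasurable f ->
  (forall x, D x -> cabs (f x) <= v x) -> mu.-integrable D (EFin \o v) ->
  cintegrable mu D f.
Proof.
move=> [fr fi] fv iv; split; apply: integrable_dominated iv => // x Dx.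
  exact: le_trans (Re_le_cabs _) (fv x Dx).
exact: le_trans (Im_le_cabs _) (fv x Dx).
Qed.

Lemma cintegrable_measurable f : cintegrable mu D f -> cmeasurable f.
Proof.
by move=> [/measurable_int/measurable_EFinP fr /measurable_int/measurable_EFinP].
Qed.

Lemma cintegrable_cabs f : cintegrable mu D f ->
  mu.-integrable D (EFin \o (fun x => cabs (f x))).
Proof.
move=> cf; have mf := cintegrable_measurable cf; case: cf => fr fi.
apply: (integrable_dominated (v := fun x => `|Re (f x)| + `|Im (f x)|)).
- exact: measurable_cabs.
- by move=> x _; rewrite ger0_norm ?cabs_ge0// cabs_le_ReIm.
- have := integrableD mD (integrable_norm fr) (integrable_norm fi).
  by apply: eq_integrable.
Qed.

Lemma cintegrableD f g : cintegrable mu D f -> cintegrable mu D g ->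
  cintegrable mu D (fun x => f x + g x).
Proof.
move=> cf cg; apply: (@cintegrable_dominated _ (fun x => cabs (f x) + cabs (g x))).
- by apply: cmeasurableD; exact: cintegrable_measurable.
- by move=> x _; exact: cabsD.
- have := integrableD mD (cintegrable_cabs cf) (cintegrable_cabs cg).
  exact: eq_integrable.
Qed.

Lemma cintegrableZ c f : cintegrable mu D f ->
  cintegrable mu D (fun x => c * f x).
Proof.
move=> cf; apply: (@cintegrable_dominated _ (fun x => cabs c * cabs (f x))).
- apply: cmeasurableM; [exact: cmeasurable_cst|exact: cintegrable_measurable].
- by move=> x _; rewrite cabsM.
- have := integrableZl mD (cabs c) (cintegrable_cabs cf).
  exact: eq_integrable.
Qed.

Lemma cintegrableN f : cintegrable mu D f -> cintegrable mu D (fun x => - f x).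
Proof.
by move=> /(cintegrableZ (-1)); under eq_fun do rewrite mulN1r.
Qed.

Lemma eq_cintegral f g : {in D, f =1 g} -> cintegral mu D f = cintegral mu D g.
Proof.
by move=> fg; rewrite /cintegral; congr (_ +i* _); apply: eq_Rintegral => x xD;
   rewrite /= fg.
Qed.

Lemma cintegralD f g : cintegrable mu D f -> cintegrable mu D g ->
  cintegral mu D (fun x => f x + g x) = cintegral mu D f + cintegral mu D g.
Proof.
move=> [fr fi] [gr gi]; apply: complex_ext; rewrite !reimE /=.
  by rewrite -RintegralD//; apply: eq_Rintegral => x _ /=; rewrite cReD.
by rewrite -RintegralD//; apply: eq_Rintegral => x _ /=; rewrite cImD.
Qed.

Lemma cintegralZ c f : cintegrable mu D f ->
  cintegral mu D (fun x => c * f x) = c * cintegral mu D f.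
Proof.
move=> [fr fi]; have Z (r : R) (u : T -> R) : mu.-integrable D (EFin \o u) ->
  mu.-integrable D (EFin \o (fun x => r * u x)).
  by move=> /(integrableZl mD r); apply: eq_integrable.
apply: complex_ext; rewrite !reimE /= -!RintegralZl//.
  rewrite -RintegralB//; try exact: Z.
  by apply: eq_Rintegral => x _ /=; rewrite cReM.
rewrite -RintegralD//; try exact: Z.
by apply: eq_Rintegral => x _ /=; rewrite cImM.
Qed.

Lemma cintegralB f g : cintegrable mu D f -> cintegrable mu D g ->
  cintegral mu D (fun x => f x - g x) = cintegral mu D f - cintegral mu D g.
Proof.
move=> cf cg; rewrite cintegralD//; last exact: cintegrableN.
congr (_ + _); rewrite -mulN1r -cintegralZ//.
by apply: eq_cintegral => x _; rewrite mulN1r.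
Qed.

(** The constant 2 spares a rotation of the integrand. *)
Lemma cabs_cintegral_le f : cintegrable mu D f ->
  cabs (cintegral mu D f) <= 2 * Rintegral mu D (fun x => cabs (f x)).
Proof.
move=> cf; have [fr fi] := cf; apply: le_trans (cabs_le_ReIm _) _.
have H (p : R[i] -> R) (pc : forall z, `|p z| <= cabs z) :
    mu.-integrable D (EFin \o (p \o f)) ->
    `|Rintegral mu D (p \o f)| <= Rintegral mu D (fun x => cabs (f x)).
  move=> ip; apply: le_trans (le_normr_Rintegral mD ip) _.
  apply: le_Rintegral => //; [exact: integrable_norm|exact: cintegrable_cabs|].
  by move=> x _; exact: pc.
rewrite mulr_natl mulr2n lerD// H//; [exact: Re_le_cabs|exact: Im_le_cabs].
Qed.

End ComplexIntegration.

Section ComplexL2.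
Context d (T : measurableType d) (R : realType).
Variables (mu : {measure set T -> \bar R}) (D : set T).
Hypothesis mD : measurable D.
Implicit Types (f g h : T -> R[i]) (c : R[i]).
Local Notation Re := (@complex.Re R).
Local Notation Im := (@complex.Im R).

(** The extended version serves as long as finiteness is not known, notably under
    Tonelli's theorem and Fatou's lemma. *)
Definition esqnorm f : \bar R := (\int[mu]_(x in D) (cabs2 (f x))%:E)%E.
Definition sqnorm f : R := Rintegral mu D (fun x => cabs2 (f x)).
Definition inner f g := cintegral mu D (fun x => f x * (g x)^*%C).
Definition square_integrable f := cmeasurable D f /\ (esqnorm f < +oo)%E.

Lemma eq_esqnorm f g : {in D, f =1 g} -> esqnorm f = esqnorm g.
Proof. by move=> fg; apply: eq_integral => x xD; rewrite fg. Qed.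

Lemma esqnorm_ge0 f : (0 <= esqnorm f)%E.
Proof. by apply: integral_ge0 => x _; rewrite lee_fin cabs2_ge0. Qed.

Lemma sqnorm_ge0 f : 0 <= sqnorm f.
Proof. by apply: Rintegral_ge0 => x _; exact: cabs2_ge0. Qed.

Lemma square_integrable_cabs2 f : square_integrable f ->
  mu.-integrable D (EFin \o (fun x => cabs2 (f x))).
Proof.
move=> [mf nf]; apply: ge0_integrable_lty => //; first exact: measurable_cabs2.
by move=> x _; exact: cabs2_ge0.
Qed.

Lemma esqnormE f : square_integrable f -> esqnorm f = (sqnorm f)%:E.
Proof.
move=> [mf nf]; rewrite /sqnorm /Rintegral fineK//.
by rewrite ge0_fin_numE// esqnorm_ge0.
Qed.

Lemma esqnormD_le (t : R) f g : 0 < t -> cmeasurable D f -> cmeasurable D g ->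
  (esqnorm (fun x => f x + g x)%R <=
   (1 + t)%:E * esqnorm f + (1 + t^-1)%:E * esqnorm g)%E.
Proof.
move=> t0 mf mg.
have m2 h : cmeasurable D h -> measurable_fun D (fun x => (cabs2 (h x))%:E).
  by move=> mh; apply/measurable_EFinP; exact: measurable_cabs2.
have i0 : 0 < t^-1 by rewrite invr_gt0.
rewrite -!ge0_integralZl//; last 6 first.
- exact: m2.
- by move=> x _; rewrite lee_fin cabs2_ge0.
- by rewrite lee_fin addr_ge0// ltW.
- exact: m2.
- by move=> x _; rewrite lee_fin cabs2_ge0.
- by rewrite lee_fin addr_ge0// ltW.
rewrite -ge0_integralD//; last 4 first.
- by move=> x _; rewrite mule_ge0// lee_fin ?cabs2_ge0// addr_ge0// ltW.
- by apply: measurable_funeM; exact: m2.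
- by move=> x _; rewrite mule_ge0// lee_fin ?cabs2_ge0// addr_ge0// ltW.
- by apply: measurable_funeM; exact: m2.
apply: ge0_le_integral => //.
- by move=> x _; rewrite lee_fin cabs2_ge0.
- by apply: m2; exact: cmeasurableD.
- by apply: emeasurable_funD; apply: measurable_funeM; exact: m2.
- by move=> x _; rewrite -!EFinM -EFinD lee_fin cabs2D_le.
Qed.

Lemma esqnormZ c f : cmeasurable D f ->
  esqnorm (fun x => c * f x) = ((cabs2 c)%:E * esqnorm f)%E.
Proof.
move=> mf; rewrite -ge0_integralZl//; last 3 first.
- by apply/measurable_EFinP; exact: measurable_cabs2.
- by move=> x _; rewrite lee_fin cabs2_ge0.
- by rewrite lee_fin cabs2_ge0.
by apply: eq_integral => x _; rewrite cabs2M EFinM.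
Qed.

Lemma square_integrableD f g : square_integrable f -> square_integrable g ->
  square_integrable (fun x => f x + g x).
Proof.
move=> [mf nf] [mg ng]; split; first exact: cmeasurableD.
apply: le_lt_trans (esqnormD_le ltr01 mf mg) _.
by rewrite lte_add_pinfty// lte_mul_pinfty// ?lee_fin ?invr1 ?addr_ge0.
Qed.

Lemma square_integrableZ c f : square_integrable f ->
  square_integrable (fun x => c * f x).
Proof.
move=> [mf nf]; split; first by apply: cmeasurableM => //; exact: cmeasurable_cst.
by rewrite esqnormZ// lte_mul_pinfty// lee_fin cabs2_ge0.
Qed.

Lemma square_integrableN f : square_integrable f ->
  square_integrable (fun x => - f x).
Proof.
by move=> /(square_integrableZ (-1)); under eq_fun do rewrite mulN1r.
Qed.

Lemma square_integrableB f g : square_integrable f -> square_integrable g ->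
  square_integrable (fun x => f x - g x).
Proof. by move=> sf /square_integrableN; exact: square_integrableD. Qed.

Lemma square_integrable0 : square_integrable (fun=> 0).
Proof.
split; first exact: cmeasurable_cst.
by rewrite /esqnorm integral0_eq// => x _; rewrite cabs2_0.
Qed.

Lemma square_integrable_sum (I : Type) (s : seq I) (c : I -> R[i])
    (b : I -> T -> R[i]) : (forall n, square_integrable (b n)) ->
  square_integrable (fun x => \sum_(n <- s) c n * b n x).
Proof.
move=> sb; elim: s => [|n s IH].
  under eq_fun do rewrite big_nil.
  exact: square_integrable0.
under eq_fun do rewrite big_cons.
by apply: square_integrableD => //; exact: square_integrableZ.
Qed.

Lemma integrable_inner f g : square_integrable f -> square_integrable g ->
  cintegrable mu D (fun x => f x * (g x)^*%C).
Proof.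
move=> sf sg; apply: (@cintegrable_dominated _ _ _ _ _ mD _
  (fun x => cabs2 (f x) + cabs2 (g x))).
- by apply: cmeasurableM; [case: sf|apply: cmeasurableJ; case: sg].
- move=> x _; rewrite cabsM {2}/cabs cabs2J -/(cabs _) -!sqr_cabs.
  have := cabs_ge0 (f x); have := cabs_ge0 (g x).
  have := sqr_ge0 (cabs (f x) - cabs (g x)); nra.
- have := integrableD mD (square_integrable_cabs2 sf) (square_integrable_cabs2 sg).
  exact: eq_integrable.
Qed.

Lemma inner_self f : inner f f = (sqnorm f)%:C.
Proof.
apply: complex_ext; rewrite /=.
  by apply: eq_Rintegral => x _ /=; rewrite mulcJ.
rewrite (eq_Rintegral mu (g := fun=> 0)) ?Rintegral_cst ?mul0r// => x _.
by rewrite /= mulcJ.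
Qed.

Lemma innerBl f g h : square_integrable f -> square_integrable g ->
  square_integrable h -> inner (fun x => f x - g x) h = inner f h - inner g h.
Proof.
move=> sf sg sh; rewrite /inner -cintegralB//; try exact: integrable_inner.
by apply: eq_cintegral => x _; rewrite mulrBl.
Qed.

Lemma innerZl c f h : square_integrable f -> square_integrable h ->
  inner (fun x => c * f x) h = c * inner f h.
Proof.
move=> sf sh; rewrite /inner -cintegralZ//; last exact: integrable_inner.
by apply: eq_cintegral => x _; rewrite mulrA.
Qed.

(** Expansion of the square, followed by completion of the square in c. *)
Lemma sqnormB_scaled c f b : square_integrable f -> square_integrable b ->
  sqnorm b = 1 -> sqnorm (fun x => f x - c * b x) =
  sqnorm f - cabs2 (inner f b) + cabs2 (c - inner f b).
Proof.
move=> sf sb b1.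
have iZ (r : R) (u : T -> R) : mu.-integrable D (EFin \o u) ->
  mu.-integrable D (EFin \o (fun x => r * u x)).
  by move=> /(integrableZl mD r); apply: eq_integrable.
have iB (u v : T -> R) : mu.-integrable D (EFin \o u) ->
  mu.-integrable D (EFin \o v) ->
  mu.-integrable D (EFin \o (fun x => u x - v x)).
  by move=> iu iv; have := integrableB mD iu iv; apply: eq_integrable.
have [ir ii] := integrable_inner sf sb.
have if2 := square_integrable_cabs2 sf; have ib2 := square_integrable_cabs2 sb.
rewrite /sqnorm (eq_Rintegral mu (g := fun x => (cabs2 (f x) -
  (2 * Re c) * (Re \o (fun x => f x * (b x)^*%C)) x) -
  ((2 * Im c) * (Im \o (fun x => f x * (b x)^*%C)) x -
    cabs2 c * cabs2 (b x)))); last first.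
  by move=> x _; rewrite /cabs2 /= !reimE; ring.
rewrite RintegralB//; [|exact: iB (iZ _ _ ir)|exact: iB (iZ _ _ ii) (iZ _ _ ib2)].
rewrite !RintegralB//; try exact: iZ.
rewrite !RintegralZl// -/(sqnorm f) -/(sqnorm b) b1 mulr1.
have -> : Rintegral mu D (Re \o (fun x => f x * (b x)^*%C)) = Re (inner f b) by [].
have -> : Rintegral mu D (Im \o (fun x => f x * (b x)^*%C)) = Im (inner f b) by [].
by rewrite /cabs2 !reimE; ring.
Qed.

Lemma inner_sum (I : eqType) (b : I -> T -> R[i]) (s : seq I) (c : I -> R[i]) m :
  (forall n, square_integrable (b n)) ->
  (forall m n, inner (b m) (b n) = (m == n)%:R) -> m \notin s ->
  forall f, square_integrable f ->
  inner (fun x => f x - \sum_(n <- s) c n * b n x) (b m) = inner f (b m).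
Proof.
move=> sb ob; elim: s => [|n s IH]; last rewrite inE negb_or => /andP[mn ms].
  by move=> _ f sf; under eq_fun do rewrite big_nil subr0.
move=> f sf.
have -> : (fun x => f x - \sum_(j <- n :: s) c j * b j x) =
  (fun x => (f x - c n * b n x) - \sum_(j <- s) c j * b j x).
  by apply/funext => x; rewrite big_cons opprD addrA.
rewrite IH//; last exact/square_integrableB/square_integrableZ.
rewrite innerBl//; last exact: square_integrableZ.
by rewrite innerZl// ob eq_sym (negPf mn) mulr0 subr0.
Qed.

(** Completing the square: among the combinations of the orthonormal family
    indexed by s, the one with the Fourier coefficients is the closest to f. *)
Lemma bessel (I : eqType) (b : I -> T -> R[i]) (s : seq I) (c : I -> R[i]) f :
  (forall n, square_integrable (b n)) ->
  (forall m n, inner (b m) (b n) = (m == n)%:R) -> uniq s ->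
  square_integrable f ->
  sqnorm (fun x => f x - \sum_(n <- s) c n * b n x) =
  sqnorm f - \sum_(n <- s) cabs2 (inner f (b n))
           + \sum_(n <- s) cabs2 (c n - inner f (b n)).
Proof.
move=> sb ob; have b1 n : sqnorm (b n) = 1.
  by have := ob n n; rewrite inner_self eqxx => /(congr1 Re).
elim: s => [_ sf|n s IH /= /andP[ns us] sf].
  by rewrite !big_nil subr0 addr0; under eq_fun do rewrite big_nil subr0.
have -> : (fun x => f x - \sum_(j <- n :: s) c j * b j x) =
  (fun x => (f x - \sum_(j <- s) c j * b j x) - c n * b n x).
  by apply/funext => x; rewrite big_cons opprD addrA addrAC.
rewrite sqnormB_scaled//; last exact/square_integrableB/square_integrable_sum.
rewrite inner_sum// IH// !big_cons; ring.
Qed.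

Lemma sqnorm_combination (I : eqType) (b : I -> T -> R[i]) (s : seq I)
    (c : I -> R[i]) : (forall n, square_integrable (b n)) ->
  (forall m n, inner (b m) (b n) = (m == n)%:R) -> uniq s ->
  sqnorm (fun x => \sum_(n <- s) c n * b n x) = \sum_(n <- s) cabs2 (c n).
Proof.
move=> sb ob us; have := bessel c sb ob us square_integrable0.
have i0 n : inner (fun=> 0) (b n) = 0.
  have := innerZl 0 (sb n) (sb n); rewrite mul0r => E; rewrite -[RHS]E.
  by apply: eq_cintegral => x _; rewrite !mul0r.
have n0 : sqnorm (fun=> 0) = 0.
  by rewrite /sqnorm (eq_Rintegral mu (g := fun=> 0)) ?Rintegral_cst ?mul0r// => x _;
    rewrite cabs2_0.
rewrite n0 sub0r [X in - X]big1 ?oppr0 ?add0r => [H|n _]; last by rewrite i0 cabs2_0.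
rewrite (eq_bigr (fun n => cabs2 (c n - inner (fun=> 0) (b n)))); last first.
  by move=> n _; rewrite i0 subr0.
rewrite -H; apply: eq_Rintegral => x _.
by rewrite sub0r cabs2N.
Qed.

End ComplexL2.

(** * Goursat's theorem on rectangles *)

Section IntervalIntegral.
Variable R : realType.
Local Notation mu := (@lebesgue_measure R).
Implicit Types (F G : R -> R) (a b c u v M : R).

Definition itvint F a b : R := Rintegral mu `[a, b] F.

Lemma integrable_itv F a b : continuous F ->
  mu.-integrable `[a, b] (EFin \o F).
Proof.
move=> cF; apply: continuous_compact_integrable; first exact: segment_compact.
exact: continuous_subspaceT.
Qed.

Lemma itvint_split F a b c : continuous F -> a <= b -> b <= c ->
  itvint F a c = itvint F a b + itvint F b c.
Proof.
move=> cF ab bc; rewrite /itvint.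
have := @Rintegral_itvB R F (BLeft a) (BRight c) b (integrable_itv a c cF).
rewrite !bnd_simp => /(_ ab bc) E.
have i := integrable_itv b c cF.
have <- : Rintegral mu `]b, c] F = Rintegral mu `[b, c] F.
  apply: Rintegral_itv_obnd_cbnd; apply: integrableS i => //.
  by apply: subset_itvr; rewrite bnd_simp.
by rewrite -E addrC subrK.
Qed.

Lemma itvint_cst u a b : a <= b -> itvint (fun=> u) a b = u * (b - a).
Proof.
move=> ab; rewrite /itvint Rintegral_cst//= lebesgue_measure_itv/= lte_fin.
by case: ltP => [//|ba]; rewrite (@le_anti _ _ a b) ?ab ?subrr ?mulr0.
Qed.

Lemma itvint_affine u v a b : a <= b ->
  itvint (fun x => u + v * x) a b = u * (b - a) + v * (b ^+ 2 - a ^+ 2) / 2.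
Proof.
rewrite le_eqVlt => /predU1P[->|ab].
  rewrite /itvint set_itv1 Rintegral_set1; ring.
have ic : continuous (fun x : R => u + v * x).
  by move=> x; apply: cvgD; [exact: cvg_cst|apply: cvgM; [exact: cvg_cst|exact: cvg_id]].
pose F x := u * x + v / 2 * x ^+ 2.
have dF (x : R) : is_derive x (1 : R) F (u + v * x).
  apply: is_derive_eq; rewrite /GRing.scale /=; by field.
have cF : continuous F.
  by move=> x; apply: differentiable_continuous; apply/derivable1_diffP; case: (dF x).
rewrite /itvint /Rintegral (@continuous_FTC2 _ _ F)//.
- by rewrite /F /=; field.
- exact: continuous_subspaceT.
- split.
  + by move=> x _; case: (dF x).
  + by apply: cvg_at_right_filter; exact: cF.
  + by apply: cvg_at_left_filter; exact: cF.
- by move=> x _; rewrite derive1E; case: (dF x).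
Qed.

Lemma itvint_bound F a b M : continuous F -> a <= b ->
  (forall x, a <= x <= b -> `|F x| <= M) -> `|itvint F a b| <= M * (b - a).
Proof.
move=> cF ab FM; have iF := integrable_itv a b cF.
apply: le_trans (le_normr_Rintegral _ iF) _ => //.
rewrite -(itvint_cst M ab); apply: le_Rintegral => //.
- exact: integrable_norm.
- by apply: integrable_itv => x; exact: cvg_cst.
Qed.

Lemma itvint_approx F u v a b M : continuous F -> a <= b ->
  (forall x, a <= x <= b -> `|F x - (u + v * x)| <= M) ->
  `|itvint F a b - (u * (b - a) + v * (b ^+ 2 - a ^+ 2) / 2)| <= M * (b - a).
Proof.
move=> cF ab FM; rewrite -itvint_affine//.
have ic : continuous (fun x : R => u + v * x).
  by move=> x; apply: cvgD; [exact: cvg_cst|apply: cvgM; [exact: cvg_cst|exact: cvg_id]].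
rewrite /itvint -RintegralB//; [|exact: integrable_itv..].
apply: itvint_bound => //.
by move=> x; apply: cvgB; [exact: cF|exact: ic].
Qed.

End IntervalIntegral.

Section Goursat.
Variable R : realType.
Implicit Types (P Q : R -> R -> R) (x y w h : R).

Definition diff2 P x y p q := forall e : R, 0 < e -> exists2 r : R, 0 < r &
  forall s t, `|s| < r -> `|t| < r ->
  `|P (x + s) (y + t) - P x y - p * s - q * t| <= e * (`|s| + `|t|).

(** The 1-form P dx + Q dy is differentiable, with vanishing exterior
    derivative; the partial derivatives need not be continuous. *)
Definition closed_form P Q := forall x y, exists p q r,
  diff2 P x y p q /\ diff2 Q x y q r.

Lemma diff2_bound P x y p q : diff2 P x y p q -> exists2 r : R, 0 < r &
  forall s t, `|s| < r -> `|t| < r ->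
  `|P (x + s) (y + t) - P x y| <= (1 + `|p| + `|q|) * (`|s| + `|t|).
Proof.
move=> /(_ 1 ltr01)[r r0 rP]; exists r => // s t sr tr.
have -> : P (x + s) (y + t) - P x y =
  (P (x + s) (y + t) - P x y - p * s - q * t) + p * s + q * t by ring.
rewrite (le_trans (ler_normD _ _))// (le_trans (lerD (ler_normD _ _) (lexx _)))//.
rewrite !normrM; have := rP s t sr tr.
have := normr_ge0 s; have := normr_ge0 t; have := normr_ge0 p.
have := normr_ge0 q; nra.
Qed.

Lemma diff2_continuous P : (forall x y, exists p q, diff2 P x y p q) ->
  (forall y, continuous (P^~ y)) /\ (forall x, continuous (P x)).
Proof.
move=> dP.
have key x y (e : R) : 0 < e -> exists2 r : R, 0 < r &
   forall s t, `|s| + `|t| < r -> `|P (x + s) (y + t) - P x y| <= e.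
  move=> e0; have [p [q /diff2_bound[r r0 rP]]] := dP x y.
  have M0 : 0 < 1 + `|p| + `|q| by rewrite -addrA ltr_pwDl// addr_ge0.
  exists (Num.min r (e / (1 + `|p| + `|q|))).
    by rewrite lt_min r0 divr_gt0.
  move=> s t; rewrite lt_min => /andP[sr se].
  have sr' : `|s| < r by rewrite (le_lt_trans _ sr)// lerDl.
  have tr' : `|t| < r by rewrite (le_lt_trans _ sr)// lerDr.
  rewrite (le_trans (rP s t sr' tr'))// mulrC -ler_pdivlMr//.
  exact: ltW.
split=> [y x|x y]; apply/cvgrPdist_le => e e0; have [r r0 rP] := key x y e e0;
  exists r => //= z; rewrite /ball_ /= distrC => zr; rewrite distrC.
  by have := rP (z - x) 0; rewrite normr0 !addr0 subrKC; apply.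
by have := rP 0 (z - y); rewrite normr0 add0r addr0 subrKC; apply.
Qed.

(** The circulation of P dx + Q dy around the rectangle of width w and height h
    with lower left corner (x, y). *)
Definition circulation P Q x y w h :=
  itvint (P^~ y) x (x + w) + itvint (Q (x + w)) y (y + h)
  - itvint (P^~ (y + h)) x (x + w) - itvint (Q x) y (y + h).

Section Closed.
Variables P Q : R -> R -> R.
Hypothesis PQ : closed_form P Q.

Let contP : (forall y, continuous (P^~ y)) /\ (forall x, continuous (P x)).
Proof. by apply: diff2_continuous => x y; have [p [q [r []]]] := PQ x y; exists p, q. Qed.

Let contQ : (forall y, continuous (Q^~ y)) /\ (forall x, continuous (Q x)).
Proof. by apply: diff2_continuous => x y; have [p [q [r []]]] := PQ x y; exists q, r. Qed.

Lemma circulation_quadrisection x y w h : 0 <= w -> 0 <= h ->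
  circulation P Q x y (w + w) (h + h) =
    circulation P Q x y w h + circulation P Q (x + w) y w h
  + circulation P Q x (y + h) w h + circulation P Q (x + w) (y + h) w h.
Proof.
move=> w0 h0; rewrite /circulation !addrA.
have sw (F : R -> R) z t : continuous F -> 0 <= t ->
    itvint F z (z + t + t) = itvint F z (z + t) + itvint F (z + t) (z + t + t).
  by move=> cF t0; apply: itvint_split; rewrite // lerDl.
rewrite (sw (P^~ y))//; last exact: contP.1.
rewrite (sw (P^~ (y + h + h)))//; last exact: contP.1.
rewrite (sw (Q (x + w + w)))//; last exact: contQ.2.
rewrite (sw (Q x))//; last exact: contQ.2.
ring.
Qed.

(** An affine closed form has no circulation, so only the errors of the first
    order expansions at (x0, y0) contribute. *)
Lemma circulation_small x0 y0 (e : R) : 0 < e -> exists2 r : R, 0 < r &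
  forall x y w h, x <= x0 <= x + w -> y <= y0 <= y + h -> w < r -> h < r ->
  `|circulation P Q x y w h| <= 2 * e * (w + h) ^+ 2.
Proof.
move=> e0; have [p [q [r [dP dQ]]]] := PQ x0 y0.
have [r1 r10 P1] := dP e e0; have [r2 r20 P2] := dQ e e0.
exists (Num.min r1 r2) => [|x y w h /andP[xl xr] /andP[yl yr]].
  by rewrite lt_min r10.
rewrite !lt_min => /andP[w1 w2] /andP[h1 h2].
have w0 : 0 <= w by lra.
have h0 : 0 <= h by lra.
have dist (z z0 t : R) : z0 - t <= z <= z0 + t -> `|z - z0| <= t.
  by rewrite ler_distl.
have inx z : x <= z <= x + w -> `|z - x0| <= w.
  by move=> /andP[z1 z2]; apply: dist; lra.
have iny z : y <= z <= y + h -> `|z - y0| <= h.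
  by move=> /andP[z1 z2]; apply: dist; lra.
have xx : x <= x <= x + w by lra.
have xw : x <= x + w <= x + w by lra.
have yy : y <= y <= y + h by lra.
have yh : y <= y + h <= y + h by lra.
have approxP z : y <= z <= y + h -> `|itvint (P^~ z) x (x + w) -
    ((P x0 y0 - p * x0 + q * (z - y0)) * (x + w - x)
     + p * ((x + w) ^+ 2 - x ^+ 2) / 2)| <= e * (w + h) * (x + w - x).
  move=> zy; apply: itvint_approx; [exact: contP.1|lra|move=> t tx].
  have := P1 (t - x0) (z - y0); rewrite !subrKC.
  move=> /(_ (le_lt_trans (inx _ tx) w1) (le_lt_trans (iny _ zy) h1)) H.
  have -> : P t z - (P x0 y0 - p * x0 + q * (z - y0) + p * t) =
    P t z - P x0 y0 - p * (t - x0) - q * (z - y0) by ring.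
  apply: le_trans H _; rewrite ler_pM2l//.
  exact: lerD (inx _ tx) (iny _ zy).
have approxQ z : x <= z <= x + w -> `|itvint (Q z) y (y + h) -
    ((Q x0 y0 - r * y0 + q * (z - x0)) * (y + h - y)
     + r * ((y + h) ^+ 2 - y ^+ 2) / 2)| <= e * (w + h) * (y + h - y).
  move=> zx; apply: itvint_approx; [exact: contQ.2|lra|move=> t ty].
  have := P2 (z - x0) (t - y0); rewrite !subrKC.
  move=> /(_ (le_lt_trans (inx _ zx) w2) (le_lt_trans (iny _ ty) h2)) H.
  have -> : Q z t - (Q x0 y0 - r * y0 + q * (z - x0) + r * t) =
    Q z t - Q x0 y0 - q * (z - x0) - r * (t - y0) by ring.
  apply: le_trans H _; rewrite ler_pM2l//.
  exact: lerD (inx _ zx) (iny _ ty).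
have a1 := approxP _ yy; have a2 := approxP _ yh.
have b1 := approxQ _ xx; have b2 := approxQ _ xw.
have Ew : x + w - x = w by ring.
have Eh : y + h - y = h by ring.
rewrite Ew in a1 a2; rewrite Eh in b1 b2.
rewrite /circulation.
move: a1 a2 b1 b2; set A1 := itvint _ _ _; set A2 := itvint _ _ _.
set B1 := itvint _ _ _; set B2 := itvint _ _ _.
set u1 := A1 - _; set u2 := A2 - _; set v1 := B1 - _; set v2 := B2 - _.
move=> a1 a2 b1 b2.
have -> : A1 + B2 - A2 - B1 = u1 + v2 - u2 - v1 by rewrite /u1 /u2 /v1 /v2; field.
have -> : 2 * e * (w + h) ^+ 2 = e * (w + h) * w + e * (w + h) * h +
  e * (w + h) * w + e * (w + h) * h by ring.
apply: le_trans (ler_normB _ _) (lerD _ b1).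
apply: le_trans (ler_normB _ _) (lerD _ a2).
exact: le_trans (ler_normD _ _) (lerD a1 b2).
Qed.

(** Goursat's quadrisection: at each step one of the four quarters carries at
    least a quarter of the circulation, whereas around the limit point of these
    rectangles the circulation is small compared to the area. *)
Lemma goursat x y w h : 0 <= w -> 0 <= h -> circulation P Q x y w h = 0.
Proof.
move=> w0 h0; pose W k := w / 2 ^+ k; pose H k := h / 2 ^+ k.
have e20 k : 0 < 2 ^+ k :> R by rewrite exprn_gt0.
have W0 k : 0 <= W k by rewrite divr_ge0// ltW.
have H0 k : 0 <= H k by rewrite divr_ge0// ltW.
have halve (t : R) k : t / 2 ^+ k = t / 2 ^+ k.+1 + t / 2 ^+ k.+1.
  by rewrite exprS; field; rewrite gt_eqF.
pose C k (z : R * R) := `|circulation P Q z.1 z.2 (W k) (H k)|.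
have step (kz : nat * (R * R)) : exists z' : R * R,
    [/\ C kz.1 kz.2 <= 4 * C kz.1.+1 z',
        kz.2.1 <= z'.1, z'.1 + W kz.1.+1 <= kz.2.1 + W kz.1,
        kz.2.2 <= z'.2 & z'.2 + H kz.1.+1 <= kz.2.2 + H kz.1].
  case: kz => k [a b] /=; apply: contrapT => no.
  have Wk := W0 k.+1; have Hk := H0 k.+1.
  have EW : W k = W k.+1 + W k.+1 by exact: halve.
  have EH : H k = H k.+1 + H k.+1 by exact: halve.
  have small a' b' : (a' = a \/ a' = a + W k.+1) ->
      (b' = b \/ b' = b + H k.+1) -> 4 * C k.+1 (a', b') < C k (a, b).
    move=> Ha Hb; rewrite ltNge; apply/negP => le; apply: no; exists (a', b').
    by split => //=; case: Ha => Ha; case: Hb => Hb; lra.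
  have s1 := small a b (or_introl erefl) (or_introl erefl).
  have s2 := small _ b (or_intror erefl) (or_introl erefl).
  have s3 := small a _ (or_introl erefl) (or_intror erefl).
  have s4 := small _ _ (or_intror erefl) (or_intror erefl).
  have : C k (a, b) <= C k.+1 (a, b) + C k.+1 (a + W k.+1, b) +
     C k.+1 (a, b + H k.+1) + C k.+1 (a + W k.+1, b + H k.+1).
    rewrite /C /= EW EH circulation_quadrisection//.
    by rewrite (le_trans (ler_normD _ _))// lerD// (le_trans (ler_normD _ _))//
      lerD// ler_normD.
  lra.
have [f fP] := choice step.
pose fix z k : R * R := if k is k'.+1 then f (k', z k') else (x, y).
have zC k : C 0 (x, y) <= 4 ^+ k * C k (z k).
  elim: k => [|k IH]; first by rewrite expr0 mul1r.
  apply: le_trans IH _; rewrite exprSr -mulrA ler_pM2l ?exprn_gt0//.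
  by have [] := fP (k, z k).
have zx : nondecreasing_seq (fun k => (z k).1).
  by apply/nondecreasing_seqP => k; have [] := fP (k, z k).
have zw : nonincreasing_seq (fun k => (z k).1 + W k).
  by apply/nonincreasing_seqP => k; have [] := fP (k, z k).
have zy : nondecreasing_seq (fun k => (z k).2).
  by apply/nondecreasing_seqP => k; have [] := fP (k, z k).
have zh : nonincreasing_seq (fun k => (z k).2 + H k).
  by apply/nonincreasing_seqP => k; have [] := fP (k, z k).
have nested (u v : nat -> R) : nondecreasing_seq u ->
    nonincreasing_seq (fun k => u k + v k) -> (forall k, 0 <= v k) ->
    exists t, forall k, u k <= t <= u k + v k.
  move=> ndu niv v0; exists (sup (range u)) => k.
  have ub j l : u j <= u l + v l.
    have [jl|lj] := leqP j l.
      by rewrite (le_trans (ndu _ _ jl))// lerDl.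
    by apply: le_trans (niv _ _ (ltnW lj)); rewrite lerDl.
  have hs : has_sup (range u).
    split; first by exists (u 0%N), 0%N.
    by exists (u 0%N + v 0%N) => _ [j _ <-]; exact: ub.
  apply/andP; split; first by apply: ub_le_sup; [exact: hs.2|exists k].
  by apply: ge_sup; [exact: hs.1|move=> _ [j _ <-]; exact: ub].
have [x0 x0P] := nested _ _ zx zw W0.
have [y0 y0P] := nested _ _ zy zh H0.
apply/normr0_eq0/le_anti; rewrite normr_ge0 andbT.
apply/ler_addgt0Pl => e e0; rewrite addr0.
pose M := 1 + 2 * (w + h) ^+ 2.
have M0 : 0 < M by rewrite ltr_pwDl// mulr_ge0 ?sqr_ge0.
have [r r0 rP] := circulation_small x0 y0 (divr_gt0 e0 M0).
have [k /andP[Wr Hr]] : exists k, (W k < r) && (H k < r).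
  have big (k : nat) : k%:R <= 2 ^+ k :> R.
    by rewrite -natrX ler_nat ltnW// ltn_expl.
  exists (Num.bound (w / r) + Num.bound (h / r))%N.
  have lt (t : R) n : 0 <= t -> (Num.bound (t / r) <= n)%N -> t / 2 ^+ n < r.
    move=> t0 bn; rewrite ltr_pdivrMr// mulrC -ltr_pdivrMr//.
    apply: lt_le_trans (archi_boundP _) _; first by rewrite divr_ge0// ltW.
    by rewrite (le_trans _ (big n))// ler_nat.
  by rewrite /W /H !lt// ?leq_addr ?leq_addl.
have E : circulation P Q x y w h = circulation P Q x y (W 0%N) (H 0%N).
  by rewrite /W /H expr0 !divr1.
rewrite E; apply: le_trans (zC k) _.
have := rP _ _ _ _ (x0P k) (y0P k) Wr Hr => ck.
apply: le_trans (_ : 4 ^+ k * (2 * (e / M) * (W k + H k) ^+ 2) <= _).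
  by rewrite ler_pM2l ?exprn_gt0.
have -> : 4 ^+ k * (2 * (e / M) * (W k + H k) ^+ 2) =
   2 * (e / M) * (w + h) ^+ 2.
  rewrite /W /H -mulrDl expr_div_n -exprM mulnC exprM (_ : 2 ^+ 2 = 4 :> R); last by ring.
  by field; rewrite !gt_eqF ?exprn_gt0.
have -> : 2 * (e / M) * (w + h) ^+ 2 = e * ((2 * (w + h) ^+ 2) / M).
  by field; rewrite gt_eqF.
by rewrite ler_piMr ?(ltW e0)// ler_pdivrMr// mul1r /M lerDr.
Qed.

End Closed.

End Goursat.

Section PeriodicEntire.
Variable R : realType.
Implicit Types (f : R[i] -> R[i]).
Local Notation mu := (@lebesgue_measure R).
Local Notation Re := (@complex.Re R).
Local Notation Im := (@complex.Im R).

Lemma cabs_le_plane (s t : R) : cabs (s +i* t) <= `|s| + `|t|.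
Proof. exact: cabs_le_ReIm. Qed.

(** The Cauchy-Riemann equations. *)
Let diff2_entire f (d : R[i]) (x y : R) : cderiv f (x +i* y) d ->
  diff2 (fun x y => Re (f (x +i* y))) x y (Re d) (- Im d) /\
  diff2 (fun x y => Im (f (x +i* y))) x y (Im d) (Re d).
Proof.
move=> df.
have key (e : R) : 0 < e -> exists2 r : R, 0 < r & forall s t, `|s| < r ->
    `|t| < r -> cabs (f ((x + s) +i* (y + t)) - f (x +i* y) - d * (s +i* t)) <=
    e * (`|s| + `|t|).
  move=> e0; have [r r0 rP] := df e e0.
  exists (r / 2) => [|s t sr tr]; first by rewrite divr_gt0.
  have -> : (x + s) +i* (y + t) = (x +i* y) + (s +i* t) by [].
  have st := cabs_le_plane s t.
  apply: le_trans (rP _ _) _; last by rewrite ler_pM2l.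
  by apply: le_lt_trans st _; lra.
split=> e /key[r r0 rP]; exists r => // s t sr tr; apply: le_trans (rP s t sr tr).
  apply: le_trans (Re_le_cabs _); rewrite !reimE /= le_eqVlt; apply/orP; left.
  by apply/eqP; congr (`|_|); ring.
apply: le_trans (Im_le_cabs _); rewrite !reimE /= le_eqVlt; apply/orP; left.
by apply/eqP; congr (`|_|); ring.
Qed.

Lemma closed_form_Re f : entire f ->
  closed_form (fun x y => Re (f (x +i* y))) (fun x y => - Im (f (x +i* y))).
Proof.
move=> /entireP df x y; have [d /diff2_entire[dR dI]] := df (x +i* y).
exists (Re d), (- Im d), (- Re d); split => // e /dI[r r0 rP].
exists r => // s t sr tr; rewrite -normrN.
by have := rP s t sr tr; congr (`|_| <= _); ring.
Qed.

Lemma closed_form_Im f : entire f ->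
  closed_form (fun x y => Im (f (x +i* y))) (fun x y => Re (f (x +i* y))).
Proof.
move=> /entireP df x y; have [d /diff2_entire[dR dI]] := df (x +i* y).
by exists (Im d), (Re d), (- Im d).
Qed.

Lemma entire_continuous_Re f : entire f ->
  (forall y, continuous (fun x => Re (f (x +i* y)))) /\
  (forall x, continuous (fun y => Re (f (x +i* y)))).
Proof.
move=> ef; apply: (@diff2_continuous R (fun x y => Re (f (x +i* y)))) => x y.
by have [p [q [r []]]] := closed_form_Re ef x y; exists p, q.
Qed.

Lemma entire_continuous_Im f : entire f ->
  (forall y, continuous (fun x => Im (f (x +i* y)))) /\
  (forall x, continuous (fun y => Im (f (x +i* y)))).
Proof.
move=> ef; apply: (@diff2_continuous R (fun x y => Im (f (x +i* y)))) => x y.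
by have [p [q [r []]]] := closed_form_Im ef x y; exists p, q.
Qed.

(** The integrals along the vertical sides of a rectangle of width 1 cancel. *)
Lemma periodic_entire_integral f : entire f -> (forall z, f (z + 1) = f z) ->
  forall y y', cintegral mu `[0, 1] (fun x => f (x +i* y)) =
               cintegral mu `[0, 1] (fun x => f (x +i* y')).
Proof.
move=> ef fper.
have per (y : R) : f (1 +i* y) = f (0 +i* y).
  by rewrite -(fper (0 +i* y)); congr f; apply: complex_ext; rewrite !reimE /= ?add0r ?addr0.
suff H (y y' : R) : y <= y' -> cintegral mu `[0, 1] (fun x => f (x +i* y)) =
               cintegral mu `[0, 1] (fun x => f (x +i* y')).
  by move=> y y'; have [|/ltW] := leP y y' => /H.
move=> yy'; have h0 : 0 <= y' - y by rewrite subr_ge0.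
have := goursat (closed_form_Re ef) 0 y ler01 h0.
have := goursat (closed_form_Im ef) 0 y ler01 h0.
rewrite /circulation subrKC !add0r.
under [itvint _ y y' in LHS]eq_Rintegral do rewrite per.
move=> /eqP; rewrite addrAC addrK subr_eq0 => /eqP EI.
under [itvint _ y y' in LHS]eq_Rintegral do rewrite per.
move=> /eqP; rewrite addrAC addrK subr_eq0 => /eqP ER.
exact: complex_ext.
Qed.

End PeriodicEntire.

(** * Completeness of the exponentials in L2 of an interval *)

Section AlmostEverywhere.
Context d (T : measurableType d) (R : realType) (mu : {measure set T -> \bar R}).
Implicit Types (A B C : T -> Prop).

Lemma ae_imply A B : (forall x, A x -> B x) ->
  {ae mu, forall x, A x} -> {ae mu, forall x, B x}.
Proof. exact: (@filterS _ _ (ae_filter_ringOfSetsType mu)). Qed.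

Lemma ae_imply2 A B C : (forall x, A x -> B x -> C x) ->
  {ae mu, forall x, A x} -> {ae mu, forall x, B x} -> {ae mu, forall x, C x}.
Proof. exact: (@filterS2 _ _ (ae_filter_ringOfSetsType mu)). Qed.

Lemma ae_true A : (forall x, A x) -> {ae mu, forall x, A x}.
Proof. exact: (@filterE _ _ (ae_filter_ringOfSetsType mu)). Qed.

End AlmostEverywhere.

Section TrigonometricApproximation.
Variables (R : realType) (P : R).
Hypothesis P0 : 0 < P.
Local Notation mu := (@lebesgue_measure R).
Local Notation D := (`[0, P]%classic : set R).
Implicit Types (f g : R -> R[i]) (c : R[i]).

Let mD : measurable D. Proof. exact: measurable_itv. Qed.

Definition circle_mode (n : int) (x : R) : R[i] :=
  cexp ('i%C * (2 * pi * n%:~R * x / P)%:C).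

Lemma circle_modeD m n x : circle_mode (m + n) x = circle_mode m x * circle_mode n x.
Proof.
by rewrite /circle_mode -cexpD -mulrDr -rmorphD /= intrD mulrDr !mulrDl.
Qed.

Lemma circle_mode0 x : circle_mode 0 x = 1.
Proof. by rewrite /circle_mode mulr0 !mul0r mulr0 cexp0. Qed.

Definition trigpoly f := exists l : seq (int * R[i]),
  forall x, f x = \sum_(p <- l) p.2 * circle_mode p.1 x.

Lemma trigpoly_cst c : trigpoly (fun=> c).
Proof. by exists [:: (0, c)] => x; rewrite big_seq1 circle_mode0 mulr1. Qed.

Lemma trigpoly_circle_mode n : trigpoly (circle_mode n).
Proof. by exists [:: (n, 1)] => x; rewrite big_seq1 mul1r. Qed.

Lemma trigpolyD f g : trigpoly f -> trigpoly g -> trigpoly (fun x => f x + g x).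
Proof. by move=> [l lE] [k kE]; exists (l ++ k) => x; rewrite big_cat lE kE. Qed.

Lemma trigpolyM f g : trigpoly f -> trigpoly g -> trigpoly (fun x => f x * g x).
Proof.
move=> [l lE] [k kE].
exists [seq (p.1 + q.1, p.2 * q.2) | p <- l, q <- k] => x.
rewrite big_allpairs_dep lE kE mulr_suml; apply: eq_bigr => p _.
rewrite mulr_sumr; apply: eq_bigr => q _ /=.
by rewrite circle_modeD mulrACA.
Qed.

Lemma trigpolyX f n : trigpoly f -> trigpoly (fun x => f x ^+ n).
Proof.
move=> tf; elim: n => [|n IH].
  by under eq_fun do rewrite expr0; exact: trigpoly_cst.
by under eq_fun do rewrite exprS; exact: trigpolyM.
Qed.

Lemma trigpolyN f : trigpoly f -> trigpoly (fun x => - f x).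
Proof.
by move=> /(trigpolyM (trigpoly_cst (-1))); under eq_fun do rewrite mulN1r.
Qed.

Lemma trigpoly_uniq f : trigpoly f -> exists (s : seq int) (c : int -> R[i]),
  uniq s /\ forall x, f x = \sum_(n <- s) c n * circle_mode n x.
Proof.
move=> [l lE]; elim: l f lE => [|[n c] l IH] f fE.
  by exists [::], (fun=> 0); split => // x; rewrite fE !big_nil.
have [s [b [us sE]]] := IH _ (fun=> erefl).
have [ns|ns] := boolP (n \in s).
  exists s, (fun m => b m + (if m == n then c else 0)); split => // x.
  rewrite fE big_cons /= sE [RHS](bigD1_seq n)//= eqxx mulrDl.
  rewrite [in LHS](bigD1_seq n)//= addrA [c * _ + _]addrC; congr (_ + _).
  by apply: eq_bigr => m /negPf->; rewrite addr0.
exists (n :: s), (fun m => if m == n then c else b m); split.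
  by rewrite /= ns.
move=> x; rewrite fE !big_cons /= eqxx sE; congr (_ + _).
rewrite !big_seq; apply: eq_bigr => m ms.
by rewrite ifN//; apply: contraNneq ns => <-.
Qed.

Lemma cmeasurable_circle_mode (E : set R) n : cmeasurable E (circle_mode n).
Proof.
apply: cmeasurable_cexp; apply: cmeasurableM; first exact: cmeasurable_cst.
apply: cmeasurable_real; apply: measurable_funTS; exact: measurable_funM.
Qed.

Lemma cmeasurable_trigpoly f : trigpoly f -> cmeasurable D f.
Proof.
move=> [l /funext->].
apply: (@cmeasurable_sum _ _ _ _ _ _ (fun p x => p.2 * circle_mode p.1 x)) => p.
by apply: cmeasurableM; [exact: cmeasurable_cst|exact: cmeasurable_circle_mode].
Qed.

(** Membership in the L2 closure of the trigonometric polynomials. *)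
Definition approximable f := cmeasurable D f /\ forall e : R, 0 < e ->
  exists2 g, trigpoly g & (esqnorm mu D (fun x => (f x - g x)%R) < e%:E)%E.

Lemma approximable_trigpoly f : trigpoly f -> approximable f.
Proof.
move=> tf; split; first exact: cmeasurable_trigpoly.
move=> e e0; exists f => //; rewrite /esqnorm integral0_eq ?lte_fin// => x _.
by rewrite subrr cabs2_0.
Qed.

Lemma approximable_closed f : cmeasurable D f ->
  (forall e : R, 0 < e ->
     exists2 g, approximable g & (esqnorm mu D (fun x => (f x - g x)%R) < e%:E)%E) ->
  approximable f.
Proof.
move=> mf H; split => // e e0.
have e4 : 0 < e / 4 by rewrite divr_gt0.
have [g [mg ag] fg] := H _ e4; have [h th gh] := ag _ e4.
exists h => //.
have mh := cmeasurable_trigpoly th.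
have mB (a b : R -> R[i]) : cmeasurable D a -> cmeasurable D b ->
    cmeasurable D (fun x => a x - b x).
  by move=> ma mb; apply: cmeasurableD => //; exact: cmeasurableN.
have := esqnormD_le mu mD ltr01 (mB _ _ mf mg) (mB _ _ mg mh).
rewrite (eq_esqnorm mu (g := fun x => f x - h x)); last first.
  by move=> x _; rewrite addrA subrK.
move=> /le_lt_trans; apply; rewrite invr1.
rewrite [X in (_ < X)%E](_ : _ =
  ((1 + 1)%:E * (e / 4)%:E + (1 + 1)%:E * (e / 4)%:E)%E); last first.
  by rewrite -!EFinM -EFinD; congr EFin; field.
by rewrite lteD// lte_pmul2l// lte_fin.
Qed.

Lemma approximableD f g : approximable f -> approximable g ->
  approximable (fun x => f x + g x).
Proof.
move=> [mf af] [mg ag]; split; first exact: cmeasurableD.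
move=> e e0; have e4 : 0 < e / 4 by rewrite divr_gt0.
have [f' tf ff] := af _ e4; have [g' tg gg] := ag _ e4.
exists (fun x => f' x + g' x); first exact: trigpolyD.
have mB (a b : R -> R[i]) : cmeasurable D a -> trigpoly b -> cmeasurable D (fun x => a x - b x).
  by move=> ma /cmeasurable_trigpoly mb; apply: cmeasurableD => //; exact: cmeasurableN.
have := esqnormD_le mu mD ltr01 (mB _ _ mf tf) (mB _ _ mg tg).
rewrite (eq_esqnorm mu (g := fun x => f x + g x - (f' x + g' x))); last first.
  by move=> x _; rewrite opprD addrACA.
move=> /le_lt_trans; apply; rewrite invr1.
rewrite [X in (_ < X)%E](_ : _ =
  ((1 + 1)%:E * (e / 4)%:E + (1 + 1)%:E * (e / 4)%:E)%E); last first.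
  by rewrite -!EFinM -EFinD; congr EFin; field.
by rewrite lteD// lte_pmul2l// lte_fin.
Qed.

Lemma approximableZ c f : approximable f -> approximable (fun x => c * f x).
Proof.
move=> [mf af]; split; first by apply: cmeasurableM => //; exact: cmeasurable_cst.
move=> e e0; have c0 : 0 < 1 + cabs2 c by rewrite ltr_pwDl// cabs2_ge0.
have [f' tf ff] := af _ (divr_gt0 e0 c0).
exists (fun x => c * f' x); first by apply: trigpolyM => //; exact: trigpoly_cst.
have mB : cmeasurable D (fun x => f x - f' x).
  by apply: cmeasurableD => //; apply: cmeasurableN => //; exact: cmeasurable_trigpoly.
rewrite (eq_esqnorm mu (g := fun x => c * (f x - f' x))); last first.
  by move=> x _; rewrite mulrBr.
rewrite esqnormZ//; apply: (@le_lt_trans _ _ ((1 + cabs2 c)%:E *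
    esqnorm mu D (fun x => (f x - f' x)%R))%E).
  by rewrite lee_wpmul2r ?esqnorm_ge0// lee_fin lerDr.
rewrite [X in (_ < X)%E](_ : _ = ((1 + cabs2 c)%:E * (e / (1 + cabs2 c))%:E)%E).
  by rewrite lte_pmul2l// lte_fin.
by rewrite -EFinM; congr EFin; field; rewrite gt_eqF.
Qed.

(** Dominated convergence in L2. *)
Lemma esqnorm_dominated (f_ : nat -> R -> R[i]) f (G : R -> R) :
  (forall n, cmeasurable D (f_ n)) -> cmeasurable D f ->
  mu.-integrable D (EFin \o G) ->
  (forall n x, D x -> cabs2 (f x - f_ n x) <= G x) ->
  {ae mu, forall x, D x -> cabs2 (f x - f_ n x) @[n --> \oo] --> (0 : R)} ->
  forall e : R, 0 < e ->
  exists n, (esqnorm mu D (fun x => (f x - f_ n x)%R) < e%:E)%E.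
Proof.
move=> mf_ mf iG fG f0 e e0.
have mB n : cmeasurable D (fun x => f x - f_ n x).
  by apply: cmeasurableD => //; exact: cmeasurableN.
have [] := @dominated_convergence _ _ R mu D mD
  (fun n x => (cabs2 (f x - f_ n x))%:E) (cst 0%E) (EFin \o G).
- by move=> n; apply/measurable_EFinP; exact: (measurable_cabs2 (mB n)).
- exact: measurable_cst.
- apply: ae_imply f0 => x H Dx; apply/fine_cvgP; split; first exact: nearW.
  exact: H.
- exact: iG.
- apply: ae_true => x n Dx; rewrite /= lee_fin ger0_norm ?cabs2_ge0//; exact: fG.
move=> _ _; rewrite integral0_eq// => /fine_cvgP[/= fin /cvgrPdist_lt/(_ e e0)].
move=> lim; near \oo => n; exists n.
have : `|0 - fine (esqnorm mu D (fun x => f x - f_ n x))| < e.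
  by near: n; exact: lim.
rewrite sub0r normrN ger0_norm ?fine_ge0 ?esqnorm_ge0// -lte_fin fineK//.
by near: n; exact: fin.
Unshelve. all: by end_near. Qed.

Lemma approximable_limit (f_ : nat -> R -> R[i]) f (G : R -> R) :
  (forall n, approximable (f_ n)) -> cmeasurable D f ->
  mu.-integrable D (EFin \o G) ->
  (forall n x, D x -> cabs2 (f x - f_ n x) <= G x) ->
  {ae mu, forall x, D x -> cabs2 (f x - f_ n x) @[n --> \oo] --> (0 : R)} ->
  approximable f.
Proof.
move=> af mf iG fG f0; apply: approximable_closed => // e e0.
have [n fn] := esqnorm_dominated (fun n => (af n).1) mf iG fG f0 e0.
by exists (f_ n).
Qed.

End TrigonometricApproximation.

Section StepPolynomial.
Variable R : realType.
Implicit Types (t w : R).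

Lemma bernoulli_le t N : 0 <= t <= 1 -> 1 - N%:R * t <= (1 - t) ^+ N.
Proof.
move=> /andP[t0 t1]; elim: N => [|N IH]; first by rewrite mul0r subr0 expr0.
rewrite exprS; apply: le_trans (_ : (1 - t) * (1 - N%:R * t) <= _); last first.
  by rewrite ler_wpM2l// subr_ge0.
have : 0 <= N%:R * (t * t) by rewrite !mulr_ge0.
by rewrite -natr1; lra.
Qed.

Lemma bernoulli_ge t N : 0 <= t <= 1 -> (1 - t) ^+ N * (N%:R * t) <= 1.
Proof.
move=> t01; have [t0 t1] := andP t01.
have H : (1 - t) ^+ N * (1 + N%:R * t) <= 1.
  elim: N => [|N IH]; first by rewrite mul0r addr0 expr0 mulr1.
  apply: le_trans IH; rewrite exprSr -mulrA ler_wpM2l ?exprn_ge0 ?subr_ge0//.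
  rewrite -natr1; have : 0 <= N%:R * (t * t) by rewrite !mulr_ge0.
  nra.
apply: le_trans H; rewrite mulrDr mulr1 lerDr exprn_ge0// subr_ge0//.
Qed.

(** On [0, 1] these polynomials tend to 1 below 1/2 and to 0 above: by Bernoulli's
    inequality, what matters is whether 2 ^ n * w ^ n tends to 0 or to infinity. *)
Definition step_poly n w : R := (1 - w ^+ n) ^+ (2 ^ n).

Lemma step_poly_01 n w : 0 <= w <= 1 -> 0 <= step_poly n w <= 1.
Proof.
move=> /andP[w0 w1]; rewrite /step_poly.
have : 0 <= w ^+ n <= 1 by rewrite exprn_ge0 ?exprn_ile1.
move=> /andP[p0 p1]; rewrite exprn_ge0 ?subr_ge0//= exprn_ile1 ?subr_ge0//.
by rewrite gerDl oppr_le0.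
Qed.

Lemma step_poly_low w : 0 <= w < 2^-1 ->
  (1 - step_poly n w) ^+ 2 @[n --> \oo] --> (0 : R).
Proof.
move=> /andP[w0 w2].
have w1 : w <= 1 by rewrite (le_trans (ltW w2))// invf_le1// ler1n.
apply: (@squeeze_cvgr _ _ _ _ (fun=> 0) (fun n => (2 * w) ^+ n)).
- apply: nearW => n; rewrite sqr_ge0/=.
  have /andP[s0 s1] : 0 <= step_poly n w <= 1 by apply: step_poly_01; rewrite w0.
  have p01 : 0 <= w ^+ n <= 1 by rewrite exprn_ge0 ?exprn_ile1.
  have := bernoulli_le (2 ^ n) p01; rewrite -/(step_poly n w) natrX -exprMn.
  nra.
- exact: cvg_cst.
- apply: cvg_expr; rewrite ger0_norm ?mulr_ge0//.
  by rewrite mulrC -ltr_pdivlMr// div1r.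
Qed.

Lemma step_poly_high w : 2^-1 < w <= 1 ->
  step_poly n w ^+ 2 @[n --> \oo] --> (0 : R).
Proof.
move=> /andP[w2 w1].
have w0 : 0 < w by rewrite (lt_trans _ w2)// invr_gt0.
apply: (@squeeze_cvgr _ _ _ _ (fun=> 0) (fun n => (2 * w)^-1 ^+ n)).
- apply: nearW => n; rewrite sqr_ge0/=.
  have /andP[s0 s1] : 0 <= step_poly n w <= 1 by apply: step_poly_01; rewrite ltW.
  have p01 : 0 <= w ^+ n <= 1 by rewrite exprn_ge0 ?exprn_ile1// ltW.
  have := bernoulli_ge (2 ^ n) p01; rewrite -/(step_poly n w) natrX -exprMn => H.
  apply: le_trans (_ : step_poly n w <= _); first by nra.
  by rewrite exprVn -div1r ler_pdivlMr// exprn_gt0// mulr_gt0.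
- exact: cvg_cst.
- apply: cvg_expr; rewrite ger0_norm ?invr_ge0 ?mulr_ge0 ?(ltW w0)//.
  by rewrite invf_lt1 ?mulr_gt0// mulrC -ltr_pdivrMr// div1r.
Qed.

End StepPolynomial.

Lemma lebesgue_ae_neq (R : realType) (a : R) :
  {ae @lebesgue_measure R, forall x, x <> a}.
Proof.
exists [set a]; split; [exact: measurable_set1|exact: lebesgue_measure_set1|].
by move=> x /= /contrapT.
Qed.

Section TrigonometricDensity.
Variables (R : realType) (P : R).
Hypothesis P0 : 0 < P.
Local Notation mu := (@lebesgue_measure R).
Local Notation D := (`[0, P]%classic : set R).
Local Notation approximable := (@approximable R P).
Local Notation trigpoly := (@trigpoly R P).

(** For 0 < b <= P this trigonometric polynomial is below 1/2 on ]0, b[ and above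
    1/2 on ]b, P[, so that its composites with the step polynomials converge to the
    indicator of ]0, b[ on ]0, P[. *)
Let threshold (b x : R) : R :=
  2^-1 - 2^-1 * (sin (pi * x / P) * sin (pi * (b - x) / P)).

Let threshold_trigpoly b : trigpoly (fun x => (threshold b x)%:C).
Proof.
set beta := pi * b / P.
pose c0 : R[i] := (2^-1 + cos beta / 4)%:C.
pose c1 : R[i] := (- 8^-1)%:C * cexp (- ('i%C * beta%:C)).
pose c2 : R[i] := (- 8^-1)%:C * cexp ('i%C * beta%:C).
suff -> : (fun x => (threshold b x)%:C) =
    (fun x => c0 + (c1 * circle_mode P 1 x + c2 * circle_mode P (-1) x)).
  apply: trigpolyD; first exact: trigpoly_cst.
  by apply: trigpolyD; apply: trigpolyM;
    [exact: trigpoly_cst|exact: trigpoly_circle_mode|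
     exact: trigpoly_cst|exact: trigpoly_circle_mode].
apply/funext => x; rewrite /c1 /c2 /circle_mode -2!(mulrA (- 8^-1)%:C) -!cexpD.
rewrite /threshold; set a := pi * x / P.
have -> : pi * (b - x) / P = beta - a by rewrite /beta /a; field; rewrite gt_eqF.
have -> : 2 * pi * 1%:~R * x / P = a + a :> R.
  by rewrite /a; field; rewrite gt_eqF.
have -> : 2 * pi * (-1)%:~R * x / P = - (a + a) :> R.
  by rewrite /a mulrN1z; field; rewrite gt_eqF.
have E : sin a * sin (beta - a) = (cos (a + a - beta) - cos beta) / 2.
  have -> : a + a - beta = a - (beta - a) by ring.
  have -> : cos beta = cos (a + (beta - a)) by congr cos; ring.
  by move: (beta - a) => c; rewrite cosB cosD; field.
rewrite E; apply: complex_ext; rewrite !creimE /=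
  !(mul0r, mul1r, sub0r, addr0, oppr0, add0r, subr0) expR0 !mul1r.
  have -> : - beta + (a + a) = a + a - beta by ring.
  have -> : beta - (a + a) = - (a + a - beta) by ring.
  by rewrite cosN; field.
have -> : - beta + (a + a) = a + a - beta by ring.
have -> : beta - (a + a) = - (a + a - beta) by ring.
by rewrite sinN; ring.
Qed.

Let threshold_01 b x : 0 <= threshold b x <= 1.
Proof.
have : -1 <= sin (pi * x / P) * sin (pi * (b - x) / P) <= 1.
  by rewrite -ler_norml normrM mulr_ile1// ler_norml sin_geN1 sin_le1.
by rewrite /threshold; lra.
Qed.

Let sin_pos x : 0 < x < P -> 0 < sin (pi * x / P).
Proof.
move=> /andP[x0 xP]; apply: sin_gt0_pi.
rewrite divr_gt0 ?mulr_gt0 ?pi_gt0//=.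
by rewrite ltr_pdivrMr// ltr_pM2l// pi_gt0.
Qed.

Lemma approximable_indic_itv (b : R) :
  approximable (fun x => (\1_(`]-oo, b[%classic : set R) x)%:C).
Proof.
have mind : cmeasurable D (fun x => (\1_(`]-oo, b[%classic : set R) x : R)%:C).
  by apply: cmeasurable_real; apply: measurable_funTS; exact: measurable_indic.
have icst : mu.-integrable D (EFin \o (fun=> (1 : R))).
  by apply: integrable_itv => x; exact: cvg_cst.
have b1 n x : (step_poly n (threshold (Num.min b P) x)) <= 1.
  by have /andP[] := step_poly_01 n (threshold_01 (Num.min b P) x).
have b0 n x : 0 <= (step_poly n (threshold (Num.min b P) x)).
  by have /andP[] := step_poly_01 n (threshold_01 (Num.min b P) x).
have ind01 x : 0 <= (\1_(`]-oo, b[%classic : set R) x : R) <= 1.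
  by rewrite indicE; case: (_ \in _); rewrite ?ler01 ?lexx.
have [b00|b00] := leP b 0.
  apply: (approximable_limit (f_ := fun _ _ => 0) _ mind icst).
  - by move=> n; apply: approximable_trigpoly; exact: trigpoly_cst.
  - by move=> _ x _; rewrite subr0 cabs2_real; have := ind01 x; nra.
  apply: ae_imply (lebesgue_ae_neq 0) => x x0 /=; rewrite in_itv/= => /andP[xge0 _].
  rewrite indicE memNset/=; last first.
    by rewrite in_itv/=; apply/negP; rewrite -leNgt (le_trans b00).
  by rewrite subr0 cabs2_0; exact: cvg_cst.
set b' := Num.min b P in b0 b1.
apply: (approximable_limit (f_ := fun n x => (step_poly n (threshold b' x))%:C)
  _ mind icst).
- move=> n; apply: approximable_trigpoly.
  rewrite (_ : (fun x => _) = fun x =>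
      (1 + - ((threshold b' x)%:C ^+ n)) ^+ (2 ^ n)); last first.
    by apply/funext => x; rewrite /step_poly rmorphXn rmorphB rmorph1 rmorphXn.
  apply: trigpolyX; apply: trigpolyD; first exact: trigpoly_cst.
  by apply: trigpolyN; apply: trigpolyX; exact: threshold_trigpoly.
- move=> n x _; rewrite -rmorphB /= cabs2_real.
  by have := ind01 x; have := b0 n x; have := b1 n x; nra.
apply: ae_imply2 (lebesgue_ae_neq 0) (ae_imply2 _ (lebesgue_ae_neq P)
  (lebesgue_ae_neq b')) => [|x xP xb]; last exact: conj xP xb.
move=> x x0 [xP xb] /=; rewrite in_itv/= => /andP[x0' xP'].
have {x0 x0'}x0 : 0 < x by rewrite lt_neqAle x0' andbT eq_sym; apply/eqP.
have {xP xP'}xP : x < P by rewrite lt_neqAle xP' andbT; apply/eqP.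
have b'P : b' <= P by rewrite ge_min lexx orbT.
have sx : 0 < sin (pi * x / P) by apply: sin_pos; rewrite x0.
under eq_fun do rewrite -rmorphB /= cabs2_real.
have /andP[t0 t1] := threshold_01 b' x.
have [xb'|b'x] := ltP x b'.
  rewrite indicE mem_set/=; last first.
    by rewrite in_itv/=; move: xb'; rewrite lt_min => /andP[].
  apply: step_poly_low; rewrite t0/= /threshold.
  have : 0 < sin (pi * (b' - x) / P).
    by apply: sin_pos; rewrite subr_gt0 xb'/= (lt_le_trans _ b'P)// ltrBlDr ltrDl.
  by have := sx; nra.
have {b'x xb}b'x : b' < x by rewrite lt_neqAle b'x andbT eq_sym; apply/eqP.
rewrite indicE memNset/=; last first.
  rewrite in_itv/= => xb; move: b'x; apply/negP; rewrite -leNgt.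
  by rewrite le_min (ltW xb) (ltW xP).
under eq_fun do rewrite sub0r sqrrN.
apply: step_poly_high; rewrite t1 andbT /threshold.
have : 0 < sin (pi * (x - b') / P).
  by apply: sin_pos; rewrite subr_gt0 b'x/= ltrBlDr (lt_le_trans xP)// lerDl le_min !ltW.
have -> : pi * (b' - x) / P = - (pi * (x - b') / P) by rewrite -opprB mulrN mulNr.
by rewrite sinN; have := sx; nra.
Qed.

(** The sets whose indicators are approximable form a lambda-system, which
    contains the half-lines. *)
Lemma approximable_indic (A : set R) : measurable A ->
  approximable (fun x => (\1_A x)%:C).
Proof.
have icst : mu.-integrable D (EFin \o (fun=> (1 : R))).
  by apply: integrable_itv => x; exact: cvg_cst.
have ind01 (B : set R) x : 0 <= (\1_B x : R) <= 1.
  by rewrite indicE; case: (_ \in _); rewrite ?ler01 ?lexx.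
pose H : set (set R) := [set B | measurable B /\ approximable (fun x => (\1_B x)%:C)].
have lH : lambda_system setT H.
  split => //.
  - split => //; rewrite (_ : (fun x => _) = fun=> 1).
      by apply: approximable_trigpoly; exact: trigpoly_cst.
    by apply/funext => x; rewrite indicE mem_set.
  - move=> B C CB [mB aB] [mC aC]; split; first exact: measurableD.
    rewrite (_ : (fun x => _) = fun x => (\1_B x)%:C + (-1) * (\1_C x)%:C).
      by apply: approximableD => //; exact: approximableZ.
    apply/funext => x; rewrite mulN1r -rmorphB /=; congr (_%:C).
    rewrite !indicE in_setD; have [xC|xC] := boolP (x \in C).
      by rewrite (mem_set (CB _ (set_mem xC))) subrr.
    by rewrite andbT subr0.
  - move=> F ndF HF; have mU : measurable (\bigcup_k F k).
      by apply: bigcupT_measurable => k; case: (HF k).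
    split => //.
    apply: (approximable_limit (f_ := fun n x => (\1_(F n) x)%:C) _ _ icst).
    + by move=> n; case: (HF n).
    + by apply: cmeasurable_real; apply: measurable_funTS; exact: measurable_indic.
    + move=> n x _; rewrite -rmorphB /= cabs2_real.
      by have := ind01 (F n) x; have := ind01 (\bigcup_k F k) x; nra.
    + apply: ae_true => x _; have [[k _ Fkx]|nFx] := pselect ((\bigcup_k F k) x).
        apply/cvgrPdist_lt => e e0; near=> n.
        have Fnx : F n x.
          have kn : (k <= n)%N by near: n; exact: nbhs_infty_ge.
          by have /subsetPset := ndF _ _ kn; exact.
        rewrite !indicE !mem_set//; last by exists k.
        by rewrite subrr cabs2_0 subrr normr0.
      have nF n : x \notin F n by rewrite notin_setE => Fnx; apply: nFx; exists n.
      under eq_fun => n.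
        rewrite !indicE (negPf (nF n)) memNset//.
        rewrite subrr cabs2_0; over.
      exact: cvg_cst.
move=> mA; suff : H A by case.
suff sub : <<s (@RGenInftyO.G R) >> `<=` H.
  apply: sub; have := mA; rewrite [X in X A -> _](RGenInftyO.measurableE R); exact.
apply: lambda_system_subset lH _ _ => //.
- move=> _ _ [x ->] [y ->]; exists (Num.min x y).
  apply/seteqP; split=> z /=; rewrite !in_itv/= lt_min.
    by move=> [-> ->].
  by move=> /andP[].
- move=> _ [x ->]; split; first exact: measurable_itv.
  exact: approximable_indic_itv.
Unshelve. all: by end_near. Qed.

End TrigonometricDensity.

Section SquareIntegrableDensity.
Variables (R : realType) (P : R).
Hypothesis P0 : 0 < P.
Local Notation mu := (@lebesgue_measure R).
Local Notation Re := (@complex.Re R).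
Local Notation Im := (@complex.Im R).
Local Notation D := (`[0, P]%classic : set R).
Local Notation approximable := (@approximable R P).

Let mD : measurable D. Proof. exact: measurable_itv. Qed.

Lemma eq_approximable (f g : R -> R[i]) : f =1 g -> approximable f -> approximable g.
Proof. by move=> /funext->. Qed.

Import HBNNSimple.

Lemma approximable_nnsfun (g : {nnsfun R >-> R}) : approximable (fun x => (g x)%:C).
Proof.
have H (s : seq R) :
    approximable (fun x => (\sum_(y <- s) y * \1_(g @^-1` [set y]) x)%:C).
  elim: s => [|y s IH].
    apply: eq_approximable (approximable_trigpoly (trigpoly_cst P 0)) => x.
    by rewrite big_nil.
  have my : measurable (g @^-1` [set y]) by [].
  apply: eq_approximable (approximableD
    (approximableZ y%:C (approximable_indic P0 my)) IH) => x.
  by rewrite big_cons rmorphD rmorphM.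
apply: eq_approximable (H (finmap.enum_fset (fset_set (range g)))) => x.
by rewrite fimfunE fsbig_finite.
Qed.

Lemma approximable_ge0 (h : R -> R) : measurable_fun D h -> (forall x, 0 <= h x) ->
  mu.-integrable D (EFin \o (fun x => h x ^+ 2)) -> approximable (fun x => (h x)%:C).
Proof.
move=> mh h0 ih.
have mhE : measurable_fun D (EFin \o h) by exact/measurable_EFinP.
pose g := nnsfun_approx mD mhE.
have gcvg x : D x -> g n x @[n --> \oo] --> h x.
  move=> Dx; have /= := @cvg_nnsfun_approx _ _ R D mD _ mhE
    (fun x _ => (h0 x : (0 <= (h x)%:E)%E)) x Dx.
  by move=> /fine_cvgP[_].
have gh n x : D x -> 0 <= g n x <= h x.
  move=> Dx; rewrite fun_ge0/=.
  have nd : nondecreasing_seq (fun n => g n x).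
    by move=> m k mk; have /lefP := @nd_nnsfun_approx _ _ R D mD _ mhE m k mk; exact.
  have := nondecreasing_cvgn_le nd (cvgP _ (gcvg x Dx)) n.
  by rewrite (cvg_lim _ (gcvg x Dx)).
apply: (approximable_limit (f_ := fun n x => (g n x)%:C) _ _ ih).
- by move=> n; exact: approximable_nnsfun.
- exact: cmeasurable_real.
- move=> n x Dx; rewrite -rmorphB /= cabs2_real.
  by have /andP[] := gh n x Dx; nra.
- apply: ae_true => x Dx; under eq_fun do rewrite -rmorphB /= cabs2_real.
  have -> : (0 : R) = (h x - h x) ^+ 2 by rewrite subrr expr0n.
  have H : h x - g n x @[n --> \oo] --> h x - h x.
    by apply: cvgB; [exact: cvg_cst|exact: gcvg].
  by apply: (cvg_comp _ (fun y : R => y ^+ 2) H); exact: exprn_continuous.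
Qed.

Lemma approximable_real (h : R -> R) : measurable_fun D h ->
  mu.-integrable D (EFin \o (fun x => h x ^+ 2)) -> approximable (fun x => (h x)%:C).
Proof.
move=> mh ih.
have pos (k : R -> R) : measurable_fun D k -> (forall x, k x ^+ 2 <= h x ^+ 2) ->
    approximable (fun x => (Num.max (k x) 0)%:C).
  move=> mk kh; have mm : measurable_fun D (fun x => Num.max (k x) 0).
    by apply: measurable_maxr => //; exact: measurable_cst.
  apply: approximable_ge0 => //; first by move=> x; rewrite le_max lexx orbT.
  apply: (@integrable_dominated _ _ _ mu D mD _ _ _ _ ih).
    exact: measurable_funX.
  move=> x _; rewrite ger0_norm ?sqr_ge0//; apply: le_trans (kh x).
  by have [k0|k0] := leP (k x) 0; rewrite ?expr0n ?sqr_ge0.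
have p1 := pos h mh (fun x => lexx _).
have p2 := pos (fun x => - h x) (measurable_funN mh) _.
apply: eq_approximable (approximableD p1 (approximableZ (-1) (p2 _))) => x.
  rewrite mulN1r -rmorphB /=; congr (_%:C).
  have [h0|h0] := leP (h x) 0.
    by rewrite max_l ?oppr_ge0// sub0r opprK.
  by rewrite max_r ?subr0// oppr_le0 ltW.
by rewrite sqrrN.
Qed.

Lemma approximable_square_integrable (f : R -> R[i]) :
  square_integrable mu D f -> approximable f.
Proof.
move=> sf; have [[fr fi] _] := sf; have ifc := square_integrable_cabs2 sf.
have part (p : R[i] -> R) : measurable_fun D (p \o f) ->
    (forall z, p z ^+ 2 <= cabs2 z) -> approximable (fun x => (p (f x))%:C).
  move=> mp pz; apply: approximable_real => //.
  apply: (@integrable_dominated _ _ _ mu D mD _ _ _ _ ifc).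
    exact: measurable_funX.
  by move=> x _; rewrite ger0_norm ?sqr_ge0.
have aR := part Re fr (fun z => ler_wpDr (sqr_ge0 _) (lexx _)).
have aI := part Im fi (fun z => ler_wpDl (sqr_ge0 _) (lexx _)).
apply: eq_approximable (approximableD aR (approximableZ 'i%C aI)) => x.
by rewrite -complexE.
Qed.

(** The exponentials with the phase exp (2 i pi a) over one period P. *)
Definition twisted_mode (a : R) (n : int) (x : R) : R[i] :=
  cexp ('i%C * (2 * pi * (n%:~R + a) * x / P)%:C).

Lemma cabs2_unimodular (t : R) : cabs2 (cexp ('i%C * t%:C)) = 1.
Proof. by rewrite cabs2_cexp !reimE /= mul0r mul1r subr0 mulr0 expR0. Qed.

Lemma cmeasurable_twisted_mode (E : set R) a n : cmeasurable E (twisted_mode a n).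
Proof.
apply: cmeasurable_cexp; apply: cmeasurableM; first exact: cmeasurable_cst.
apply: cmeasurable_real; apply: measurable_funTS.
exact: measurable_funM.
Qed.

(** Completeness of the twisted exponentials in L2 of an interval of length P:
    multiplication by a unimodular function reduces it to the untwisted case. *)
Lemma twisted_density (a : R) (f : R -> R[i]) : square_integrable mu D f ->
  forall e : R, 0 < e -> exists (s : seq int) (c : int -> R[i]), uniq s /\
    sqnorm mu D (fun x => f x - \sum_(n <- s) c n * twisted_mode a n x) < e.
Proof.
move=> sf e e0; pose tw (x : R) := cexp ('i%C * (2 * pi * a * x / P)%:C).
pose twN (x : R) := cexp (- ('i%C * (2 * pi * a * x / P)%:C)).
have twNE x : twN x = cexp ('i%C * (- (2 * pi * a * x / P))%:C).
  by rewrite /twN rmorphN mulrN.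
have mtw : cmeasurable D twN.
  apply: cmeasurable_cexp; apply: cmeasurableN; apply: cmeasurableM.
    exact: cmeasurable_cst.
  by apply: cmeasurable_real; apply: measurable_funTS; exact: measurable_funM.
have sg : square_integrable mu D (fun x => f x * twN x).
  split; first by apply: cmeasurableM => //; case: sf.
  rewrite (_ : esqnorm _ _ _ = esqnorm mu D f); first by case: sf.
  by apply: eq_integral => x _; rewrite cabs2M twNE cabs2_unimodular mulr1.
have [_ /(_ e e0)[g tg fg]] := approximable_square_integrable sg.
have [s [c [us gE]]] := trigpoly_uniq tg.
exists s, c; split => //; rewrite -lte_fin.
have E x : f x * twN x - g x =
    twN x * (f x - \sum_(n <- s) c n * twisted_mode a n x).
  rewrite mulrBr mulrC gE; congr (_ - _); rewrite mulr_sumr; apply: eq_bigr => n _.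
  rewrite [RHS]mulrCA; congr (_ * _); rewrite /twN /twisted_mode -cexpD -mulrN -rmorphN.
  rewrite -mulrDr -rmorphD /=; congr (cexp (_ * _%:C)); field.
  by rewrite gt_eqF.
have sh : square_integrable mu D (fun x => f x - \sum_(n <- s) c n * twisted_mode a n x).
  apply: square_integrableB => //; apply: square_integrable_sum => // n; split.
    exact: cmeasurable_twisted_mode.
  rewrite /esqnorm (eq_integral (fun=> 1%:E)); last first.
    by move=> x _; rewrite cabs2_unimodular.
  by rewrite integral_cst//= mul1e lebesgue_measure_itv/= lte_fin P0 oppr0 adde0 ltry.
rewrite -esqnormE//; apply: le_lt_trans fg; rewrite le_eqVlt; apply/orP; left.
apply/eqP; apply: eq_integral => x _.
by rewrite E cabs2M twNE cabs2_unimodular mul1r.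
Qed.

End SquareIntegrableDensity.

(** * Quasi-periodic functions against an exponential weight *)

Section Translation.
Variable R : realType.
Local Notation mu := (@lebesgue_measure R).
Implicit Types (s : R).

Definition translation s (x : measurableTypeR R) : measurableTypeR R := x + s.

Let measurable_translation s : measurable_fun setT (translation s).
Proof. exact: measurable_funD. Qed.

HB.instance Definition _ s :=
  isMeasurableFun.Build _ _ _ _ (translation s) (measurable_translation s).

Lemma lebesgue_measure_shift s (A : set R) : measurable A ->
  pushforward mu (translation s) A = mu A.
Proof.
move=> mA; apply/esym/lebesgue_measure_unique => //= _ [[a b]] _ <-.
rewrite /pushforward (_ : _ @^-1` _ = `]a - s, b - s]%classic); last first.
  by apply/seteqP; split=> x /=; rewrite !in_itv/= /translation ltrBlDr lerBrDr.
rewrite !lebesgue_measure_itv/= !lte_fin ltrD2r; case: ifPn => // _.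
by rewrite -!EFinB; congr EFin; ring.
Qed.

Lemma ge0_integral_shift s (D : set R) (f : R -> \bar R) : measurable D ->
  measurable_fun D f -> (forall x, D x -> 0 <= f x)%E ->
  (\int[mu]_(x in D) f x = \int[mu]_(x in [set x | D (x + s)%R]) f (x + s)%R)%E.
Proof.
move=> mD mf f0; rewrite -(@ge0_integral_pushforward _ _ _ _ _ (translation s) _ mu)//.
- by apply: eq_measure_integral => //= A mA AS; exact/esym/lebesgue_measure_shift.
- by move=> x /set_mem; exact: f0.
Qed.

Lemma integral_shift s (f : R -> \bar R) : measurable_fun setT f ->
  (\int[mu]_x f x = \int[mu]_x f (x + s)%R)%E.
Proof.
move=> mf; rewrite [LHS]integralE [RHS]integralE; congr (_ - _)%E.
- have := @ge0_integral_shift s setT (f^\+)%E measurableT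
    (measurable_funepos mf) (fun x _ => funepos_ge0 f x).
  by move=> ->; apply: eq_integral => x _; rewrite !funeposE.
- have := @ge0_integral_shift s setT (f^\-)%E measurableT
    (measurable_funeneg mf) (fun x _ => funeneg_ge0 f x).
  by move=> ->; apply: eq_integral => x _; rewrite !funenegE.
Qed.

Lemma cintegral_shift s (f : R -> R[i]) : cmeasurable setT f ->
  cintegral mu setT f = cintegral mu setT (fun x => f (x + s)).
Proof.
move=> [fr fi]; rewrite /cintegral /Rintegral; congr (fine _ +i* fine _).
  by rewrite (integral_shift s)//; exact/measurable_EFinP.
by rewrite (integral_shift s)//; exact/measurable_EFinP.
Qed.

End Translation.

Section Periodization.
Variables (R : realType) (P : R).
Hypothesis P0 : 0 < P.
Local Notation mu := (@lebesgue_measure R).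
Variable u : R -> R.
Hypothesis mu_ : measurable_fun setT u.
Hypothesis u0 : forall q, 0 <= u q.
Hypothesis uper : forall m : int, {ae mu, forall q, u (q + P * m%:~R) = u q}.

(** Half-open, so that distinct tiles are disjoint. *)
Let tile (m : int) : set R := `[P * m%:~R, P * (m + 1)%:~R[%classic.

Let integral_tile m :
  (\int[mu]_(q in tile m) (u q)%:E = \int[mu]_(q in `[0%R, P]) (u q)%:E)%E.
Proof.
rewrite -(integral_itv_bndo_bndc (a := BLeft 0)); last first.
  by apply/measurable_EFinP; exact: measurable_funTS.
rewrite (@ge0_integral_shift _ (P * m%:~R))//; last 3 first.
- exact: measurable_itv.
- by apply/measurable_EFinP; exact: measurable_funTS.
- by move=> x _; rewrite lee_fin.
rewrite (_ : [set _ | _] = `[0, P[%classic); last first.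
  apply/seteqP; split=> x /=; rewrite /tile /= !in_itv/= intrD mulrDr mulr1.
    by move=> /andP[x1 x2]; apply/andP; split; lra.
  by move=> /andP[x1 x2]; apply/andP; split; lra.
apply: ge0_ae_eq_integral => //.
- apply/measurable_EFinP; apply: measurable_funTS.
  apply: (measurableT_comp mu_).
  exact: measurable_funD.
- by apply/measurable_EFinP; exact: measurable_funTS.
- by move=> x _; rewrite lee_fin.
- by move=> x _; rewrite lee_fin.
- by apply: ae_imply (uper m) => q -> _.
Qed.

Let w (q : R) := expR (- `|q|).
Let mw : measurable_fun setT w.
Proof.
by apply: measurableT_comp => //; apply: measurableT_comp.
Qed.

Let r := expR (- P).
Let r1 : r < 1. Proof. by rewrite -expR0 ltr_expR oppr_lt0. Qed.
Let r0 : 0 <= r. Proof. exact: expR_ge0. Qed.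

Let integral_tile_weighted m (k : nat) : (forall q, tile m q -> P * k%:R <= `|q|) ->
  (\int[mu]_(q in tile m) (u q * w q)%:E <=
   (r ^+ k)%:E * \int[mu]_(q in `[0%R, P]) (u q)%:E)%E.
Proof.
move=> mk; rewrite -(integral_tile m) -ge0_integralZl//; last 4 first.
- exact: measurable_itv.
- by apply/measurable_EFinP; exact: measurable_funTS.
- by move=> x _; rewrite lee_fin.
- by rewrite lee_fin exprn_ge0.
apply: ge0_le_integral => //; first exact: measurable_itv.
- by move=> x _; rewrite lee_fin mulr_ge0// expR_ge0.
- by apply/measurable_EFinP; apply: measurable_funTS; exact: measurable_funM.
- apply: measurable_funeM; apply/measurable_EFinP; exact: measurable_funTS.
- move=> q /mk kq; rewrite -EFinM lee_fin mulrC ler_wpM2r// /r -expRM_natl.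
  by rewrite ler_expR mulrN lerN2 mulrC.
Qed.

(** The tiles at distance k P from the origin contribute at most a fixed
    multiple of r ^ k, hence a geometric series. *)
Lemma periodization_le :
  (\int[mu]_q (u q * expR (- `|q|))%:E <=
   (2 / (1 - r))%:E * \int[mu]_(q in `[0%R, P]) (u q)%:E)%E.
Proof.
set I := (\int[mu]_(q in `[0%R, P]) (u q)%:E)%E.
have I0 : (0 <= I)%E by apply: integral_ge0 => x _; rewrite lee_fin.
pose F (k : nat) : set R := `[- (P * k%:R), P * k%:R[%classic.
have uw0 q : (0 <= (u q * w q)%:E)%E by rewrite lee_fin mulr_ge0// expR_ge0.
have muw (A : set R) : measurable_fun A (fun q => (u q * w q)%:E).
  by apply/measurable_EFinP; apply: measurable_funTS; exact: measurable_funM.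
have r1' : 0 < 1 - r by rewrite subr_gt0.
have intNS (k : nat) : ((- k.+1%:Z + 1)%:~R : R) = - k%:R.
  by rewrite intrD mulrNz -pmulrn -natr1; ring.
have FS k : F k.+1 = F k `|` (tile k%:Z `|` tile (- (k.+1)%:Z)).
  rewrite /tile.
  have -> : ((k%:Z + 1)%:~R : R) = k.+1%:R by rewrite -addn1 natrD intrD.
  have -> : ((- k.+1%:Z + 1)%:~R : R) = - k%:R by exact: intNS.
  rewrite mulrNz mulrN mulrN.
  have : 0 <= P * k%:R by rewrite mulr_ge0// ltW.
  rewrite /F -!pmulrn -[k.+1%:R]natr1 mulrDr mulr1; set t := P * _ => t0.
  apply/seteqP; split=> x /=; rewrite !in_itv/=.
    move=> /andP[x1 x2]; have [xt|tx] := ltP x t; last by right; left; rewrite x2.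
    have [xt'|tx'] := ltP x (- t); last by left.
    by right; right; rewrite x1.
  move=> [|[]] /andP[x1 x2]; apply/andP; split; have := P0; lra.
have dis1 k : [disjoint F k & tile k%:Z `|` tile (- (k.+1)%:Z)].
  rewrite disj_set2E; apply/eqP/seteqP; split=> x //= [].
  rewrite /F /tile /= !in_itv/=.
  have -> : ((- k.+1%:Z + 1)%:~R : R) = - k%:R by exact: intNS.
  rewrite (mulrN P k%:R) -!pmulrn => /andP[x1 x2] [/andP[x3 _]|/andP[_ x4]].
    by have := le_lt_trans x3 x2; rewrite ltxx.
  by have := le_lt_trans x1 x4; rewrite ltxx.
have dis2 k : [disjoint tile k%:Z & tile (- (k.+1)%:Z)].
  rewrite disj_set2E; apply/eqP/seteqP; split=> x //= [].
  rewrite /F /tile /= !in_itv/=.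
  have -> : ((- k.+1%:Z + 1)%:~R : R) = - k%:R by exact: intNS.
  rewrite (mulrN P k%:R) -!pmulrn => /andP[x1 _] /andP[_ x2].
  have := le_lt_trans x1 x2; rewrite ltNge => /negP; apply.
  by rewrite (@le_trans _ _ 0)// ?oppr_le0 mulr_ge0// ltW.
have J k : (\int[mu]_(q in F k) (u q * w q)%:E <=
    (2 / (1 - r) * (1 - r ^+ k))%:E * I)%E.
  elim: k => [|k IH].
    rewrite /F mulr0 oppr0 expr0 subrr mulr0 mul0e.
    rewrite (_ : [set` _] = set0) ?integral_set0//.
    by apply/seteqP; split=> x //=; rewrite in_itv/= => /andP[x1 x2];
      have := le_lt_trans x1 x2; rewrite ltxx.
  rewrite FS ge0_integral_setU//; try exact: measurable_itv.
  - rewrite ge0_integral_setU//; try exact: measurable_itv.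
    have -> : 2 / (1 - r) * (1 - r ^+ k.+1) =
        2 / (1 - r) * (1 - r ^+ k) + (r ^+ k + r ^+ k).
      by rewrite exprS; field; rewrite gt_eqF.
    have rk : 0 <= r ^+ k by rewrite exprn_ge0.
    have rk1 : 0 <= 1 - r ^+ k by rewrite subr_ge0 exprn_ile1// ltW.
    have c0 : 0 <= 2 / (1 - r) by rewrite divr_ge0// ltW.
    rewrite !EFinD !ge0_muleDl ?lee_fin ?addr_ge0 ?(mulr_ge0 c0 rk1)//.
    apply: leeD => //; apply: leeD; apply: integral_tile_weighted => q.
      rewrite /tile /= in_itv/= -pmulrn => /andP[q1 _].
      exact: le_trans (ler_norm _).
    rewrite /tile /= in_itv/=.
    have -> : ((- k.+1%:Z + 1)%:~R : R) = - k%:R by exact: intNS.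
    rewrite (mulrN P k%:R) => /andP[_ q2]; rewrite -normrN.
    by apply: le_trans (ler_norm _); rewrite lerNr ltW.
  - exact: muw.
  - by apply: measurableU; exact: measurable_itv.
  - exact: muw.
have UF : \bigcup_k F k = setT.
  apply/seteqP; split=> x //= _; exists (Num.bound (`|x| / P)) => //=.
  have := archi_boundP (divr_ge0 (normr_ge0 x) (ltW P0)).
  rewrite ltr_pdivrMr// (mulrC _ P) ltr_norml => /andP[x1 x2].
  by rewrite /F /= in_itv/= (ltW x1).
apply: (@le_trans _ _ (\int[mu]_(q in \bigcup_k F k) (u q * w q)%:E)%E).
  by rewrite UF.
have ndF : nondecreasing_seq F.
  by apply/nondecreasing_seqP => k; apply/subsetPset; rewrite FS; exact: subsetUl.
have mF k : measurable (F k : set (measurableTypeR R)) by exact: measurable_itv.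
have cv := @ge0_nondecreasing_set_cvg_integral _ (measurableTypeR R) R F _ mu ndF mF
  (fun i => muw (F i)) (fun _ q _ => uw0 q).
rewrite -(cvg_lim _ cv)//; apply: lime_le; first exact: cvgP cv.
apply: nearW => k; apply: le_trans (J k) _; rewrite lee_wpmul2r// lee_fin.
by rewrite ler_piMr ?divr_ge0 ?(ltW r1')// gerBl exprn_ge0.
Qed.

End Periodization.

(** * The Bargmann transform of a quasi-periodic function *)

Section LaplaceTransform.
Variable R : realType.
Local Notation mu := (@lebesgue_measure R).
Variable v : R -> R[i].
Hypothesis mv : cmeasurable setT v.
Hypothesis iv : forall c : R,
  mu.-integrable setT (EFin \o (fun q => cabs (v q) * expR (c * `|q|))).

(** Up to a Gaussian factor and a dilation, the Bargmann transform is this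
    bilateral Laplace transform of a function damped by a Gaussian. *)
Definition laplace (z : R[i]) : R[i] :=
  cintegral mu setT (fun q => v q * cexp (z * q%:C)).

Let mexp z : cmeasurable setT (fun q : R => cexp (z * q%:C)).
Proof.
apply: cmeasurable_cexp; apply: cmeasurableM; first exact: cmeasurable_cst.
exact: cmeasurable_real.
Qed.

Lemma cabs_exp_le z (q : R) : cabs (cexp (z * q%:C)) <= expR (cabs z * `|q|).
Proof.
rewrite cabs_cexp ler_expR -[X in _ <= X * _]ger0_norm ?cabs_ge0// -normrM.
rewrite !reimE /= mulr0 subr0 (le_trans (ler_norm _))// !normrM ler_wpM2r//.
by rewrite (le_trans (Re_le_cabs z))// ler_norm.
Qed.

Lemma laplace_integrable z : cintegrable mu setT (fun q => v q * cexp (z * q%:C)).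
Proof.
apply: (@cintegrable_dominated _ _ _ mu setT measurableT _ _ _ _ (iv (cabs z))).
  exact: (cmeasurableM mv (mexp z)).
by move=> q _; rewrite cabsM ler_wpM2l ?cabs_ge0 ?cabs_exp_le.
Qed.

Let le_expR (t : R) : t <= expR t.
Proof. by rewrite (le_trans _ (expR_ge1Dx _))// lerDr. Qed.

(** Differentiation under the integral sign, with the quadratic remainder of exp
    bounded uniformly in q by an integrable function. *)
Lemma entire_laplace : entire laplace.
Proof.
apply/entireP => z.
have mid : cmeasurable setT (fun q : R => q%:C) by exact: cmeasurable_real.
have iq : cintegrable mu setT (fun q => q%:C * (v q * cexp (z * q%:C))).
  apply: (@cintegrable_dominated _ _ _ mu setT measurableT _ _ _ _ (iv (1 + cabs z))).
    exact: (cmeasurableM mid (cmeasurableM mv (mexp z))).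
  move=> q _; rewrite 2!cabsM cabs_real mulrCA ler_wpM2l ?cabs_ge0//.
  by rewrite mulrDl mul1r expRD ler_pM ?cabs_ge0 ?cabs_exp_le// le_expR.
exists (cintegral mu setT (fun q => q%:C * (v q * cexp (z * q%:C)))) => e e0.
pose M := Rintegral mu setT (fun q => cabs (v q) * expR ((3 + cabs z) * `|q|)).
have M0 : 0 <= M.
  by apply: Rintegral_ge0 => q _; rewrite mulr_ge0 ?expR_ge0 ?cabs_ge0.
exists (Num.min 1 (e / (12 * M + 1))).
  by rewrite lt_min ltr01 divr_gt0// ltr_wpDl// mulr_ge0.
move=> h; rewrite lt_min => /andP[h1 he].
set d := cintegral _ _ _.
have -> : laplace (z + h) - laplace z - d * h = cintegral mu setT (fun q =>
    (v q * cexp ((z + h) * q%:C) - v q * cexp (z * q%:C))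
     - h * (q%:C * (v q * cexp (z * q%:C)))).
  rewrite cintegralB//; last 2 first.
  - apply: cintegrableD => //; first exact: laplace_integrable.
    by apply: cintegrableN => //; exact: laplace_integrable.
  - exact: cintegrableZ.
  rewrite cintegralB//; try exact: laplace_integrable.
  by rewrite cintegralZ// mulrC.
set F := fun q => _.
have FE q : F q = (v q * cexp (z * q%:C)) * (cexp (h * q%:C) - 1 - h * q%:C).
  rewrite /F (mulrDl z h) cexpD.
  move: (cexp (z * _)) (cexp (h * _)) => a b; ring.
have Fle q : cabs (F q) <=
    6 * cabs h ^+ 2 * (cabs (v q) * expR ((3 + cabs z) * `|q|)).
  rewrite FE cabsM cabsM.
  have -> : 6 * cabs h ^+ 2 * (cabs (v q) * expR ((3 + cabs z) * `|q|)) =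
     cabs (v q) * expR (cabs z * `|q|) * (6 * (cabs h ^+ 2 * expR (3 * `|q|))).
    by rewrite (mulrDl 3 (cabs z)) expRD; ring.
  apply: ler_pM; rewrite ?mulr_ge0 ?cabs_ge0//.
    by rewrite ler_wpM2l ?cabs_ge0 ?cabs_exp_le.
  apply: le_trans (cexp_taylor _) _; rewrite ler_wpM2l//.
  rewrite cabsM cabs_real exprMn -mulrA ler_wpM2l ?sqr_ge0//.
  have -> : 3 * `|q| = `|q| + `|q| + `|q| by ring.
  rewrite !expRD; apply: ler_pM; rewrite ?sqr_ge0 ?expR_ge0//.
    by rewrite expr2; apply: ler_pM => //; exact: le_expR.
  by rewrite ler_expR ler_piMl// ltW.
have iF : cintegrable mu setT F.
  apply: cintegrableD => //; last exact/cintegrableN/cintegrableZ.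
  apply: cintegrableD => //; first exact: laplace_integrable.
  by apply: cintegrableN => //; exact: laplace_integrable.
apply: le_trans (cabs_cintegral_le _ iF) _ => //.
apply: le_trans (_ : 2 * (6 * cabs h ^+ 2 * M) <= _).
  rewrite ler_wpM2l// /M -RintegralZl//.
  apply: le_Rintegral => //; first exact: cintegrable_cabs.
  by have := integrableZl measurableT (6 * cabs h ^+ 2) (iv (3 + cabs z));
    exact: eq_integrable.
have M12 : 0 < 12 * M + 1 by rewrite ltr_wpDl// mulr_ge0.
have -> : 2 * (6 * cabs h ^+ 2 * M) = (12 * M) * cabs h * cabs h by ring.
rewrite ler_wpM2r ?cabs_ge0//.
move: he; rewrite ltr_pdivlMr// => /ltW; apply: le_trans.
by rewrite mulrC ler_wpM2l ?cabs_ge0// lerDl.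
Qed.

End LaplaceTransform.

Section BargmannTransform.
Variables (R : realType) (nu alpha : R).
Hypothesis nu0 : 0 < nu.
Local Notation mu := (@lebesgue_measure R).
Local Notation sqrt2 := (Num.sqrt (2 : R)).
Local Notation D := (`[0, sqrt2]%classic : set R).
Local Notation QP := (quasi_periodic_L2 alpha).
Implicit Types (phi psi : R -> R[i]) (z : R[i]) (q : R).

Let s2 : 0 < sqrt2. Proof. by rewrite sqrtr_gt0. Qed.
Let mD' : measurable (D : set (measurableTypeR R)).
Proof. exact: measurable_itv. Qed.
Let s22 : sqrt2 * sqrt2 = 2. Proof. by rewrite -expr2 sqr_sqrtr. Qed.

Lemma quasi_periodic_cmeasurable phi (E : set R) : QP phi -> cmeasurable E phi.
Proof. by move=> [mr mi _ _]; split; apply: measurable_funTS. Qed.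

Lemma quasi_periodic_square_integrable phi : QP phi -> square_integrable mu D phi.
Proof. by move=> Q; split; [exact: quasi_periodic_cmeasurable|case: Q]. Qed.

Lemma quasi_periodicD phi psi (c : R[i]) : QP phi -> QP psi ->
  QP (fun q => c * phi q + psi q).
Proof.
move=> Qf Qg; have [_ _ pf _] := Qf; have [_ _ pg _] := Qg.
have [mr mi] : cmeasurable setT (fun q => c * phi q + psi q).
  apply: cmeasurableD; last exact: quasi_periodic_cmeasurable.
  apply: cmeasurableM; first exact: cmeasurable_cst.
  exact: quasi_periodic_cmeasurable.
split => //.
- move=> m; apply: ae_imply2 (pf m) (pg m) => q -> ->.
  by move: (cexp _) => e; ring.
- have [] : square_integrable mu D (fun q => c * phi q + psi q).
    apply: square_integrableD => //; last exact: quasi_periodic_square_integrable.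
    exact/square_integrableZ/quasi_periodic_square_integrable.
  by [].
Qed.

Let cabs_phase (t : R) : cabs (cexp ('i%C * t%:C)) = 1.
Proof. by rewrite /cabs cabs2_unimodular sqrtr1. Qed.

Lemma quasi_periodic_weighted_le phi : QP phi ->
  (\int[mu]_q (cabs (phi q) * expR (- `|q|))%:E <=
   (2 / (1 - expR (- sqrt2)))%:E * \int[mu]_(q in D) (cabs (phi q))%:E)%E.
Proof.
move=> Q; apply: periodization_le => //.
- by apply: measurable_cabs; exact: quasi_periodic_cmeasurable.
- by move=> q; exact: cabs_ge0.
- move=> m; have [_ _ pf _] := Q; apply: ae_imply (pf m) => q ->.
  by rewrite cabsM cabs_phase mul1r.
Qed.

Let muD : mu D = sqrt2%:E.
Proof. by rewrite lebesgue_measure_itv/= lte_fin s2 oppr0 adde0. Qed.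

(** The inequality 2 ab <= t a ^ 2 + b ^ 2 / t, in place of Cauchy-Schwarz. *)
Lemma integral_cabs_le phi (t : R) : 0 < t -> QP phi ->
  (\int[mu]_(q in D) (cabs (phi q))%:E <=
   ((t * sqrt2 + sqnorm mu D phi / t) / 2)%:E)%E.
Proof.
move=> t0 Q; have sq := quasi_periodic_square_integrable Q.
have i2 := square_integrable_cabs2 sq.
have mf := quasi_periodic_cmeasurable D Q.
have ic : mu.-integrable D (EFin \o (fun=> t)).
  by apply: integrable_itv => x; exact: cvg_cst.
have iz : mu.-integrable D (EFin \o (fun q => t^-1 * cabs2 (phi q))).
  by have := integrableZl mD' t^-1 i2; exact: eq_integrable.
have is_ : mu.-integrable D (EFin \o (fun q => t + t^-1 * cabs2 (phi q))).
  by have := integrableD mD' ic iz; exact: eq_integrable.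
have ih : mu.-integrable D (EFin \o (fun q => 2^-1 * (t + t^-1 * cabs2 (phi q)))).
  by have := integrableZl mD' 2^-1 is_; exact: eq_integrable.
have le q : cabs (phi q) <= 2^-1 * (t + t^-1 * cabs2 (phi q)).
  by rewrite mulrC (mulrC t^-1); exact: cabs_le_cabs2.
apply: (@le_trans _ _ (\int[mu]_(q in D) (2^-1 * (t + t^-1 * cabs2 (phi q)))%:E)%E).
  apply: ge0_le_integral => //.
  - by move=> x _; rewrite lee_fin cabs_ge0.
  - by apply/measurable_EFinP; exact: measurable_cabs.
  - by case/integrableP: ih.
  - by move=> x _; rewrite lee_fin.
rewrite -[leLHS]fineK; last exact: integrable_fin_num ih.
rewrite lee_fin.
have -> : fine (\int[mu]_(q in D) (2^-1 * (t + t^-1 * cabs2 (phi q)))%:E)%E =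
  Rintegral mu D (fun q => 2^-1 * (t + t^-1 * cabs2 (phi q))) by [].
rewrite RintegralZl// RintegralD// RintegralZl// Rintegral_cst//.
have -> : fine (mu D) = sqrt2 by rewrite muD.
by rewrite mulrC (mulrC t^-1).
Qed.

Lemma quasi_periodic_weighted_integrable phi : QP phi ->
  mu.-integrable setT (EFin \o (fun q => cabs (phi q) * expR (- `|q|))).
Proof.
move=> Q; apply: ge0_integrable_lty => //.
- apply: measurable_funM.
    by apply: measurable_cabs; exact: quasi_periodic_cmeasurable.
  by apply: measurableT_comp => //; apply: measurableT_comp.
- by move=> q _; rewrite mulr_ge0 ?cabs_ge0 ?expR_ge0.
- apply: le_lt_trans (quasi_periodic_weighted_le Q) _.
  apply: lte_mul_pinfty => //.
  by apply: le_lt_trans (integral_cabs_le ltr01 Q) _; rewrite ltry.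
Qed.

(** The Gaussian beats every exponential: complete the square. *)
Let gauss_decay (c q : R) : expR (- (nu / 2 * q ^+ 2)) * expR (c * `|q|) <=
  expR ((c + 1) ^+ 2 / (2 * nu)) * expR (- `|q|).
Proof.
rewrite -!expRD ler_expR -(real_normK (num_real q)); set t := `|q|.
rewrite -subr_ge0.
have -> : (c + 1) ^+ 2 / (2 * nu) + - t - (- (nu / 2 * t ^+ 2) + c * t) =
  (nu * t - (c + 1)) ^+ 2 / (2 * nu) by field; rewrite gt_eqF.
by rewrite divr_ge0 ?sqr_ge0// mulr_ge0// ltW.
Qed.

Definition gauss_damped phi q : R[i] := phi q * (expR (- (nu / 2 * q ^+ 2)))%:C.

Let gauss_damped_measurable phi : QP phi -> cmeasurable setT (gauss_damped phi).
Proof.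
move=> Q; apply: cmeasurableM; first exact: quasi_periodic_cmeasurable.
apply: cmeasurable_real; apply: measurableT_comp => //.
by apply: measurableT_comp => //; apply: measurable_funM => //; exact: measurable_funX.
Qed.

Let gauss_damped_le phi (c q : R) : cabs (gauss_damped phi q) * expR (c * `|q|) <=
  expR ((c + 1) ^+ 2 / (2 * nu)) * (cabs (phi q) * expR (- `|q|)).
Proof.
rewrite /gauss_damped cabsM cabs_real ger0_norm ?expR_ge0// -mulrA [leRHS]mulrCA.
by rewrite ler_wpM2l ?cabs_ge0 ?gauss_decay.
Qed.

Let gauss_damped_integrable phi : QP phi -> forall c : R, mu.-integrable setT
  (EFin \o (fun q => cabs (gauss_damped phi q) * expR (c * `|q|))).
Proof.
move=> Q c; apply: (@integrable_dominated _ _ _ mu setT measurableT _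
  (fun q => expR ((c + 1) ^+ 2 / (2 * nu)) * (cabs (phi q) * expR (- `|q|)))).
- apply: measurable_funM; first exact/measurable_cabs/gauss_damped_measurable.
  by apply: measurableT_comp => //; apply: measurable_funM => //; apply: measurableT_comp.
- move=> q _; rewrite ger0_norm ?mulr_ge0 ?cabs_ge0 ?expR_ge0//.
- have := integrableZl measurableT (expR ((c + 1) ^+ 2 / (2 * nu)))
    (quasi_periodic_weighted_integrable Q).
  exact: eq_integrable.
Qed.

Lemma bargmann_integrandE phi z q : bargmann_integrand nu phi z q =
  cexp (- (nu%:C / 2 * z ^+ 2)) *
  (gauss_damped phi q * cexp ((nu * sqrt2)%:C * z * q%:C)).
Proof.
rewrite /bargmann_integrand /gauss_damped -cexp_real.
have -> : - (nu%:C / 2 * (z ^+ 2 + q%:C ^+ 2)) + (nu * sqrt2)%:C * z * q%:C =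
  - (nu%:C / 2 * z ^+ 2) + ((- (nu / 2 * q ^+ 2))%:C + (nu * sqrt2)%:C * z * q%:C).
  have -> : (- (nu / 2 * q ^+ 2))%:C = - (nu%:C / 2 * q%:C ^+ 2) :> R[i].
    by rewrite !expr2 rmorphN !rmorphM fmorphV rmorph_nat.
  by rewrite mulrDr opprD addrA.
rewrite !cexpD; move: (cexp _) (cexp _) (cexp _) => a b c; ring.
Qed.

Lemma bargmann_exists_quasi_periodic phi : QP phi -> bargmann_exists nu phi.
Proof.
move=> Q z; have := cintegrableZ measurableT (cexp (- (nu%:C / 2 * z ^+ 2)))
  (laplace_integrable (gauss_damped_measurable Q) (gauss_damped_integrable Q)
   ((nu * sqrt2)%:C * z)).
by under eq_fun do rewrite -bargmann_integrandE.
Qed.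

Lemma bargmannE phi z : QP phi -> bargmann nu phi z =
  ((nu / pi) `^ (3 / 4))%:C * (cexp (- (nu%:C / 2 * z ^+ 2)) *
   laplace (gauss_damped phi) ((nu * sqrt2)%:C * z)).
Proof.
move=> Q; rewrite /bargmann; congr (_ * _); rewrite /laplace -cintegralZ//; last first.
  exact: laplace_integrable (gauss_damped_measurable Q) (gauss_damped_integrable Q) _.
by apply: eq_cintegral => q _; rewrite bargmann_integrandE.
Qed.

Lemma entire_bargmann phi : QP phi -> entire (bargmann nu phi).
Proof.
move=> Q; have -> : bargmann nu phi = fun z => ((nu / pi) `^ (3 / 4))%:C *
   ((@cexp R \o (fun z => - (nu%:C / 2) * (z * z))) z *
   (laplace (gauss_damped phi) \o (fun z => (nu * sqrt2)%:C * z)) z).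
  by apply/funext => z; rewrite bargmannE//= mulNr.
apply: entireM; first exact: entire_cst.
apply: entireM.
  apply: entire_comp (@entire_cexp R); apply: entireM; first exact: entire_cst.
  by apply: entireM; exact: entire_id.
apply: entire_comp.
  by apply: entireM; [exact: entire_cst|exact: entire_id].
by apply: entire_laplace; [exact: gauss_damped_measurable|exact: gauss_damped_integrable].
Qed.

Lemma bargmann_linear (c : R[i]) phi psi : QP phi -> QP psi ->
  bargmann nu (fun q => c * phi q + psi q) =
  (fun z => c * bargmann nu phi z + bargmann nu psi z).
Proof.
move=> Qf Qg; apply/funext => z; rewrite /bargmann mulrCA -mulrDr; congr (_ * _).
have Ef := bargmann_exists_quasi_periodic Qf z.
have Eg := bargmann_exists_quasi_periodic Qg z.
rewrite -cintegralZ// -cintegralD//; last exact: cintegrableZ.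
by apply: eq_cintegral => q _; rewrite /bargmann_integrand mulrDl mulrA.
Qed.

(** The kernel at (z + t, q + sqrt 2 t) is the kernel at (z, q) times an
    exponential that does not depend on q: change of variable in the integral. *)
Lemma bargmann_translation phi (lambda : R[i]) (t : R) : QP phi ->
  {ae mu, forall q, phi (q + sqrt2 * t) = lambda * phi q} ->
  forall z, bargmann nu phi (z + t%:C) =
    lambda * cexp (nu%:C * (z + t%:C / 2) * t%:C) * bargmann nu phi z.
Proof.
move=> Q pt z; rewrite /bargmann mulrCA; congr (_ * _).
set k := lambda * _.
have Ez := bargmann_exists_quasi_periodic Q z.
have Ezt := bargmann_exists_quasi_periodic Q (z + t%:C).
rewrite -cintegralZ// (cintegral_shift (sqrt2 * t)); last exact: cintegrable_measurable Ezt.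
have H : {ae mu, forall q, bargmann_integrand nu phi (z + t%:C) (q + sqrt2 * t) =
    k * bargmann_integrand nu phi z q}.
  apply: ae_imply pt => q E; rewrite /bargmann_integrand E /k.
  have -> : - (nu%:C / 2 * ((z + t%:C) ^+ 2 + (q + sqrt2 * t)%:C ^+ 2)) +
      (nu * sqrt2)%:C * (z + t%:C) * (q + sqrt2 * t)%:C =
     nu%:C * (z + t%:C / 2) * t%:C +
     (- (nu%:C / 2 * (z ^+ 2 + q%:C ^+ 2)) + (nu * sqrt2)%:C * z * q%:C).
    have s22C : sqrt2%:C * sqrt2%:C = 2 :> R[i] by rewrite -rmorphM s22 rmorph_nat.
    rewrite !(rmorphD, rmorphM) /=; move: s22C.
    move: (nu%:C) (sqrt2%:C) (t%:C) (q%:C) => n s t' q' ss.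
    have -> : n * s * (z + t') * (q' + s * t') =
      n * s * z * q' + n * s * t' * q' + n * (s * s) * t' * (z + t') by ring.
    have -> : (q' + s * t') ^+ 2 = q' ^+ 2 + 2 * (s * q' * t') + (s * s) * t' ^+ 2 by ring.
    by rewrite ss; field.
  by rewrite cexpD; move: (cexp _) (cexp _) => a b; ring.
have [mr mi] : cmeasurable setT (fun q => bargmann_integrand nu phi (z + t%:C) (q + sqrt2 * t)).
  have [r i] := cintegrable_measurable Ezt.
  by split; [apply: (measurableT_comp r)|apply: (measurableT_comp i)];
    exact: measurable_funD.
have [kr ki] := cintegrable_measurable (cintegrableZ measurableT k Ez).
rewrite /cintegral /Rintegral; congr (fine _ +i* fine _); apply: ae_eq_integral => //.
- exact/measurable_EFinP.
- exact/measurable_EFinP.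
- by apply: ae_imply H => q /= -> _.
- exact/measurable_EFinP.
- exact/measurable_EFinP.
- by apply: ae_imply H => q /= -> _.
Qed.

(** A value of the transform is controlled by the L1 norm over one period, thanks
    to the periodization estimate, hence by the L2 norm. *)
Lemma bargmann_small z (e : R) : 0 < e -> exists2 d : R, 0 < d &
  forall phi, QP phi -> sqnorm mu D phi < d -> cabs (bargmann nu phi z) <= e.
Proof.
move=> e0; set w := (nu * sqrt2)%:C * z; set c := cabs w.
pose A := `|(nu / pi) `^ (3 / 4)| * (cabs (cexp (- (nu%:C / 2 * z ^+ 2))) *
  (2 * (expR ((c + 1) ^+ 2 / (2 * nu)) * (2 / (1 - expR (- sqrt2)))))).
pose K := A + 1.
have r1 : 0 < 1 - expR (- sqrt2) by rewrite subr_gt0 -expR0 ltr_expR oppr_lt0.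
have c1 : 0 < expR ((c + 1) ^+ 2 / (2 * nu)) by exact: expR_gt0.
have c2 : 0 < 2 / (1 - expR (- sqrt2)) by rewrite divr_gt0.
have K0 : 0 < K.
  rewrite ltr_wpDl// mulr_ge0// mulr_ge0 ?cabs_ge0// mulr_ge0// mulr_ge0 ltW//.
have main phi : QP phi -> forall I : R,
    (\int[mu]_(q in D) (cabs (phi q))%:E <= I%:E)%E -> cabs (bargmann nu phi z) <= K * I.
  move=> Q I DI.
  have I0 : 0 <= I.
    by rewrite -lee_fin (le_trans _ DI)// integral_ge0// => x _; rewrite lee_fin cabs_ge0.
  have J : Rintegral mu setT (fun q => cabs (phi q) * expR (- `|q|)) <=
      2 / (1 - expR (- sqrt2)) * I.
    rewrite -lee_fin /Rintegral fineK; last first.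
      by apply: integrable_fin_num => //; exact: quasi_periodic_weighted_integrable.
    apply: le_trans (quasi_periodic_weighted_le Q) _.
    by rewrite [leRHS]EFinM lee_wpmul2l// lee_fin ltW.
  have L : cabs (laplace (gauss_damped phi) w) <=
      2 * (expR ((c + 1) ^+ 2 / (2 * nu)) * (2 / (1 - expR (- sqrt2)) * I)).
    have il := laplace_integrable (gauss_damped_measurable Q) (gauss_damped_integrable Q) w.
    apply: le_trans (cabs_cintegral_le _ il) _ => //.
    rewrite ler_wpM2l//; apply: le_trans (_ : expR ((c + 1) ^+ 2 / (2 * nu)) *
      Rintegral mu setT (fun q => cabs (phi q) * expR (- `|q|)) <= _); last first.
      by rewrite ler_wpM2l// ltW.
    rewrite -RintegralZl//; last exact: quasi_periodic_weighted_integrable.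
    apply: le_Rintegral => //; first exact: cintegrable_cabs.
      have := integrableZl measurableT (expR ((c + 1) ^+ 2 / (2 * nu)))
        (quasi_periodic_weighted_integrable Q).
      exact: eq_integrable.
    move=> q _; apply: le_trans (gauss_damped_le phi c q).
    by rewrite cabsM ler_wpM2l ?cabs_ge0// cabs_exp_le.
  rewrite bargmannE// cabsM cabs_real cabsM /K (mulrDl A 1) mul1r; apply: ler_wpDr => //.
  rewrite /A -[leRHS]mulrA ler_wpM2l// -[leRHS]mulrA ler_wpM2l ?cabs_ge0//.
  by apply: le_trans L _; rewrite !mulrA.
pose t := e / (K * (sqrt2 + 1)).
have t0 : 0 < t by rewrite divr_gt0// mulr_gt0// addr_gt0.
exists (t ^+ 2) => [|phi Q nphi]; first by rewrite exprn_gt0.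
apply: le_trans (main phi Q _ (integral_cabs_le t0 Q)) _.
apply: le_trans (_ : K * (t * (sqrt2 + 1)) <= _); last first.
  by rewrite /t le_eqVlt; apply/orP; left; apply/eqP; field; rewrite !gt_eqF// addr_gt0.
rewrite ler_pM2l//.
have : sqnorm mu D phi / t <= t by rewrite ler_pdivrMr// -expr2 ltW.
have : 0 <= t * sqrt2 by rewrite mulr_ge0 ?ltW.
have := t0; lra.
Qed.

End BargmannTransform.

(** * The basis of the L2 space and its image *)

Section ModeOrthogonality.
Variables (R : realType) (P : R).
Hypothesis P0 : 0 < P.
Local Notation mu := (@lebesgue_measure R).
Local Notation D := (`[0, P]%classic : set R).

Let deriv_integral (F f : R -> R) : continuous f ->
  (forall x : R, is_derive x (1 : R) F (f x)) -> F 0 = F P -> Rintegral mu D f = 0.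
Proof.
move=> cf dF FP.
have cF : continuous F.
  by move=> x; apply: differentiable_continuous; apply/derivable1_diffP; case: (dF x).
rewrite /Rintegral (@continuous_FTC2 _ _ F)//=; first by rewrite FP subrr.
- exact: continuous_subspaceT.
- split.
  + by move=> x _; case: (dF x).
  + by apply: cvg_at_right_filter; exact: cF.
  + by apply: cvg_at_left_filter; exact: cF.
- by move=> x _; rewrite derive1E; case: (dF x).
Qed.

Lemma cintegral_circle_mode (k : int) : k != 0 ->
  cintegral mu D (circle_mode P k) = 0.
Proof.
move=> k0; pose a : R := 2 * pi * k%:~R / P.
have a0 : a != 0.
  rewrite /a mulf_neq0 ?invr_eq0 ?(gt_eqF P0)// mulf_neq0 ?intr_eq0//.
  by rewrite gt_eqF// mulr_gt0// pi_gt0.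
have aP : circle_mode P k P = 1.
  by rewrite -(cexp_2pi R k) /circle_mode mulfK// gt_eqF.
have aE x : circle_mode P k x = cos (a * x) +i* sin (a * x).
  apply: complex_ext; rewrite /circle_mode ?Re_cexp ?Im_cexp !reimE /= !mul0r mul1r
    ?mulr0 ?subr0 ?add0r ?addr0 expR0 mul1r; congr (_ _); rewrite /a; ring.
have [cP sP] : cos (a * P) = 1 /\ sin (a * P) = 0.
  by have := aP; rewrite aE => -[-> ->].
have cl : continuous (fun x : R => a * x).
  by move=> x; apply: cvgM; [exact: cvg_cst|exact: cvg_id].
apply: complex_ext => /=.
- rewrite (eq_Rintegral mu (g := fun x => cos (a * x))); last by move=> x _; rewrite /comp aE.
  apply: (@deriv_integral (fun x => a^-1 * sin (a * x))).
  + by move=> x; apply: continuous_comp; [exact: cl|exact: continuous_cos].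
  + move=> x; apply: is_derive_eq; rewrite /GRing.scale /= ?mulr0 ?add0r ?addr0; by field.
  + by rewrite mulr0 sin0 sP.
- rewrite (eq_Rintegral mu (g := fun x => sin (a * x))); last by move=> x _; rewrite /comp aE.
  apply: (@deriv_integral (fun x => - (a^-1 * cos (a * x)))).
  + by move=> x; apply: continuous_comp; [exact: cl|exact: continuous_sin].
  + move=> x; apply: is_derive_eq; rewrite /GRing.scale /= ?mulr0 ?add0r ?addr0; by field.
  + by rewrite mulr0 cos0 cP.
Qed.

Lemma twisted_modeJ a m n x : twisted_mode P a m x * (twisted_mode P a n x)^*%C =
  circle_mode P (m - n) x.
Proof.
rewrite /twisted_mode cexpJ -cexpD /circle_mode; congr cexp.
rewrite intrB; apply: complex_ext; rewrite !reimE /=; ring.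
Qed.

Lemma twisted_mode_orthogonal a m n :
  inner mu D (twisted_mode P a m) (twisted_mode P a n) = (P * (m == n)%:R)%:C.
Proof.
rewrite /inner (eq_cintegral mu (g := circle_mode P (m - n))); last first.
  by move=> x _; exact: twisted_modeJ.
have [->|mn] := eqVneq m n; last first.
  by rewrite cintegral_circle_mode ?subr_eq0// mulr0.
rewrite subrr mulr1 (eq_cintegral mu (g := fun=> 1)); last first.
  by move=> x _; rewrite circle_mode0.
apply: complex_ext => /=; rewrite Rintegral_cst//= ?mul0r// mul1r.
by rewrite lebesgue_measure_itv/= lte_fin P0 oppr0 adde0.
Qed.

Lemma twisted_mode_square_integrable a n : square_integrable mu D (twisted_mode P a n).
Proof.
split; first exact: cmeasurable_twisted_mode.
rewrite /esqnorm (eq_integral (fun=> 1%:E)); last first.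
  by move=> x _; rewrite cabs2_unimodular.
by rewrite integral_cst//= mul1e lebesgue_measure_itv/= lte_fin P0 oppr0 adde0 ltry.
Qed.

End ModeOrthogonality.

Section BasisImage.
Variables (R : realType) (nu alpha : R).
Hypothesis nu0 : 0 < nu.
Local Notation mu := (@lebesgue_measure R).
Local Notation Re := (@complex.Re R).
Local Notation sqrt2 := (Num.sqrt (2 : R)).
Local Notation D := (`[0, sqrt2]%classic : set R).
Local Notation QP := (quasi_periodic_L2 alpha).

Let s2 : 0 < sqrt2. Proof. by rewrite sqrtr_gt0. Qed.
Let s22 : sqrt2 * sqrt2 = 2. Proof. by rewrite -expr2 sqr_sqrtr. Qed.
Let gam : R := 2 `^ (- 4^-1).
Let gam0 : 0 < gam. Proof. by rewrite powR_gt0. Qed.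
Let gam2 : gam ^+ 2 * sqrt2 = 1.
Proof.
rewrite expr2 -powRD; last by rewrite implybE pnatr_eq0 orbT.
rewrite -powR12_sqrt// -powRD; last by rewrite implybE pnatr_eq0 orbT.
by rewrite (_ : _ + _ = 0) ?powRr0//; field.
Qed.

Lemma L2_basisE n q : L2_basis alpha n q = gam%:C * twisted_mode sqrt2 alpha n q.
Proof.
rewrite /L2_basis /twisted_mode; congr (_ * cexp (_ * _%:C)).
have -> : 2 * pi * (n%:~R + alpha) * q / sqrt2 =
  (sqrt2 * sqrt2) * pi * (n%:~R + alpha) * q / sqrt2 by rewrite s22.
by field; rewrite gt_eqF.
Qed.

Lemma L2_basis_square_integrable n : square_integrable mu D (L2_basis alpha n).
Proof.
have -> : L2_basis alpha n = fun q => gam%:C * twisted_mode sqrt2 alpha n q.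
  by apply/funext => q; exact: L2_basisE.
exact/square_integrableZ/twisted_mode_square_integrable.
Qed.

Lemma L2_basis_translation n (t q : R) : L2_basis alpha n (q + sqrt2 * t) =
  cexp ('i%C * (2 * pi * (n%:~R + alpha) * t)%:C) * L2_basis alpha n q.
Proof.
rewrite /L2_basis.
have -> : 'i%C * (sqrt2 * pi * (n%:~R + alpha) * (q + sqrt2 * t))%:C =
  'i%C * (2 * pi * (n%:~R + alpha) * t)%:C +
  'i%C * (sqrt2 * pi * (n%:~R + alpha) * q)%:C :> R[i].
  have -> : 2 * pi * (n%:~R + alpha) * t = (sqrt2 * sqrt2) * pi * (n%:~R + alpha) * t.
    by rewrite s22.
  by rewrite -mulrDr -rmorphD /=; congr (_ * _%:C); ring.
by rewrite cexpD; move: (cexp _) (cexp _) => a b; ring.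
Qed.

Lemma phase_int n (m : int) :
  cexp ('i%C * (2 * pi * (n%:~R + alpha) * m%:~R : R)%:C) =
  cexp ('i%C * (2 * pi * alpha * m%:~R)%:C).
Proof.
rewrite -[RHS]mul1r -(cexp_2pi R (n * m)) -cexpD -mulrDr -rmorphD /=.
by congr (cexp (_ * _%:C)); rewrite intrM; ring.
Qed.

Lemma L2_basis_quasi_periodic n : QP (L2_basis alpha n).
Proof.
have [_ fin] := L2_basis_square_integrable n.
have [mr mi] : cmeasurable setT (L2_basis alpha n).
  have -> : L2_basis alpha n = fun q => gam%:C * twisted_mode sqrt2 alpha n q.
    by apply/funext => q; exact: L2_basisE.
  by apply: cmeasurableM; [exact: cmeasurable_cst|exact: cmeasurable_twisted_mode].
split => // m; apply: ae_true => q.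
by rewrite L2_basis_translation phase_int.
Qed.

Lemma L2_basis_orthonormal m n :
  inner mu D (L2_basis alpha m) (L2_basis alpha n) = (m == n)%:R.
Proof.
rewrite /inner (eq_cintegral mu (g := fun q => (gam ^+ 2)%:C *
   (twisted_mode sqrt2 alpha m q * (twisted_mode sqrt2 alpha n q)^*%C))); last first.
  move=> q _; rewrite !L2_basisE conjc_mul conjc_real expr2 (real_complexM gam).
  by move: (twisted_mode _ _ m q) ((twisted_mode _ _ n q)^*%C) => a b; ring.
have iD := measurable_itv `[0, sqrt2].
have st k := twisted_mode_square_integrable s2 alpha k.
rewrite cintegralZ//; last exact: integrable_inner (st m) (st n).
transitivity ((gam ^+ 2)%:C * inner mu D (twisted_mode sqrt2 alpha m)
  (twisted_mode sqrt2 alpha n)); first by [].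
rewrite twisted_mode_orthogonal//.
rewrite -rmorphM /= mulrA gam2 mul1r.
by case: (m == n); rewrite ?rmorph1 ?rmorph0.
Qed.

Lemma L2_basis_dense f : square_integrable mu D f -> forall e : R, 0 < e ->
  exists (s : seq int) (c : int -> R[i]), uniq s /\
    sqnorm mu D (fun q => f q - \sum_(n <- s) c n * L2_basis alpha n q) < e.
Proof.
move=> sf e e0; have [s [c [us H]]] := twisted_density s2 alpha sf e0.
exists s, (fun n => c n / gam%:C); split => //.
have -> // : (fun q => f q - \sum_(n <- s) c n / gam%:C * L2_basis alpha n q) =
  (fun q => f q - \sum_(n <- s) c n * twisted_mode sqrt2 alpha n q).
apply/funext => q; congr (_ - _); apply: eq_bigr => n _.
rewrite L2_basisE mulrA divfK//.
by apply/eqP => /(congr1 Re)/= g0; move: gam0; rewrite g0 ltxx.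
Qed.

(** The total mass of a centred normal law. *)
Lemma gauss_integral_scaled (a : R) : 0 < a ->
  Rintegral mu setT (fun q => expR (- (a / 2 * q ^+ 2))) = Num.sqrt (2 * pi / a).
Proof.
move=> a0; pose s : R := (Num.sqrt a)^-1.
have sa : 0 < Num.sqrt a by rewrite sqrtr_gt0.
have s0 : s != 0 by rewrite gt_eqF// invr_gt0.
have s2a : s ^+ 2 = a^-1 by rewrite exprVn sqr_sqrtr// ltW.
have pk : normal_peak s = (Num.sqrt (2 * pi / a))^-1.
  by rewrite /normal_peak s2a; congr ((Num.sqrt _)^-1); rewrite -mulr_natr; ring.
have pk0 : 0 < normal_peak s by exact: normal_peak_gt0.
have E q : normal_pdf 0 s q = normal_peak s * expR (- (a / 2 * q ^+ 2)).
  rewrite normal_pdfE// /normal_fun subr0 s2a; congr (_ * expR _).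
  by rewrite -mulr_natr; field; rewrite gt_eqF.
have := @integral_normal_pdf R 0 s => /(congr1 fine) /=.
have -> : (fine (\int[mu]_x (normal_pdf 0 s x)%:E) =
   Rintegral mu setT (fun q => (normal_peak s * expR (- (a / 2 * q ^+ 2)))%R))%E.
  by apply: eq_Rintegral => q _; rewrite E.
rewrite RintegralZl//; last first.
  have := integrableZl measurableT (normal_peak s)^-1 (@integrable_normal_pdf R 0 s).
  apply: eq_integrable => // q _; rewrite /= -EFinM E mulKf// gt_eqF//.
move=> H; rewrite -[LHS](mulKf (lt0r_neq0 pk0)) H mulr1 pk invrK//.
Qed.

Let pin0 : 0 < nu / pi. Proof. by rewrite divr_gt0// pi_gt0. Qed.

Let constant_identity :
  (nu / pi) `^ (3 / 4) * (gam * Num.sqrt (2 * pi / nu)) = (2 * nu / pi) `^ 4^-1.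
Proof.
have -> : 2 * pi / nu = 2 * (nu / pi)^-1 :> R by rewrite invf_div mulrA.
rewrite -(mulrA 2 nu) [RHS]powRM ?(ltW pin0)// sqrtrM// -!powR12_sqrt ?invr_ge0 ?(ltW pin0)//.
have -> : ((nu / pi)^-1 `^ 2^-1 = (nu / pi) `^ (- 2^-1) :> R).
  by rewrite -powR_inv1 ?(ltW pin0)// -powRrM mulN1r.
have -> : (2 `^ 4^-1 = gam * 2 `^ 2^-1 :> R).
  rewrite -powRD; last by rewrite implybE pnatr_eq0 orbT.
  by congr (_ `^ _); field.
have -> : (nu / pi) `^ 4^-1 = (nu / pi) `^ (3 / 4) * (nu / pi) `^ (- 2^-1) :> R.
  rewrite -powRD; last by rewrite implybE (gt_eqF pin0) orbT.
  by congr (_ `^ _); field.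
ring.
Qed.

Let phase n (z : R[i]) : R[i] := nu%:C / 2 * z ^+ 2 +
  ((- (pi ^+ 2 / nu * (n%:~R + alpha) ^+ 2))%:C +
   'i%C * (2 * pi * (alpha + n%:~R))%:C * z).

Let fock_basisE n z : fock_basis nu alpha n z =
  ((2 * nu / pi) `^ 4^-1)%:C * cexp (phase n z).
Proof. by rewrite /fock_basis /phase [in RHS]cexpD -[in LHS](mulrA _%:C). Qed.

Let phase_translation n z (t : R) : phase n (z + t%:C) =
  'i%C * (2 * pi * (n%:~R + alpha) * t)%:C + nu%:C * (z + t%:C / 2) * t%:C +
  phase n z.
Proof.
rewrite /phase.
have -> : (2 * pi * (n%:~R + alpha) * t)%:C =
  (2 * pi * (alpha + n%:~R))%:C * t%:C :> R[i].
  by rewrite -rmorphM /= (addrC alpha).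
move: (_%:C) (_%:C) ('i%C) (nu%:C) (t%:C) => a b i n' t'.
by field.
Qed.

Let entire_phase n : entire (phase n).
Proof.
apply: entireD.
  apply: entireM; first exact: entire_cst.
  by apply: entireM; exact: entire_id.
apply: entireD; first exact: entire_cst.
by apply: entireM; [exact: entire_cst|exact: entire_id].
Qed.

Lemma entire_fock_basis n : entire (fock_basis nu alpha n).
Proof.
have -> : fock_basis nu alpha n =
    fun z => ((2 * nu / pi) `^ 4^-1)%:C * (@cexp R \o phase n) z.
  by apply/funext => z; exact: fock_basisE.
exact: (entireM (@entire_cst R _) (entire_comp (@entire_phase n) (@entire_cexp R))).
Qed.

(** At the point where the exponent of the integrand is real, the transform of a
    basis element is a real Gaussian integral. *)
Let saddle n : R[i] := 0 +i* (- (pi * (n%:~R + alpha) / nu)).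

Let bargmann_saddle n : bargmann nu (L2_basis alpha n) (saddle n) =
  fock_basis nu alpha n (saddle n).
Proof.
set be := pi * (n%:~R + alpha).
have nz : nu != 0 by rewrite gt_eqF.
rewrite fock_basisE.
have -> : phase n (saddle n) = (be ^+ 2 / (2 * nu))%:C.
  rewrite /phase expr2; apply: complex_ext; rewrite !reimE /=.
    by rewrite !(mul0r, mulr0, sub0r, subr0, add0r, addr0, oppr0) /be; field.
  by rewrite !(mul0r, mulr0, sub0r, subr0, add0r, addr0, oppr0).
have F q : bargmann_integrand nu (L2_basis alpha n) (saddle n) q =
    (gam * expR (be ^+ 2 / (2 * nu)))%:C * (expR (- (nu / 2 * q ^+ 2)))%:C.
  rewrite /bargmann_integrand /L2_basis -/gam -(mulrA gam%:C) -cexpD (real_complexM gam)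
    -(mulrA gam%:C) -!cexp_real -cexpD.
  congr (_ * cexp _); rewrite !expr2; apply: complex_ext; rewrite !reimE /=.
    by rewrite !(mul0r, mulr0, sub0r, subr0, add0r, addr0, oppr0) /be; field.
  rewrite !(mul0r, mulr0, sub0r, subr0, add0r, addr0, oppr0, mul1r) /be.
  by field.
rewrite /bargmann (eq_cintegral mu (g := fun q =>
  (gam * expR (be ^+ 2 / (2 * nu)))%:C * (expR (- (nu / 2 * q ^+ 2)))%:C)); last first.
  by move=> q _; exact: F.
have ig : cintegrable mu setT (fun q => (gam * expR (be ^+ 2 / (2 * nu)))%:C *
    (expR (- (nu / 2 * q ^+ 2)))%:C).
  have := bargmann_exists_quasi_periodic nu0 (L2_basis_quasi_periodic n) (saddle n).
  by have -> : bargmann_integrand nu (L2_basis alpha n) (saddle n) = _ := funext F.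
have c0 : (gam * expR (be ^+ 2 / (2 * nu)))%:C != 0 :> R[i].
  by rewrite fmorph_eq0 gt_eqF// mulr_gt0 ?expR_gt0.
have ig' : cintegrable mu setT (fun q => (expR (- (nu / 2 * q ^+ 2)))%:C).
  have := cintegrableZ measurableT ((gam * expR (be ^+ 2 / (2 * nu)))%:C^-1) ig.
  by under eq_fun do rewrite mulKf//.
rewrite cintegralZ//.
have -> : cintegral mu setT (fun q => (expR (- (nu / 2 * q ^+ 2)))%:C) =
    (Num.sqrt (2 * pi / nu))%:C.
  apply: complex_ext => /=; first by rewrite -gauss_integral_scaled.
  by rewrite (eq_Rintegral mu (g := fun=> 0)) ?Rintegral_cst ?mul0r.
rewrite cexp_real -!rmorphM /= -constant_identity; congr (_%:C).
by rewrite mulrAC -!mulrA; congr (_ * (_ * _)).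
Qed.

(** By translation covariance the transform and the expected function obey the same
    law along the real axis; their quotient is entire and constant on horizontal
    lines, hence constant, and its value is found at one point. *)
Lemma bargmann_L2_basis n : bargmann nu (L2_basis alpha n) = fock_basis nu alpha n.
Proof.
have Q := L2_basis_quasi_periodic n.
pose k z := bargmann nu (L2_basis alpha n) z * cexp (- phase n z).
have ek : entire k.
  apply: entireM; first exact: entire_bargmann Q.
  have -> : (fun z => cexp (- phase n z)) = @cexp R \o (fun z => -1 * phase n z).
    by apply/funext => z /=; rewrite mulN1r.
  apply: entire_comp (@entire_cexp R); apply: entireM; first exact: entire_cst.
  exact: (@entire_phase n).
have kt z (t : R) : k (z + t%:C) = k z.
  have bt := bargmann_translation nu0 Q (ae_true mu (L2_basis_translation n t)) z.
  rewrite /k bt phase_translation.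
  set a := 'i%C * _; set b := nu%:C * _ * _.
  rewrite -[cexp (- phase n z)]mul1r -(cexpN (a + b)) opprD cexpD [cexp (a + b)]cexpD.
  move: (cexp _) (cexp _) (cexp _) (cexp _) => *; ring.
apply/funext => z; have := entire_horizontally_constant ek kt z (saddle n).
rewrite /k bargmann_saddle fock_basisE -mulrA [cexp _ * _]mulrC cexpN mulr1 => kz.
rewrite fock_basisE -kz -mulrA cexpN mulr1//.
Qed.

End BasisImage.

(** * The Fock norm through horizontal slices *)

Section JointMeasurability.
Variable R : realType.
Local Notation RT := (measurableTypeR R).

(** Rounding the first variable down to a multiple of 1 / (n + 1) gives
    functions that are measurable because they glue countably many slices. *)
Lemma separately_continuous_measurable (F : R -> R -> R) :
  (forall y, continuous (F^~ y)) -> (forall x, continuous (F x)) ->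
  measurable_fun [set: RT * RT] (fun p => F p.1 p.2).
Proof.
move=> c1 c2.
pose g (n : nat) (x : R) : R := (Num.floor (n.+1%:R * x))%:~R / n.+1%:R.
have gx n x : `|x - g n x| <= n.+1%:R^-1.
  have n0 : 0 < n.+1%:R :> R by rewrite ltr0n.
  have /andP[f1 f2] := floor_itv (n.+1%:R * x).
  have -> : x - g n x = (n.+1%:R * x - (Num.floor (n.+1%:R * x))%:~R) / n.+1%:R.
    by rewrite /g; field; rewrite gt_eqF.
  rewrite normrM (ger0_norm (_ : 0 <= n.+1%:R^-1)) ?invr_ge0//.
  rewrite ler_piMl ?invr_ge0// ler_norml; move: f1 f2; rewrite intrD; lra.
apply: (measurable_fun_cvg (h := fun n p => F (g n p.1) p.2)) => [n|[x y] _ /=].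
- move=> _ B mB; rewrite setTI.
  pose slab (k : int) : set (RT * RT) :=
    [set x : RT | Num.floor (n.+1%:R * x) = k] `*`
    [set y : RT | B (F (k%:~R / n.+1%:R) y)].
  rewrite (_ : _ @^-1` _ = \bigcup_(k : int) slab k); last first.
    apply/seteqP; split=> [[x y] /= Bxy|[x y] [k _] [/= <-]//].
    by exists (Num.floor (n.+1%:R * x)).
  have mslab k : measurable (slab k).
    apply: measurableX.
      have n0 : 0 < n.+1%:R :> R by rewrite ltr0n.
      rewrite (_ : [set _ | _] = `[k%:~R / n.+1%:R, (k + 1)%:~R / n.+1%:R[%classic).
        exact: measurable_itv.
      apply/seteqP; split=> x /=; rewrite in_itv/= ler_pdivrMr// ltr_pdivlMr// mulrC.
        by move=> <-; rewrite floor_itv.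
      by move=> H; apply/eqP; rewrite floor_eq.
    have := @continuous_measurable_fun R _ (c2 (k%:~R / n.+1%:R)) measurableT B mB.
    by rewrite setTI.
  rewrite (_ : \bigcup_(k : int) slab k =
    \bigcup_(j : nat) (if unpickle j is Some k then slab k else set0)); last first.
    apply/seteqP; split=> p.
      by move=> [k _ sk]; exists (pickle k) => //; rewrite pickleK.
    by move=> [j _]; case: (unpickle j) => [k sk|//]; exists k.
  by apply: bigcupT_measurable => j; case: (unpickle j) => [k|]; [exact: mslab|exact: measurable0].
- have gc : g n x @[n --> \oo] --> x.
    apply/cvgrPdist_le => e e0; near=> n; apply: le_trans (gx n x) _.
    near: n; have := @cvg_harmonic R => /cvgrPdist_le/(_ e e0).
    by apply: filterS => n; rewrite sub0r normrN ger0_norm ?invr_ge0.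
  by apply: (cvg_comp _ (F^~ y) gc); exact: c1.
Unshelve. all: by end_near. Qed.

Lemma entire_measurable (f : R[i] -> R[i]) : entire f ->
  cmeasurable [set: RT * RT] (fun p => f (p.1 +i* p.2)).
Proof.
move=> ef; split.
  have [h1 h2] := entire_continuous_Re ef.
  exact: (@separately_continuous_measurable (fun x y => complex.Re (f (x +i* y)))).
have [h1 h2] := entire_continuous_Im ef.
exact: (@separately_continuous_measurable (fun x y => complex.Im (f (x +i* y)))).
Qed.

End JointMeasurability.

Section StripIntegral.
Variable R : realType.
Local Notation RT := (measurableTypeR R).
Local Notation mu := (@lebesgue_measure R).
Local Notation mu2 := (mu \x mu)%E.
Local Notation strip := (@strip R).
Local Notation I01 := (`[0%R, 1%R]%classic : set RT).

Lemma measurable_strip : measurable (strip : set (RT * RT)).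
Proof. by apply: measurableX; [exact: measurable_itv|exact: measurableT]. Qed.

Let restrict_slice (h : RT * RT -> \bar R) y :
  (\int[mu]_x (h \_ strip) (x, y) = \int[mu]_(x in I01) h (x, y))%E.
Proof.
rewrite [RHS]integral_mkcond; apply: eq_integral => x _; rewrite !patchE.
congr (if _ then _ else _); apply/idP/idP; rewrite !inE.
  by move=> [].
by move=> xI; split.
Qed.

(** The strip is integrated along horizontal segments first, where Fourier series
    apply. *)
Lemma strip_slice_measurable (h : RT * RT -> \bar R) :
  measurable_fun setT h -> (forall p, 0 <= h p)%E ->
  measurable_fun setT (fun y : RT => \int[mu]_(x in I01) h (x, y))%E.
Proof.
move=> mh h0; rewrite (_ : (fun y => _) =
    fubini_G mu (h \_ strip)); last by apply/funext => y; rewrite -restrict_slice.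
apply: measurable_fun_fubini_tonelli_G.
  by apply/(measurable_restrictT h measurable_strip); exact: measurable_funTS.
by move=> p; apply: erestrict_ge0 => x _.
Qed.

Lemma strip_tonelli (h : RT * RT -> \bar R) :
  measurable_fun setT h -> (forall p, 0 <= h p)%E ->
  (\int[mu2]_(p in strip) h p = \int[mu]_y \int[mu]_(x in I01) h (x, y))%E.
Proof.
move=> mh h0; rewrite integral_mkcond fubini_tonelli2.
- by apply: eq_integral => y _; exact: restrict_slice.
- by apply/(measurable_restrictT h measurable_strip); exact: measurable_funTS.
- by move=> p; apply: erestrict_ge0 => x _.
Qed.

Lemma strip_fubini (h : RT * RT -> \bar R) : mu2.-integrable strip h ->
  (\int[mu2]_(p in strip) h p = \int[mu]_y \int[mu]_(x in I01) h (x, y))%E.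
Proof.
move=> ih; rewrite integral_mkcond -integral21_prod_meas1.
  by apply: eq_integral => y _; exact: restrict_slice.
by rewrite -(integrable_mkcond _ measurable_strip).
Qed.

End StripIntegral.

Section FockSlices.
Variables (R : realType) (nu alpha : R).
Hypothesis nu0 : 0 < nu.
Local Notation RT := (measurableTypeR R).
Local Notation mu := (@lebesgue_measure R).
Local Notation mu2 := (mu \x mu)%E.
Local Notation strip := (@strip R).
Local Notation Re := (@complex.Re R).
Local Notation Im := (@complex.Im R).
Local Notation I01 := (`[0%R, 1%R]%classic : set RT).
Local Notation mode := (twisted_mode 1 alpha).
Implicit Types (f g : R[i] -> R[i]).

Let mI : measurable I01. Proof. exact: measurable_itv. Qed.
Let mS : measurable (strip : set (RT * RT)). Proof. exact: measurable_strip. Qed.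

(** Absorbing half of the weight turns the Fock norm into a plain L2 norm. *)
Definition weighted f (p : RT * RT) : R[i] :=
  f (p.1 +i* p.2) * (expR (- (nu / 2 * (p.1 ^+ 2 + p.2 ^+ 2))))%:C.

(** Removing the Gaussian exp (nu z ^ 2 / 2) makes the elements of the Fock
    space periodic up to a phase on each horizontal line. *)
Definition slice f (y x : R) : R[i] :=
  f (x +i* y) * cexp (- (nu%:C / 2 * (x +i* y) ^+ 2)).

Let half_weight (p : RT * RT) :
  expR (- (nu / 2 * (p.1 ^+ 2 + p.2 ^+ 2))) ^+ 2 = fock_weight nu p.
Proof. by rewrite -expRM_natl /fock_weight; congr expR; field. Qed.

Lemma cabs2_weighted f p : cabs2 (weighted f p) =
  cabs2 (f (p.1 +i* p.2)) * fock_weight nu p.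
Proof. by rewrite cabs2M cabs2_real half_weight. Qed.

Lemma fock_normE f : fock_norm nu f = Num.sqrt (sqnorm mu2 strip (weighted f)).
Proof.
congr Num.sqrt; apply: eq_Rintegral => p _.
by rewrite cabs2_weighted.
Qed.

Lemma fock_ipE f g : fock_ip nu f g = inner mu2 strip (weighted f) (weighted g).
Proof.
apply: eq_cintegral => p _; rewrite /weighted conjc_mul conjc_real -half_weight.
rewrite expr2 real_complexM; move: (f _) ((g _)^*%C) (_%:C) => a b c; ring.
Qed.

(** The weights in terms of slices: only exp (- 2 nu y ^ 2) remains. *)
Lemma weighted_slice f g (x y : R) :
  weighted f (x, y) * (weighted g (x, y))^*%C =
  (expR (- (2 * nu * y ^+ 2)))%:C * (slice f y x * (slice g y x)^*%C).
Proof.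
rewrite /weighted /slice 2!conjc_mul conjc_real cexpJ /=.
have E : (expR (- (nu / 2 * (x ^+ 2 + y ^+ 2))))%:C *
    (expR (- (nu / 2 * (x ^+ 2 + y ^+ 2))))%:C =
  (expR (- (2 * nu * y ^+ 2)))%:C * (cexp (- (nu%:C / 2 * (x +i* y) ^+ 2)) *
     cexp (- (nu%:C / 2 * (x +i* y) ^+ 2))^*%C).
  rewrite -!cexp_real -!cexpD; congr cexp; rewrite !expr2.
  by apply: complex_ext; rewrite !reimE /=; field.
move: E; set a := (expR (- (nu / 2 * _)))%:C; set b := (expR _)%:C.
move: (cexp _) (cexp _) (f _) ((g _)^*%C) => c d u v E.
rewrite (_ : u * a * (v * a) = u * v * (a * a)); last by ring.
by rewrite E; ring.
Qed.

Lemma cabs2_weighted_slice f (x y : R) : cabs2 (weighted f (x, y)) =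
  expR (- (2 * nu * y ^+ 2)) * cabs2 (slice f y x).
Proof. by apply: complexI; rewrite real_complexM -!mulcJ weighted_slice. Qed.

Lemma weighted_cmeasurable f : entire f -> cmeasurable [set: RT * RT] (weighted f).
Proof.
move=> ef; apply: cmeasurableM; first exact: entire_measurable.
apply: cmeasurable_real; apply: measurableT_comp => //; apply: measurableT_comp => //.
by apply: measurable_funM => //; apply: measurable_funD; exact: measurable_funX.
Qed.

Let cmeasurable_strip (u : RT * RT -> R[i]) : cmeasurable setT u -> cmeasurable strip u.
Proof. by move=> [ur ui]; split; exact: measurable_funTS. Qed.

Lemma weighted_combination f (s : seq int) (c : int -> R[i]) (b : int -> R[i] -> R[i]) :
  weighted (fun z => f z - \sum_(n <- s) c n * b n z) =
  (fun p => weighted f p - \sum_(n <- s) c n * weighted (b n) p).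
Proof.
apply/funext => p; rewrite /weighted mulrBl mulr_suml; congr (_ - _).
by apply: eq_bigr => n _; rewrite mulrA.
Qed.

Lemma slice_combination f (s : seq int) (c : int -> R[i]) (b : int -> R[i] -> R[i]) y x :
  slice (fun z => f z - \sum_(n <- s) c n * b n z) y x =
  slice f y x - \sum_(n <- s) c n * slice (b n) y x.
Proof.
rewrite /slice mulrBl mulr_suml; congr (_ - _).
by apply: eq_bigr => n _; move: (cexp _) => e; ring.
Qed.

Lemma esqnorm_weighted f : cmeasurable setT (weighted f) ->
  esqnorm mu2 strip (weighted f) =
  (\int[mu]_y ((expR (- (2 * nu * y ^+ 2)))%:E * esqnorm mu I01 (slice f y)))%E /\
  measurable_fun setT (fun y : RT =>
    ((expR (- (2 * nu * y ^+ 2)))%:E * esqnorm mu I01 (slice f y))%E).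
Proof.
move=> mf.
have m2 : measurable_fun setT (fun p => (cabs2 (weighted f p))%:E).
  by apply/measurable_EFinP; exact: measurable_cabs2.
have p2 p : (0 <= (cabs2 (weighted f p))%:E)%E by rewrite lee_fin cabs2_ge0.
have E y : (\int[mu]_(x in I01) (cabs2 (weighted f (x, y)))%:E =
    (expR (- (2 * nu * y ^+ 2)))%:E * esqnorm mu I01 (slice f y))%E.
  rewrite -(@ge0_integralZl_EFin _ _ R mu I01)//.
  - by apply: eq_integral => x _; rewrite cabs2_weighted_slice EFinM.
  - by move=> x _; rewrite lee_fin cabs2_ge0.
  - have m1 := measurable_funTS (D := I01) (measurable_fun_pair1 y m2).
    rewrite (_ : (fun x => _) = (fun x => (expR (- (2 * nu * y ^+ 2)))^-1%:E *
       (cabs2 (weighted f (x, y)))%:E)%E); first exact: measurable_funeM.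
    by apply/funext => x; rewrite cabs2_weighted_slice -EFinM mulKf// gt_eqF// expR_gt0.
split.
  rewrite /esqnorm strip_tonelli//.
  by apply: eq_integral => y _; rewrite E.
rewrite (_ : (fun y => _) =
  (fun y => \int[mu]_(x in I01) (cabs2 (weighted f (x, y)))%:E)%E).
  exact: (strip_slice_measurable m2 p2).
by apply/funext => y; rewrite E.
Qed.

Let peak : R := (2 * nu / pi) `^ 4^-1.

(** The coefficient of the n-th mode in the slice at height y of the n-th basis
    element. *)
Definition fock_coefficient (n : int) (y : R) : R :=
  peak * expR (- (pi ^+ 2 / nu * (n%:~R + alpha) ^+ 2)) *
  expR (- (2 * pi * (n%:~R + alpha) * y)).

Lemma slice_fock_basis n y x :
  slice (fock_basis nu alpha n) y x = (fock_coefficient n y)%:C * mode n x.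
Proof.
rewrite /slice /fock_basis /fock_coefficient -/peak
  [(peak * _ * _)%:C]real_complexM [(peak * _)%:C]real_complexM -!cexp_real /twisted_mode.
set e1 := cexp (nu%:C / 2 * (x +i* y) ^+ 2).
rewrite cexpD; set e2 := cexp (- _)%:C.
have -> : cexp ('i%C * (2 * pi * (alpha + n%:~R))%:C * (x +i* y)) =
   cexp (- (2 * pi * (n%:~R + alpha) * y))%:C *
   cexp ('i%C * (2 * pi * (n%:~R + alpha) * x / 1)%:C).
  by rewrite -cexpD; congr cexp; apply: complex_ext; rewrite !reimE /=; field.
have : cexp (- (nu%:C / 2 * (x +i* y) ^+ 2)) * e1 = 1 by exact: cexpN.
move: (peak%:C) e1 e2 (cexp _) (cexp _) (cexp _) => p e1 e2 c d e' E.
rewrite (_ : p * e1 * (e2 * (d * c)) * e' = (e' * e1) * (p * e2 * d * c)); last by ring.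
by rewrite E mul1r.
Qed.

(** The mass of the n-th basis element at height y is a normal density in y. *)
Let fock_pdf n y : expR (- (2 * nu * y ^+ 2)) * fock_coefficient n y ^+ 2 =
  normal_pdf (- (pi * (n%:~R + alpha) / nu)) (Num.sqrt (4 * nu))^-1 y.
Proof.
set s := (Num.sqrt (4 * nu))^-1.
have n4 : 0 < 4 * nu by rewrite mulr_gt0.
have s0 : s != 0 by rewrite invr_eq0 gt_eqF// sqrtr_gt0.
have s2 : s ^+ 2 = (4 * nu)^-1 by rewrite exprVn sqr_sqrtr// ltW.
have pk : peak ^+ 2 = normal_peak s.
  rewrite /peak -powR_mulrn ?powR_ge0// -powRrM (_ : 4^-1 * 2%:R = 2^-1 :> R); last by field.
  rewrite powR12_sqrt ?divr_ge0 ?pi_ge0 ?mulr_ge0 ?(ltW nu0)// /normal_peak s2 -sqrtrV; last first.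
    by rewrite mulrn_wge0// mulr_ge0 ?pi_ge0// invr_ge0 ltW.
  congr Num.sqrt; rewrite -mulr_natr; have := pi_gt0 R; move: (pi : R) => p p0.
  by field; rewrite !gt_eqF.
rewrite normal_pdfE// /normal_fun s2 /fock_coefficient -pk.
set e0 := expR (- (2 * nu * y ^+ 2)); set e1 := expR (- (pi ^+ 2 / nu * _)).
set e2 := expR (- (2 * pi * _ * y)).
have -> : e0 * (peak * e1 * e2) ^+ 2 = peak ^+ 2 * (e0 * e1 ^+ 2 * e2 ^+ 2) by ring.
congr (_ * _); rewrite /e0 /e1 /e2 -!expRM_natl -!expRD; congr expR.
by rewrite -mulr_natr; field; rewrite gt_eqF.
Qed.

Let mode_sqnorm n : sqnorm mu I01 (mode n) = 1.
Proof.
have := twisted_mode_orthogonal (ltr01 : 0 < 1 :> R) alpha n n.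
by rewrite inner_self; [rewrite eqxx mulr1 => /(congr1 Re)|exact: mI].
Qed.

Lemma weighted_fock_basis_esqnorm n :
  esqnorm mu2 strip (weighted (fock_basis nu alpha n)) = 1%:E.
Proof.
have mw := weighted_cmeasurable (@entire_fock_basis R nu alpha n).
have [-> _] := esqnorm_weighted mw.
rewrite -(integral_normal_pdf (- (pi * (n%:~R + alpha) / nu)) (Num.sqrt (4 * nu))^-1).
apply: eq_integral => y _; rewrite -fock_pdf EFinM; congr (_ * _)%E.
rewrite (eq_esqnorm mu (g := fun x => (fock_coefficient n y)%:C * mode n x)); last first.
  by move=> x _; exact: slice_fock_basis.
rewrite esqnormZ; [|exact: mI|exact: cmeasurable_twisted_mode].
rewrite cabs2_real esqnormE; last exact: twisted_mode_square_integrable.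
by rewrite mode_sqnorm mule1.
Qed.

Lemma weighted_fock_basis_square_integrable n :
  square_integrable mu2 strip (weighted (fock_basis nu alpha n)).
Proof.
split; last by rewrite weighted_fock_basis_esqnorm ltry.
by apply: cmeasurable_strip; exact: weighted_cmeasurable (@entire_fock_basis R nu alpha n).
Qed.

Lemma weighted_fock_basis_orthonormal m n :
  inner mu2 strip (weighted (fock_basis nu alpha m)) (weighted (fock_basis nu alpha n)) =
  (m == n)%:R.
Proof.
have [->|mn] := eqVneq m n.
  rewrite inner_self; last exact: mS.
  rewrite /sqnorm /Rintegral.
  by rewrite [X in fine X](weighted_fock_basis_esqnorm n).
have sm := weighted_fock_basis_square_integrable m.
have sn := weighted_fock_basis_square_integrable n.
have [ir ii] := integrable_inner mS sm sn.
have E x y : weighted (fock_basis nu alpha m) (x, y) *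
    (weighted (fock_basis nu alpha n) (x, y))^*%C =
    (expR (- (2 * nu * y ^+ 2)) * fock_coefficient m y * fock_coefficient n y)%:C *
    circle_mode 1 (m - n) x.
  rewrite weighted_slice !slice_fock_basis conjc_mul conjc_real -(twisted_modeJ 1 alpha).
  rewrite !real_complexM; move: (mode m x) ((mode n x)^*%C) => a b; ring.
have cm0 := cintegral_circle_mode (ltr01 : 0 < 1 :> R) (k := m - n).
have {}cm0 : cintegral mu I01 (circle_mode 1 (m - n)) = 0.
  by apply: cm0; rewrite subr_eq0.
have [cr ci] : cintegrable mu I01 (circle_mode 1 (m - n)).
  have := integrable_inner mI (twisted_mode_square_integrable (ltr01 : 0 < 1 :> R) alpha m)
    (twisted_mode_square_integrable (ltr01 : 0 < 1 :> R) alpha n).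
  by rewrite (_ : (fun x => _) = circle_mode 1 (m - n)) //; apply/funext => x; exact: twisted_modeJ.
have zero (p : R[i] -> R) (pZ : forall r z, p (r%:C * z) = r * p z) :
   mu2.-integrable strip (EFin \o (p \o (fun q => weighted (fock_basis nu alpha m) q *
    (weighted (fock_basis nu alpha n) q)^*%C))) ->
   mu.-integrable I01 (EFin \o (p \o circle_mode 1 (m - n))) ->
   Rintegral mu I01 (p \o circle_mode 1 (m - n)) = 0 ->
   Rintegral mu2 strip (p \o (fun q => weighted (fock_basis nu alpha m) q *
    (weighted (fock_basis nu alpha n) q)^*%C)) = 0.
  move=> i2 i1 z; rewrite /Rintegral strip_fubini// integral0_eq// => y _.
  rewrite (eq_integral (fun x : RT => ((expR (- (2 * nu * y ^+ 2)) * fock_coefficient m y *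
    fock_coefficient n y)%:E * (p (circle_mode 1 (m - n) x))%:E)%E)); last first.
    by move=> x _; rewrite /= E pZ EFinM.
  rewrite integralZl//; have := z; rewrite /Rintegral => z'.
  by rewrite -(fineK (integrable_fin_num mI i1)) z' mule0.
apply: complex_ext; rewrite /inner /cintegral /=.
  apply: zero => //; first by move=> r z; rewrite cReM /= mul0r subr0.
  by have := congr1 Re cm0.
apply: zero => //; first by move=> r z; rewrite cImM /= mul0r addr0.
by have := congr1 Im cm0.
Qed.

End FockSlices.

(** * Completeness of the basis of the Fock space *)

Section SymmetricRange.

(** The integers from - N to N: increasing finite index sets that exhaust the
    integers, as dominated convergence requires a sequence. *)
Definition symmetric_range (N : nat) : seq int :=
  [seq (k%:Z - N%:Z) | k <- iota 0 (N + N).+1].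

Lemma symmetric_range_uniq N : uniq (symmetric_range N).
Proof.
rewrite map_inj_in_uniq ?iota_uniq// => k l _ _ /eqP.
by rewrite (inj_eq (addIr _)) eqz_nat => /eqP.
Qed.

Lemma mem_symmetric_range N (n : int) : (`|n| <= N)%N -> n \in symmetric_range N.
Proof.
move=> nN; apply/mapP; exists `|(n + N%:Z)%R|%N.
  by rewrite mem_iota add0n ltnS; lia.
by rewrite gez0_abs; lia.
Qed.

Lemma sub_symmetric_range (s : seq int) : exists N0, forall N, (N0 <= N)%N ->
  {subset s <= symmetric_range N}.
Proof.
exists (\max_(n <- s) `|n|)%N => N NN n ns; apply: mem_symmetric_range.
by apply: leq_trans NN; apply: leq_bigmax_seq.
Qed.

Lemma symmetric_range_sum (V : zmodType) (s : seq int) N (F : int -> V) :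
  uniq s -> {subset s <= symmetric_range N} ->
  \sum_(n <- symmetric_range N) (if n \in s then F n else 0) = \sum_(n <- s) F n.
Proof.
move=> us ss; rewrite -big_mkcond -big_filter; apply: perm_big.
apply: uniq_perm => //; first by rewrite filter_uniq// symmetric_range_uniq.
move=> n; rewrite mem_filter; apply/andP/idP => [[]//|ns]; split => //.
exact: ss.
Qed.

End SymmetricRange.

Section FockDensity.
Variables (R : realType) (nu alpha : R).
Hypothesis nu0 : 0 < nu.
Local Notation RT := (measurableTypeR R).
Local Notation mu := (@lebesgue_measure R).
Local Notation mu2 := (mu \x mu)%E.
Local Notation strip := (@strip R).
Local Notation I01 := (`[0%R, 1%R]%classic : set RT).
Local Notation mode := (twisted_mode 1 alpha).
Local Notation psi := (fock_basis nu alpha).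
Variable f : R[i] -> R[i].
Hypothesis Qf : quasi_periodic_fock nu alpha f.

Let mI : measurable I01. Proof. exact: measurable_itv. Qed.
Let ef : entire f. Proof. by case: Qf. Qed.

Lemma entire_slice_square_integrable (g : R[i] -> R[i]) (y : R) : entire g ->
  square_integrable mu I01 (fun x => g (x +i* y)).
Proof.
move=> eg; have [/(_ y) cR _] := entire_continuous_Re eg.
have [/(_ y) cI _] := entire_continuous_Im eg.
split.
  by split; apply: measurable_funTS; apply: continuous_measurable_fun;
    [exact: cR|exact: cI].
have c2 : continuous (fun x => cabs2 (g (x +i* y))).
  move=> x; apply: (@cvgD _ R^o).
    by apply: (cvg_comp _ (fun t : R => t ^+ 2) (cR x)); exact: exprn_continuous.
  by apply: (cvg_comp _ (fun t : R => t ^+ 2) (cI x)); exact: exprn_continuous.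
have /integrableP[_] := integrable_itv 0 1 c2.
rewrite /esqnorm; apply: le_lt_trans; rewrite le_eqVlt; apply/orP; left; apply/eqP.
by apply: eq_integral => x _ /=; rewrite ger0_norm ?cabs2_ge0.
Qed.

Let unweighted z := f z * cexp (- (nu%:C / 2 * z ^+ 2)).

Let entire_unweighted : entire unweighted.
Proof.
apply: entireM ef _.
have -> : (fun z => cexp (- (nu%:C / 2 * z ^+ 2))) =
    @cexp R \o (fun z => - (nu%:C / 2) * (z * z)).
  by apply/funext => z /=; rewrite mulNr.
apply: entire_comp (@entire_cexp R); apply: entireM; first exact: entire_cst.
by apply: entireM; exact: entire_id.
Qed.

Let slice_square_integrable y : square_integrable mu I01 (slice nu f y).
Proof. exact: (entire_slice_square_integrable y entire_unweighted). Qed.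

(** Its average over a period is, up to a factor depending on the height, the n-th
    Fourier coefficient of the slice. *)
Let demodulated (n : int) z := unweighted z * cexp (- ('i%C * (2 * pi * (n%:~R + alpha))%:C * z)).

Let entire_demodulated n : entire (demodulated n).
Proof.
apply: entireM entire_unweighted _.
have -> : (fun z => cexp (- ('i%C * (2 * pi * (n%:~R + alpha))%:C * z))) =
    @cexp R \o (fun z => - ('i%C * (2 * pi * (n%:~R + alpha))%:C) * z).
  by apply/funext => z /=; rewrite mulNr.
apply: entire_comp (@entire_cexp R); apply: entireM; first exact: entire_cst.
exact: entire_id.
Qed.

Let demodulated_periodic n z : demodulated n (z + 1) = demodulated n z.
Proof.
have [_ qp _] := Qf; have := qp z 1; rewrite /demodulated /unweighted => ->.
set A := cexp ('i%C * _); set B := cexp (nu%:C * _ * _).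
have E1 : cexp (- (nu%:C / 2 * (z + 1) ^+ 2)) * B = cexp (- (nu%:C / 2 * z ^+ 2)).
  by rewrite /B -cexpD; congr cexp; field.
have E2 : cexp (- ('i%C * (2 * pi * (n%:~R + alpha))%:C * (z + 1))) * A =
    cexp (- ('i%C * (2 * pi * (n%:~R + alpha))%:C * z)).
  have Z1 : cexp (- ('i%C * (2 * pi * n%:~R : R)%:C)) = 1.
    by have := cexpN ('i%C * (2 * pi * n%:~R : R)%:C); rewrite cexp_2pi mulr1.
  rewrite /A -cexpD -[RHS]mulr1 -[X in _ = _ * X]Z1 -cexpD; congr cexp.
  have -> : (2 * pi * (n%:~R + alpha))%:C =
    (2 * pi * n%:~R)%:C + (2 * pi * alpha * 1%:~R)%:C :> R[i].
    by rewrite -rmorphD /= mulr1 mulrDr.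
  by move: (_%:C) => a; move: (_%:C) => b; ring.
rewrite -[in RHS]E1 -[in RHS]E2; move: A B (cexp _) (cexp _) {E1 E2} => A B a b; ring.
Qed.

Let mean (n : int) : R[i] := cintegral mu I01 (fun x => demodulated n (x +i* 0)).

(** Cauchy's theorem turns the Fourier coefficients of the slice at height y into
    a constant times the exponential that the basis element prescribes. *)
Let slice_coefficient n (y : R) : inner mu I01 (slice nu f y) (mode n) =
  (expR (- (2 * pi * (n%:~R + alpha) * y)))%:C * mean n.
Proof.
have -> : mean n = cintegral mu I01 (fun x => demodulated n (x +i* y)).
  have := periodic_entire_integral (@entire_demodulated n) (@demodulated_periodic n).
  by move=> /(_ 0 y).
have [iR iI] := integrable_inner mI (slice_square_integrable y)
  (twisted_mode_square_integrable (ltr01 : 0 < 1 :> R) alpha n).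
have E x : slice nu f y x * (mode n x)^*%C =
    (expR (- (2 * pi * (n%:~R + alpha) * y)))%:C * demodulated n (x +i* y).
  rewrite /slice /demodulated /unweighted /twisted_mode cexpJ -cexp_real.
  have -> : cexp ('i%C * (2 * pi * (n%:~R + alpha) * x / 1)%:C)^*%C =
     cexp (- (2 * pi * (n%:~R + alpha) * y))%:C *
     cexp (- ('i%C * (2 * pi * (n%:~R + alpha))%:C * (x +i* y))).
    by rewrite -cexpD; congr cexp; apply: complex_ext; rewrite !reimE /=; field.
  by move: (cexp _) (cexp _) (cexp _) => a b c; ring.
have e0 : (expR (- (2 * pi * (n%:~R + alpha) * y)))%:C != 0 :> R[i].
  by rewrite fmorph_eq0 gt_eqF// expR_gt0.
have ie : cintegrable mu I01 (fun x =>
    (expR (- (2 * pi * (n%:~R + alpha) * y)))%:C * demodulated n (x +i* y)).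
  by rewrite -(funext E).
have id : cintegrable mu I01 (fun x => demodulated n (x +i* y)).
  have := cintegrableZ mI (expR (- (2 * pi * (n%:~R + alpha) * y)))%:C^-1 ie.
  congr cintegrable; apply/funext => x; exact: mulKf.
by rewrite -cintegralZ//; apply: eq_cintegral => x _; rewrite E.
Qed.

(** The Fourier sum is the best approximation. *)
Let slice_combination_error (s : seq int) y :
  uniq s -> forall c : int -> R[i],
  sqnorm mu I01 (fun x => slice nu f y x -
     \sum_(n <- s) inner mu I01 (slice nu f y) (mode n) * mode n x) <=
  sqnorm mu I01 (fun x => slice nu f y x - \sum_(n <- s) c n * mode n x).
Proof.
move=> us c.
have st n := twisted_mode_square_integrable (ltr01 : 0 < 1 :> R) alpha n.
have ob m n : inner mu I01 (mode m) (mode n) = (m == n)%:R.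
  have := twisted_mode_orthogonal (ltr01 : 0 < 1 :> R) alpha m n; rewrite mul1r => ->.
  by case: (m == n).
rewrite !(bessel mI _ st ob us (slice_square_integrable y)) lerD2l.
rewrite big1 ?sumr_ge0// => [n _|n _]; first exact: cabs2_ge0.
by rewrite subrr cabs2_0.
Qed.

Let slice_error y (e : R) : 0 < e -> exists N0, forall N, (N0 <= N)%N ->
  sqnorm mu I01 (fun x => slice nu f y x -
     \sum_(n <- symmetric_range N) inner mu I01 (slice nu f y) (mode n) * mode n x) < e.
Proof.
move=> e0; have [s [c [us sE]]] :=
  twisted_density (ltr01 : 0 < 1 :> R) alpha (slice_square_integrable y) e0.
have [N0 N0P] := sub_symmetric_range s; exists N0 => N /N0P ss.
apply: le_lt_trans (slice_combination_error y (symmetric_range_uniq N)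
  (fun n => if n \in s then c n else 0)) _.
apply: le_lt_trans sE; rewrite le_eqVlt; apply/orP; left; apply/eqP.
apply: eq_Rintegral => x _; congr (cabs2 (_ - _)).
rewrite -(symmetric_range_sum _ us ss); apply: eq_bigr => n _.
by case: ifP => // _; rewrite mul0r.
Qed.

(** The part of the coefficient of the n-th mode in the n-th basis element that
    does not depend on the height. *)
Let peak (n : int) : R :=
  (2 * nu / pi) `^ 4^-1 * expR (- (pi ^+ 2 / nu * (n%:~R + alpha) ^+ 2)).

Let peak_neq0 n : (peak n)%:C != 0 :> R[i].
Proof.
rewrite fmorph_eq0 gt_eqF// mulr_gt0 ?expR_gt0// powR_gt0//.
by rewrite divr_gt0 ?pi_gt0// mulr_gt0.
Qed.

Definition fock_expansion (n : int) : R[i] := mean n / (peak n)%:C.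

Let remainder N z := f z - \sum_(n <- symmetric_range N) fock_expansion n * psi n z.

(** The heights disappear: at every height the slice of the Fock expansion is the
    Fourier sum of the slice. *)
Let slice_remainder N y x : slice nu (remainder N) y x = slice nu f y x -
  \sum_(n <- symmetric_range N) inner mu I01 (slice nu f y) (mode n) * mode n x.
Proof.
rewrite /remainder slice_combination; congr (_ - _); apply: eq_bigr => n _.
rewrite slice_fock_basis slice_coefficient /fock_expansion /fock_coefficient.
rewrite -/(peak n) real_complexM; move: (mode n x) => m.
have := peak_neq0 n; move: ((peak n)%:C) (_%:C) (mean n) => p a b p0.
by field.
Qed.

Let remainder_measurable N : cmeasurable setT (weighted nu (remainder N)).
Proof.
rewrite /remainder weighted_combination; apply: cmeasurableD.
  exact: weighted_cmeasurable.
apply: cmeasurableN.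
apply: (@cmeasurable_sum _ _ _ _ _ _ (fun n p => fock_expansion n * weighted nu (psi n) p)) => n.
apply: cmeasurableM; first exact: cmeasurable_cst.
exact: weighted_cmeasurable (@entire_fock_basis R nu alpha n).
Qed.

Let fock_norm_finite : (esqnorm mu2 strip (weighted nu f) < +oo)%E.
Proof.
have [_ _] := Qf; apply: le_lt_trans; rewrite le_eqVlt; apply/orP; left; apply/eqP.
by apply: eq_integral => p _; rewrite cabs2_weighted.
Qed.

(** The slice errors tend to 0 at every height, by completeness of the modes, and
    Bessel's inequality dominates them by the slice norms of f. *)
Lemma fock_basis_dense (e : R) : 0 < e -> exists N,
  fock_norm nu (fun z => f z -
    \sum_(n <- symmetric_range N) fock_expansion n * psi n z) < e.
Proof.
move=> e0; pose w (y : R) := expR (- (2 * nu * y ^+ 2)).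
have w0 y : 0 < w y by exact: expR_gt0.
pose F N (y : RT) := ((w y)%:E * esqnorm mu I01 (slice nu (remainder N) y))%E.
pose G (y : RT) := ((w y)%:E * esqnorm mu I01 (slice nu f y))%E.
have [fE mG] := esqnorm_weighted (weighted_cmeasurable nu ef).
have rE N := (esqnorm_weighted (remainder_measurable N)).1.
have mF N := (esqnorm_weighted (remainder_measurable N)).2.
have sr N y : square_integrable mu I01 (slice nu (remainder N) y).
  have -> : slice nu (remainder N) y = fun x => slice nu f y x -
    \sum_(n <- symmetric_range N) inner mu I01 (slice nu f y) (mode n) * mode n x.
    by apply/funext => x; exact: slice_remainder.
  apply: square_integrableB => //; apply: square_integrable_sum => // n.
  exact: twisted_mode_square_integrable.
have rF N y : F N y = (w y * sqnorm mu I01 (fun x => slice nu f y x -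
    \sum_(n <- symmetric_range N) inner mu I01 (slice nu f y) (mode n) * mode n x))%:E.
  rewrite /F esqnormE// EFinM; congr (_ * _%:E)%E; apply: eq_Rintegral => x _.
  by rewrite slice_remainder.
have FG N y : (F N y <= G y)%E.
  rewrite rF /G esqnormE// -EFinM lee_fin ler_wpM2l ?(ltW (w0 y))//.
  apply: le_trans (slice_combination_error y (symmetric_range_uniq N) (fun=> 0)) _.
  rewrite le_eqVlt; apply/orP; left; apply/eqP; apply: eq_Rintegral => x _.
  by rewrite big1 ?subr0// => n _; rewrite mul0r.
have F0 N y : (0 <= F N y)%E by rewrite mule_ge0 ?esqnorm_ge0// lee_fin ltW.
have G0 y : (0 <= G y)%E by rewrite mule_ge0 ?esqnorm_ge0// lee_fin ltW.
have iG : mu.-integrable setT G.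
  apply/integrableP; split => //.
  rewrite (eq_integral G); first by have := fock_norm_finite; rewrite fE.
  by move=> y _; rewrite gee0_abs.
have [] := @dominated_convergence _ RT R mu setT measurableT F (cst 0%E) G.
- by move=> N; exact: mF.
- exact: measurable_cst.
- apply: ae_true => y _; under eq_fun do rewrite rF.
  apply: cvg_EFin; first exact: nearW.
  apply/cvgrPdist_lt => d d0; have [N0 N0P] := slice_error y (divr_gt0 d0 (w0 y)).
  near=> N; rewrite /= sub0r normrN ger0_norm ?mulr_ge0 ?sqnorm_ge0 ?(ltW (w0 y))//.
  rewrite mulrC -ltr_pdivlMr//; apply: N0P.
  by near: N; exact: nbhs_infty_ge.
- exact: iG.
- by apply: ae_true => y N _; rewrite gee0_abs.
move=> _ _; rewrite integral_cst//= mul0e => /fine_cvgP[/= fin].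
have e20 : 0 < e ^+ 2 by rewrite exprn_gt0.
move=> /cvgrPdist_lt/(_ _ e20) lim; near \oo => N; exists N.
have : `|0 - fine (\int[mu]_y F N y)%E| < e ^+ 2 by near: N; exact: lim.
rewrite sub0r normrN ger0_norm ?fine_ge0 ?integral_ge0// => H.
rewrite fock_normE -/(remainder N) -(ger0_norm (ltW e0)) -sqrtr_sqr ltr_sqrt//.
apply: le_lt_trans H; rewrite le_eqVlt; apply/orP; left; apply/eqP.
by rewrite /F -rE.
Unshelve. all: by end_near. Qed.

End FockDensity.

(** * The Bargmann transform is isometric *)

Section BargmannIsometry.
Variables (R : realType) (nu alpha : R).
Hypothesis nu0 : 0 < nu.
Local Notation RT := (measurableTypeR R).
Local Notation mu := (@lebesgue_measure R).
Local Notation mu2 := (mu \x mu)%E.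
Local Notation strip := (@strip R).
Local Notation Re := (@complex.Re R).
Local Notation Im := (@complex.Im R).
Local Notation sqrt2 := (Num.sqrt (2 : R)).
Local Notation D := (`[0, sqrt2]%classic : set RT).
Local Notation QP := (quasi_periodic_L2 alpha).
Local Notation phi_ := (L2_basis alpha).
Local Notation psi_ := (fock_basis nu alpha).
Local Notation A := (bargmann nu).
Implicit Types (f g : R -> R[i]) (s : seq int) (c : int -> R[i]).

Let mD : measurable D. Proof. exact: measurable_itv. Qed.
Let mS : measurable (strip : set (RT * RT)). Proof. exact: measurable_strip. Qed.
Let sq f : QP f -> square_integrable mu D f.
Proof. exact: quasi_periodic_square_integrable. Qed.

Let combination s c q := \sum_(n <- s) c n * phi_ n q.

Let QP0 : QP (fun=> 0).
Proof.
have Q := L2_basis_quasi_periodic alpha 0.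
have := quasi_periodicD (-1) Q Q.
by under eq_fun do rewrite mulN1r addNr.
Qed.

Let bargmann0 : A (fun=> 0) = fun=> 0.
Proof.
have Q := L2_basis_quasi_periodic alpha 0.
have := bargmann_linear nu0 (-1) Q Q.
under eq_fun do rewrite mulN1r addNr.
by move=> ->; apply/funext => z; rewrite mulN1r addNr.
Qed.

Let combination_cons n s c :
  combination (n :: s) c = fun q => c n * phi_ n q + combination s c q.
Proof. by apply/funext => q; rewrite /combination big_cons. Qed.

Let QP_combination s c : QP (combination s c).
Proof.
elim: s => [|n s IH].
  rewrite (_ : combination _ _ = fun=> 0); first exact: QP0.
  by apply/funext => q; rewrite /combination big_nil.
by rewrite combination_cons; apply: quasi_periodicD => //; exact: L2_basis_quasi_periodic.
Qed.

Let bargmann_combination s c : A (combination s c) =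
  fun z => \sum_(n <- s) c n * psi_ n z.
Proof.
elim: s => [|n s IH].
  rewrite (_ : combination _ _ = fun=> 0); last first.
    by apply/funext => q; rewrite /combination big_nil.
  by rewrite bargmann0; apply/funext => z; rewrite big_nil.
rewrite combination_cons (bargmann_linear nu0 _ (L2_basis_quasi_periodic alpha n)
  (QP_combination s c)).
by apply/funext => z; rewrite big_cons bargmann_L2_basis// IH.
Qed.

Let coefficient f n := inner mu D f (phi_ n).

Let quasi_periodicB f g : QP f -> QP g -> QP (fun q => f q - g q).
Proof.
move=> Qf Qg; have := quasi_periodicD (-1) Qg Qf.
by under eq_fun do rewrite mulN1r addrC.
Qed.

Let bargmannB f g : QP f -> QP g ->
  A (fun q => f q - g q) = fun z => A f z - A g z.
Proof.
move=> Qf Qg; have := bargmann_linear nu0 (-1) Qg Qf.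
under eq_fun do rewrite mulN1r addrC.
by move=> ->; apply/funext => z; rewrite mulN1r addrC.
Qed.

Let basis_bessel f s c : uniq s -> QP f ->
  sqnorm mu D (fun q => f q - combination s c q) =
  sqnorm mu D f - \sum_(n <- s) cabs2 (coefficient f n) +
  \sum_(n <- s) cabs2 (c n - coefficient f n).
Proof.
move=> us Qf; exact: (bessel mD c (L2_basis_square_integrable alpha)
  (L2_basis_orthonormal alpha) us (sq Qf)).
Qed.

(** The Fourier coefficients do at least as well as those that density provides;
    the last clause is Parseval's identity up to the error. *)
Let fourier_approximation f (e : R) : QP f -> 0 < e -> exists s,
  [/\ uniq s, sqnorm mu D (fun q => f q - combination s (coefficient f) q) < e &
  sqnorm mu D f = sqnorm mu D (fun q => f q - combination s (coefficient f) q)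
     + \sum_(n <- s) cabs2 (coefficient f n)].
Proof.
move=> Qf e0; have [s [c [us H]]] := L2_basis_dense alpha (sq Qf) e0.
have z0 : \sum_(n <- s) cabs2 (coefficient f n - coefficient f n) = 0.
  by rewrite big1// => n _; rewrite subrr cabs2_0.
exists s; split => //; rewrite basis_bessel// z0 addr0 ?subrK//.
apply: le_lt_trans H; rewrite -/(combination s c) (basis_bessel _ us Qf) lerDl.
by rewrite sumr_ge0// => n _; exact: cabs2_ge0.
Qed.

Let weighted_sum s c : weighted nu (fun z => \sum_(n <- s) c n * psi_ n z) =
  fun p => \sum_(n <- s) c n * weighted nu (psi_ n) p.
Proof.
apply/funext => p; rewrite /weighted mulr_suml; apply: eq_bigr => n _.
by rewrite mulrA.
Qed.

Let esqnorm_combination s c : uniq s ->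
  esqnorm mu2 strip (weighted nu (A (combination s c))) =
  (\sum_(n <- s) cabs2 (c n))%:E.
Proof.
move=> us; rewrite bargmann_combination weighted_sum.
have sw n := weighted_fock_basis_square_integrable alpha nu0 n.
rewrite esqnormE; last exact: square_integrable_sum.
by rewrite (sqnorm_combination mS _ sw (weighted_fock_basis_orthonormal alpha nu0) us).
Qed.

Let weighted_bargmann_measurable f : QP f ->
  cmeasurable [set: RT * RT] (weighted nu (A f)).
Proof. by move=> Qf; apply: weighted_cmeasurable; exact: entire_bargmann Qf. Qed.

Let strip_measurable (u : RT * RT -> R[i]) : cmeasurable setT u -> cmeasurable strip u.
Proof. by move=> [ur ui]; split; exact: measurable_funTS. Qed.

Let limn_einf_le (u : nat -> \bar R) (M : \bar R) : (forall n, u n <= M)%E ->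
  (limn_einf u <= M)%E.
Proof.
move=> uM; rewrite limn_einf_lim; apply: lime_le; first exact: is_cvg_einfs.
apply: nearW => n; apply: le_trans (uM n).
by apply: ereal_inf_lbound; exists n => /=.
Qed.

(** Fatou's lemma along the partial Fourier sums: their transforms converge
    pointwise, and have the norms of these sums, which Bessel's inequality bounds. *)
Let bargmann_contraction f : QP f ->
  (esqnorm mu2 strip (weighted nu (A f)) <= (sqnorm mu D f)%:E)%E.
Proof.
move=> Qf.
have S k : exists s, [/\ uniq s,
   sqnorm mu D (fun q => f q - combination s (coefficient f) q) < k.+1%:R^-1 &
   \sum_(n <- s) cabs2 (coefficient f n) <= sqnorm mu D f].
  have k0 : 0 < k.+1%:R^-1 :> R by rewrite invr_gt0.
  have [s [us H E]] := fourier_approximation Qf k0.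
  by exists s; split => //; rewrite E lerDr sqnorm_ge0.
have [s sP] := choice S.
pose T k := combination (s k) (coefficient f).
have QT k : QP (T k) by exact: QP_combination.
have ptw z (e : R) : 0 < e -> \forall k \near \oo, cabs (A f z - A (T k) z) <= e.
  move=> e0; have [d d0 dP] := @bargmann_small R nu alpha nu0 z e e0.
  have := @cvg_harmonic R => /cvgrPdist_lt/(_ d d0); apply: filterS => k.
  rewrite sub0r normrN ger0_norm ?invr_ge0// => kd.
  have := dP _ (quasi_periodicB Qf (QT k)); rewrite bargmannB//; apply.
  by have [_ + _] := sP k; move=> /lt_trans; apply.
have part (p : R[i] -> R) (pB : forall a b, p (a - b) = p a - p b)
    (pc : forall a, `|p a| <= cabs a) z : p (A (T k) z) @[k --> \oo] --> p (A f z).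
  apply/cvgrPdist_le => e e0; apply: filterS (ptw z e e0) => k; apply: le_trans.
  by rewrite -pB.
have cv p : (cabs2 (weighted nu (A (T k)) p))%:E @[k --> \oo] -->
    (cabs2 (weighted nu (A f) p))%:E.
  apply: cvg_EFin; first exact: nearW.
  rewrite /comp cabs2_weighted; under eq_fun do rewrite /= cabs2_weighted.
  apply: cvgM; last exact: cvg_cst.
  apply: cvgD.
    have H := part Re (fun a b => etrans (cReD _ _) (congr1 _ (cReN _)))
      (@Re_le_cabs R) (p.1 +i* p.2).
    by apply: (cvg_comp _ (fun t : R => t ^+ 2) H); exact: exprn_continuous.
  have H := part Im (fun a b => etrans (cImD _ _) (congr1 _ (cImN _)))
    (@Im_le_cabs R) (p.1 +i* p.2).
  by apply: (cvg_comp _ (fun t : R => t ^+ 2) H); exact: exprn_continuous.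
have := @fatou _ _ R mu2 strip mS (fun k p => (cabs2 (weighted nu (A (T k)) p))%:E).
rewrite (eq_integral (fun p => (cabs2 (weighted nu (A f) p))%:E)); last first.
  by move=> p _; exact: (cvg_limn_einf_sup (cv p)).1.
move=> H; apply: le_trans (H _ _) _.
- move=> k; apply/measurable_EFinP; apply: measurable_cabs2.
  by apply: strip_measurable; exact: weighted_bargmann_measurable.
- by move=> k p _; rewrite lee_fin cabs2_ge0.
apply: limn_einf_le => k; have [us _ le] := sP k.
by rewrite -/(esqnorm mu2 strip (weighted nu (A (T k)))) esqnorm_combination// lee_fin.
Qed.

(** The contraction estimate, applied to the error of a partial Fourier sum,
    upgrades itself to an equality since A preserves the norm of such sums. The
    quasi-triangle inequality with parameter t replaces the triangle inequality;
    the error e tends to 0 first, then t. *)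
Lemma bargmann_isometry f : QP f ->
  esqnorm mu2 strip (weighted nu (A f)) = (sqnorm mu D f)%:E.
Proof.
move=> Qf; have sW : square_integrable mu2 strip (weighted nu (A f)).
  split; first exact/strip_measurable/weighted_bargmann_measurable.
  by apply: le_lt_trans (bargmann_contraction Qf) _; rewrite ltry.
apply/le_anti/andP; split; first exact: bargmann_contraction.
rewrite esqnormE// lee_fin; set n := sqnorm mu D f; set N := sqnorm mu2 _ _.
have N0 : 0 <= N by exact: sqnorm_ge0.
have key (t e : R) : 0 < t -> 0 < e -> n <= (1 + t) * N + (2 + t^-1) * e.
  move=> t0 e0; have [s [us H E]] := fourier_approximation Qf e0.
  set T := combination s _ in H E; have QT : QP T := QP_combination _ _.
  have QfT := quasi_periodicB QT Qf.
  have mW g := fun Qg : QP g => strip_measurable (weighted_bargmann_measurable Qg).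
  have := esqnormD_le mu2 mS t0 (mW _ Qf) (mW _ QfT).
  rewrite (_ : (fun p => _) = weighted nu (A T)); last first.
    by apply/funext => p; rewrite bargmannB// /weighted -mulrDl addrC subrK.
  rewrite esqnorm_combination// (esqnormE sW) -/N => le1.
  have le2 : (esqnorm mu2 strip (weighted nu (A (fun q => T q - f q)%R)) <= e%:E)%E.
    apply: le_trans (bargmann_contraction QfT) _; rewrite lee_fin ltW//.
    apply: le_lt_trans H; rewrite le_eqVlt; apply/orP; left; apply/eqP.
    by apply: eq_Rintegral => q _; rewrite -cabs2N opprB.
  have i0 : 0 < t^-1 by rewrite invr_gt0.
  have {le1}le1 : \sum_(k <- s) cabs2 (coefficient f k) <= (1 + t) * N + (1 + t^-1) * e.
    rewrite -lee_fin EFinD !EFinM; apply: le_trans le1 _; rewrite leeD2l//.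
    by rewrite lee_wpmul2l// lee_fin addr_ge0// ltW.
  have -> : n = sqnorm mu D (fun q => f q - T q) + \sum_(k <- s) cabs2 (coefficient f k).
    exact: E.
  by move: H le1; lra.
have key2 (t : R) : 0 < t -> n <= (1 + t) * N.
  move=> t0; have i0 : 0 < 2 + t^-1 by rewrite addr_gt0// invr_gt0.
  apply/ler_addgt0Pr => e e0; have := key t (e / (2 + t^-1)) t0 (divr_gt0 e0 i0).
  by rewrite [(2 + _) * _]mulrC divfK// gt_eqF.
apply/ler_addgt0Pr => e e0; have N1 : 0 < 1 + N by rewrite ltr_pwDl.
apply: le_trans (key2 (e / (1 + N)) (divr_gt0 e0 N1)) _.
rewrite mulrDl mul1r lerD2l mulrAC ler_pdivrMr// ler_pM2l//.
by rewrite lerDr.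
Qed.

Lemma bargmann_fock f : QP f -> quasi_periodic_fock nu alpha (A f).
Proof.
move=> Qf; split; first exact: entire_bargmann Qf.
- move=> z m; have [_ _ pf _] := Qf.
  by have := bargmann_translation nu0 Qf (pf m) z; rewrite -intC.
- rewrite (_ : (\int[_]_(p in _) _)%E = esqnorm mu2 strip (weighted nu (A f))).
    by rewrite bargmann_isometry// ltry.
  by apply: eq_integral => p _; rewrite cabs2_weighted.
Qed.

Lemma bargmann_norm f : QP f -> fock_norm nu (A f) = L2_norm f.
Proof.
move=> Qf; rewrite fock_normE; congr Num.sqrt.
by rewrite /sqnorm /Rintegral -/(esqnorm mu2 strip (weighted nu (A f))) bargmann_isometry.
Qed.

(** A vanishing L2 norm forces the L1 norm over one period to vanish, hence, by
    the periodization estimate, a weighted L1 norm over the whole line. *)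
Let ae_zero f : QP f -> sqnorm mu D f = 0 -> {ae mu, forall q, f q = 0}.
Proof.
move=> Qf f0.
have I0 : (\int[mu]_(q in D) (cabs (f q))%:E = 0)%E.
  apply/le_anti/andP; split; last by apply: integral_ge0 => x _; rewrite lee_fin cabs_ge0.
  apply/lee_addgt0Pr => e e0; rewrite add0e.
  have s20 : 0 < sqrt2 by rewrite sqrtr_gt0.
  apply: le_trans (integral_cabs_le (divr_gt0 e0 s20) Qf) _.
  rewrite f0 mul0r addr0 divfK ?gt_eqF// lee_fin.
  by rewrite ler_pdivrMr// ler_peMr ?ler1n// ltW.
have := quasi_periodic_weighted_le Qf; rewrite I0 mule0 => le0.
have mf : measurable_fun [set: RT] (fun q => (cabs (f q) * expR (- `|q|))%:E).
  by have := quasi_periodic_weighted_integrable Qf => /integrableP[].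
have /(ae_eq_integral_abs mu measurableT mf) H :
    (\int[mu]_q `|(cabs (f q) * expR (- `|q|))%:E| = 0)%E.
  apply/le_anti/andP; split; last by apply: integral_ge0 => x _; exact: abse_ge0.
  apply: le_trans le0; rewrite le_eqVlt; apply/orP; left; apply/eqP.
  apply: eq_integral => q _; rewrite /= ger0_norm// mulr_ge0 ?expR_ge0//.
  exact: cabs_ge0.
apply: ae_imply H => q /(_ I) [] /eqP; rewrite mulf_eq0 (gt_eqF (expR_gt0 _)) orbF.
by move=> /eqP fq; apply: cabs2_eq0; rewrite -sqr_cabs fq expr0n.
Qed.

Let bargmann_ae f g : QP f -> QP g -> ae_equal f g -> A f = A g.
Proof.
move=> Qf Qg fg; apply/funext => z; rewrite /bargmann; congr (_ * _).
have [/measurable_int fr /measurable_int fi] := bargmann_exists_quasi_periodic nu0 Qf z.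
have [/measurable_int gr /measurable_int gi] := bargmann_exists_quasi_periodic nu0 Qg z.
rewrite /cintegral /Rintegral; congr (fine _ +i* fine _); apply: ae_eq_integral => //;
  by apply: ae_imply fg => q /= E _; rewrite /bargmann_integrand E.
Qed.

Lemma bargmann_isometric_embedding :
  isometric_embedding QP (@ae_equal R) (@L2_norm R)
    (quasi_periodic_fock nu alpha) (fock_norm nu) A.
Proof.
split.
- exact: bargmann_fock.
- move=> f g Qf Qg; split; first exact: bargmann_ae.
  move=> Afg; have QB := quasi_periodicB Qf Qg.
  have A0 : A (fun q => f q - g q) = fun=> 0.
    by rewrite bargmannB// Afg; apply/funext => z; rewrite subrr.
  have n0 : sqnorm mu D (fun q => f q - g q) = 0.
    have := bargmann_isometry QB; rewrite A0 => E; apply: EFin_inj; rewrite -E.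
    by rewrite /esqnorm integral0_eq// => p _; rewrite /weighted mul0r cabs2_0.
  by apply: ae_imply (ae_zero QB n0) => q /eqP; rewrite subr_eq0 => /eqP.
- by move=> c f g Qf Qg; exact: (bargmann_linear nu0 c Qf Qg).
- exact: bargmann_norm.
Qed.

End BargmannIsometry.

Section OrthonormalBases.
Variables (R : realType) (nu alpha : R).
Hypothesis nu0 : 0 < nu.

Lemma L2_orthonormal_basis : orthonormal_basis (quasi_periodic_L2 alpha)
  (@L2_ip R) (@L2_norm R) (L2_basis alpha).
Proof.
split.
- exact: L2_basis_quasi_periodic.
- exact: L2_basis_orthonormal.
- move=> f Qf e e0; have e20 : 0 < e ^+ 2 by rewrite exprn_gt0.
  have [s [c [_ H]]] := L2_basis_dense alpha (quasi_periodic_square_integrable Qf) e20.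
  exists s, c; rewrite /L2_norm -(ger0_norm (ltW e0)) -sqrtr_sqr ltr_sqrt//.
Qed.

Lemma fock_orthonormal_basis : orthonormal_basis (quasi_periodic_fock nu alpha)
  (fock_ip nu) (fock_norm nu) (fock_basis nu alpha).
Proof.
split.
- move=> n; rewrite -bargmann_L2_basis//; apply: bargmann_fock => //.
  exact: L2_basis_quasi_periodic.
- by move=> m n; rewrite fock_ipE; exact: weighted_fock_basis_orthonormal.
- move=> f Qf e e0; have [N H] := fock_basis_dense nu0 Qf e0.
  by exists (symmetric_range N), (fock_expansion nu alpha f).
Qed.

End OrthonormalBases.

Theorem mainTheorem5 (R : realType) (nu alpha : R) (hnu : 0 < nu) :
  [/\ orthonormal_basis (quasi_periodic_L2 alpha) (@L2_ip R) (@L2_norm R)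
        (L2_basis alpha),
      orthonormal_basis (quasi_periodic_fock nu alpha) (fock_ip nu)
        (fock_norm nu) (fock_basis nu alpha),
      forall phi : R -> complex R,
        quasi_periodic_L2 alpha phi -> bargmann_exists nu phi,
      forall n : int,
        bargmann nu (L2_basis alpha n) = fock_basis nu alpha n
    & isometric_embedding (quasi_periodic_L2 alpha) (@ae_equal R) (@L2_norm R)
        (quasi_periodic_fock nu alpha) (fock_norm nu) (bargmann nu)].
Proof.
split.
- exact: L2_orthonormal_basis.
- exact: fock_orthonormal_basis.
- by move=> phi; exact: bargmann_exists_quasi_periodic.
- by move=> n; exact: bargmann_L2_basis.
- exact: bargmann_isometric_embedding.
Qed.
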